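(* Let the circle $S^1$ act symplectically and non-trivially on a closed symplectic manifold $(M,\omega)$ such that $c_1(M)|_{\pi_2(M)}=\lambda\cdot[\omega]|_{\pi_2(M)}$ for some $\lambda\in\mathbb{R}$. Then: (i) If $\lambda>0$, the action is Hamiltonian if and only if it has fixed points. (ii) If $\lambda<0$, the action is non-Hamiltonian and has no fixed points. (iii) If $\lambda=0$, the action is non-Hamiltonian.
   Context: $M$ is connected. $c_1(M)$ is the first Chern class of $(M,\omega)$. A smooth action of $S^1=\mathbb{R}/\mathbb{Z}$ on $M$, generated by the vector field $X$, is symplectic if the $1$-form $\iota_X\omega$ is closed, and Hamiltonian if $\iota_X\omega$ is exact (non-Hamiltonian otherwise). A fixed point of the action is a point fixed by all of $S^1$. *)

(* Defs.v *)
From HB Require Import structures.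
From mathcomp Require Import all_boot all_order all_algebra.
From mathcomp Require Import all_classical all_reals all_analysis.

Set Implicit Arguments.
Unset Strict Implicit.
Unset Printing Implicit Defensive.

Import Order.TTheory GRing.Theory Num.Theory.
Import numFieldNormedType.Exports.

Local Open Scope classical_set_scope.
Local Open Scope ring_scope.

Fixpoint Ck_on (R : realType) (V W : normedModType R) (k : nat) (U : set V)
    (f : V -> W) : Prop :=
  match k with
  | 0 => forall x, U x -> {for x, continuous f}
  | k'.+1 => (forall x, U x -> differentiable f x) /\
             (forall v, Ck_on k' U ('D_v f))
  end.

(* Only used for open [U]. *)
Definition smooth_on (R : realType) (V W : normedModType R) (U : set V)
  (f : V -> W) : Prop := forall k, Ck_on k U f.

Definition partial (R : realType) (n : nat) (W : normedModType R) (i : 'I_n)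
  (f : 'rV[R]_n -> W) (x : 'rV[R]_n) : W := 'D_(delta_mx 0 i : 'rV[R]_n) f x.

(* [fwd] and [bwd] are total functions; their values outside [dom], resp.
   outside the image of [dom], are irrelevant. *)
Record chart (R : realType) (n : nat) (M : topologicalType) := Chart {
  dom : set M;
  fwd : M -> 'rV[R]_n;
  bwd : 'rV[R]_n -> M;
  dom_open : open dom;
  cod_open : open (fwd @` dom);
  fwdK : {in dom, cancel fwd bwd};
  fwd_continuous : forall p, dom p -> {for p, continuous fwd};
  bwd_continuous : forall x, (fwd @` dom) x -> {for x, continuous bwd} }.

Definition cod (R : realType) (n : nat) (M : topologicalType)
  (c : chart R n M) : set 'rV[R]_n := fwd c @` dom c.

Definition transition (R : realType) (n : nat) (M : topologicalType)
  (c c' : chart R n M) : 'rV[R]_n -> 'rV[R]_n := fwd c' \o bwd c.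

Definition overlap (R : realType) (n : nat) (M : topologicalType)
  (c c' : chart R n M) : set 'rV[R]_n := cod c `&` bwd c @^-1` dom c'.

Record smooth_structure (R : realType) (n : nat) (M : topologicalType) :=
  SmoothStructure {
  atlas : set (chart R n M);
  chart_at : M -> chart R n M;
  chart_at_atlas : forall p, atlas (chart_at p);
  mem_chart_at : forall p, dom (chart_at p) p;
  atlas_smooth : forall c c', atlas c -> atlas c' ->
    smooth_on (overlap c c') (transition c c') }.

(* Smoothness of a map from an open subset of a normed space into [M]. *)
Definition smooth_into (R : realType) (n : nat) (M : topologicalType)
    (S : smooth_structure R n M) (V : normedModType R) (U : set V)
    (g : V -> M) : Prop :=
  (forall z, U z -> {for z, continuous g}) /\
  (forall c, atlas S c -> smooth_on (U `&` g @^-1` dom c) (fwd c \o g)).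

(* The tangent space at [p] is 'rV[R]_n, by means of the distinguished chart
  [chart_at S p].  At the point [p]:
  - a vector field X is the row vector [X p];
  - a 1-form a is the column vector [a p], with a(v) = v *m a p;
  - a 2-form w is the matrix [w p], with w(v1, v2) = v1 *m w p *m v2^T;
  - a field of endomorphisms A is the matrix [A p], acting by v |-> v *m A p.
  The functions [oneform_in], [twoform_in], [endo_in] give the components of
  such a field in an arbitrary chart. *)

(* The components of a tangent vector pass from the chart [c] to the
   distinguished chart at [bwd c x] by right multiplication by [frame S c x]. *)
Definition frame (R : realType) (n : nat) (M : topologicalType)
    (S : smooth_structure R n M) (c : chart R n M) (x : 'rV[R]_n) : 'M[R]_n :=
  'J (transition c (chart_at S (bwd c x))) x.

Definition oneform_in (R : realType) (n : nat) (M : topologicalType)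
    (S : smooth_structure R n M) (a : M -> 'cV[R]_n) (c : chart R n M)
    (x : 'rV[R]_n) : 'cV[R]_n :=
  frame S c x *m a (bwd c x).

Definition twoform_in (R : realType) (n : nat) (M : topologicalType)
    (S : smooth_structure R n M) (w : M -> 'M[R]_n) (c : chart R n M)
    (x : 'rV[R]_n) : 'M[R]_n :=
  frame S c x *m w (bwd c x) *m (frame S c x)^T.

Definition endo_in (R : realType) (n : nat) (M : topologicalType)
    (S : smooth_structure R n M) (A : M -> 'M[R]_n) (c : chart R n M)
    (x : 'rV[R]_n) : 'M[R]_n :=
  frame S c x *m A (bwd c x) *m invmx (frame S c x).

Definition closed_oneform (R : realType) (n : nat) (M : topologicalType)
    (S : smooth_structure R n M) (a : M -> 'cV[R]_n) : Prop :=
  forall c x, atlas S c -> cod c x -> forall i j : 'I_n,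
    partial i (fun y => oneform_in S a c y j 0) x =
    partial j (fun y => oneform_in S a c y i 0) x.

Definition exact_oneform (R : realType) (n : nat) (M : topologicalType)
    (S : smooth_structure R n M) (a : M -> 'cV[R]_n) : Prop :=
  exists h : M -> R,
    (forall c, atlas S c -> smooth_on (cod c) (h \o bwd c)) /\
    (forall p (v : 'rV[R]_n),
       'D_v (h \o bwd (chart_at S p)) (fwd (chart_at S p) p) =
       (v *m a p) 0 0).

Definition closed_twoform (R : realType) (n : nat) (M : topologicalType)
    (S : smooth_structure R n M) (w : M -> 'M[R]_n) : Prop :=
  forall c x, atlas S c -> cod c x -> forall i j k : 'I_n,
    partial i (fun y => twoform_in S w c y j k) x +
    partial j (fun y => twoform_in S w c y k i) x +
    partial k (fun y => twoform_in S w c y i j) x = 0.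

Record symplectic_form (R : realType) (n : nat) (M : topologicalType)
    (S : smooth_structure R n M) := SymplecticForm {
  omega :> M -> 'M[R]_n;
  omega_smooth : forall c, atlas S c -> smooth_on (cod c) (twoform_in S omega c);
  omega_skew : forall p, (omega p)^T = - omega p;
  omega_nondegenerate : forall p, omega p \in unitmx;
  omega_closed : closed_twoform S omega }.

(* An action of R/Z is an action of R for which 1 acts as the identity. *)
Record circle_action (R : realType) (n : nat) (M : topologicalType)
    (S : smooth_structure R n M) := CircleAction {
  act :> R -> M -> M;
  act0 : forall p, act 0 p = p;
  actD : forall s t p, act (s + t) p = act s (act t p);
  act1 : forall p, act 1 p = p;
  act_smooth : forall c, atlas S c ->
    smooth_into S [set z : R * 'rV[R]_n | cod c z.2]
                  (fun z : R * 'rV[R]_n => act z.1 (bwd c z.2)) }.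

Definition generator (R : realType) (n : nat) (M : topologicalType)
    (S : smooth_structure R n M) (rho : circle_action S) (p : M) : 'rV[R]_n :=
  derive1 (fun t => fwd (chart_at S p) (rho t p)) 0.

(* The 1-form w(X, -). *)
Definition contraction (R : realType) (n : nat) (M : topologicalType)
    (X : M -> 'rV[R]_n) (w : M -> 'M[R]_n) (p : M) : 'cV[R]_n :=
  (X p *m w p)^T.

Definition symplectic_action (R : realType) (n : nat) (M : topologicalType)
    (S : smooth_structure R n M) (w : symplectic_form S)
    (rho : circle_action S) : Prop :=
  closed_oneform S (contraction (generator rho) w).

Definition hamiltonian_action (R : realType) (n : nat) (M : topologicalType)
    (S : smooth_structure R n M) (w : symplectic_form S)
    (rho : circle_action S) : Prop :=
  exact_oneform S (contraction (generator rho) w).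

Definition nontrivial_action (R : realType) (n : nat) (M : topologicalType)
    (S : smooth_structure R n M) (rho : circle_action S) : Prop :=
  exists t p, rho t p <> p.

Definition fixed_point (R : realType) (n : nat) (M : topologicalType)
    (S : smooth_structure R n M) (rho : circle_action S) (p : M) : Prop :=
  forall t, rho t p = p.

(* c_1(M, w) is the first Chern class of the complex vector bundle (TM, J), for
  any w-compatible almost complex structure J.  It is represented in de Rham
  cohomology by Chern-Weil theory: if F is the curvature of a connection on TM
  that preserves J, then c_1 is the class of (i/2pi) tr_C F.  Up to the exact
  form (i/4pi) tr_R F this is the real form (1/4pi) tr_R (J F), because
  tr_C A = (tr_R A - i tr_R (J A)) / 2 for every complex linear A. *)

Record compatible_acs (R : realType) (n : nat) (M : topologicalType)
    (S : smooth_structure R n M) (w : symplectic_form S) := CompatibleAcs {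
  acs :> M -> 'M[R]_n;
  acs_smooth : forall c, atlas S c -> smooth_on (cod c) (endo_in S acs c);
  acs_square : forall p, acs p *m acs p = - 1%:M;
  acs_invariant : forall p, acs p *m w p *m (acs p)^T = w p;
  acs_positive : forall p (v : 'rV[R]_n), v != 0 ->
    0 < (v *m w p *m (v *m acs p)^T) 0 0 }.

(* The connection is (nabla_i Y) = partial i Y + Y *m christoffel c x i for the
   components of a vector field Y in the chart [c]; the equation below says that
   nabla Y is independent of the chart. *)
Record affine_connection (R : realType) (n : nat) (M : topologicalType)
    (S : smooth_structure R n M) := AffineConnection {
  christoffel :> chart R n M -> 'rV[R]_n -> 'I_n -> 'M[R]_n;
  christoffel_smooth : forall c i, atlas S c ->
    smooth_on (cod c) (fun x => christoffel c x i);
  christoffel_change : forall c c' x i, atlas S c -> atlas S c' ->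
    overlap c c' x ->
    let T y := 'J (transition c c') y in
    partial i T x +
      T x *m (\sum_j T x i j *: christoffel c' (transition c c' x) j) =
    christoffel c x i *m T x }.

Definition preserves_acs (R : realType) (n : nat) (M : topologicalType)
    (S : smooth_structure R n M) (nabla : affine_connection S)
    (J : M -> 'M[R]_n) : Prop :=
  forall c x i, atlas S c -> cod c x ->
    partial i (endo_in S J c) x + endo_in S J c x *m nabla c x i =
    nabla c x i *m endo_in S J c x.

(* nabla_i nabla_j Y - nabla_j nabla_i Y = Y *m curvature nabla c x i j; the
   order of the products is that of the action on row vectors. *)
Definition curvature (R : realType) (n : nat) (M : topologicalType)
    (S : smooth_structure R n M) (nabla : affine_connection S)
    (c : chart R n M) (x : 'rV[R]_n) (i j : 'I_n) : 'M[R]_n :=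
  partial i (fun y => nabla c y j) x - partial j (fun y => nabla c y i) x +
  nabla c x j *m nabla c x i - nabla c x i *m nabla c x j.

Definition chern_weil_form (R : realType) (n : nat) (M : topologicalType)
    (S : smooth_structure R n M) (J : M -> 'M[R]_n)
    (nabla : affine_connection S) (p : M) : 'M[R]_n :=
  let c := chart_at S p in
  \matrix_(i, j) (\tr (J p *m curvature nabla c (fwd c p) i j) / (4 * pi)).

Definition represents_c1 (R : realType) (n : nat) (M : topologicalType)
    (S : smooth_structure R n M) (w : symplectic_form S)
    (sigma : M -> 'M[R]_n) : Prop :=
  exists (J : compatible_acs w) (nabla : affine_connection S),
    preserves_acs nabla J /\ sigma = chern_weil_form J nabla.

(* An element of pi_2(M, p) is the homotopy class, relative to the boundary, of
   a map from the unit square to M that sends the boundary to p.  Such maps are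
   extended by p to the whole plane; likewise homotopies are extended to all
   times. *)
Definition off_square (R : realType) (z : R * R) : Prop :=
  ~ (0 < z.1 < 1 /\ 0 < z.2 < 1).

Definition spheroid (R : realType) (M : topologicalType) (p : M)
    (f : R * R -> M) : Prop :=
  continuous f /\ (forall z, off_square z -> f z = p).

Definition homotopic (R : realType) (M : topologicalType) (p : M)
    (f g : R * R -> M) : Prop :=
  exists H : R * (R * R) -> M,
    [/\ continuous H,
        forall z, H (0, z) = f z,
        forall z, H (1, z) = g z &
        forall t z, off_square z -> H (t, z) = p].

Definition velocity (R : realType) (n : nat) (M : topologicalType)
    (S : smooth_structure R n M) (u : R * R -> M) (z v : R * R) : 'rV[R]_n :=
  'D_v (fwd (chart_at S (u z)) \o u) z.

(* The integral of the 2-form u^* sigma over the unit square. *)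
Definition spheroid_integral (R : realType) (n : nat) (M : topologicalType)
    (S : smooth_structure R n M) (sigma : M -> 'M[R]_n) (u : R * R -> M) : R :=
  Rintegral (@lebesgue_measure R) `[0, 1] (fun s =>
    Rintegral (@lebesgue_measure R) `[0, 1] (fun t =>
      (velocity S u (s, t) (1, 0) *m sigma (u (s, t)) *m
       (velocity S u (s, t) (0, 1))^T) 0 0)).

(* The value of the class of the closed 2-form sigma on the element of
   pi_2(M, p) represented by f is r: integrate over a smooth representative. *)
Definition pi2_value (R : realType) (n : nat) (M : topologicalType)
    (S : smooth_structure R n M) (sigma : M -> 'M[R]_n) (p : M)
    (f : R * R -> M) (r : R) : Prop :=
  exists u : R * R -> M,
    [/\ spheroid p u, smooth_into S setT u, homotopic p f u &
        r = spheroid_integral S sigma u].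

(* c_1(M) = lambda . [w] as functions on pi_2(M). *)
Definition c1_proportional_on_pi2 (R : realType) (n : nat)
    (M : topologicalType) (S : smooth_structure R n M)
    (w : symplectic_form S) (lambda : R) : Prop :=
  exists sigma : M -> 'M[R]_n,
    represents_c1 w sigma /\
    forall (p : M) (f : R * R -> M), spheroid p f ->
    forall a b : R, pi2_value S sigma p f a -> pi2_value S w p f b ->
      a = lambda * b.

(* Main.v *)
(* A path gamma between fixed points p and q sweeps out, under the action, a
   smooth sphere whose symplectic area is, up to sign, the integral of i_X w
   along gamma.  Since each time-a map is symplectic, the complex linear part of
   its differential is invertible, and the covariant logarithmic derivative of
   the complex determinant of that part is a 1-form on the strip (s, a) whose
   exterior derivative is the pullback of the Chern-Weil form.  It vanishes on
   the edges a = 0 and a = 1, so the first Chern number of the sphere is the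
   difference of the mean weights of the action at q and at p, and the hypothesis
   becomes

     mean_weight q - mean_weight p = - 4 pi lambda int_gamma i_X w.

   If lambda <> 0, the case q = p shows that i_X w has no periods, so that the
   action is Hamiltonian as soon as it has a fixed point.  If the action has a
   Hamiltonian h, take for p a minimum and for q a maximum of h.  Both are fixed.
   The Hessian of h is positive semidefinite at p and nonzero, for otherwise the
   action would be trivial near p and hence everywhere; this makes the weight at
   p positive.  Likewise the weight at q is negative, and lambda > 0 follows. *)
Require Import Defs.
From HB Require Import structures.
From mathcomp Require Import all_boot all_order all_algebra.
From mathcomp Require Import all_classical all_reals all_analysis.
From mathcomp Require Import ring lra.

Set Implicit Arguments.
Unset Strict Implicit.
Unset Printing Implicit Defensive.

Import Order.TTheory GRing.Theory Num.Theory.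
Import numFieldNormedType.Exports.

Local Open Scope classical_set_scope.
Local Open Scope ring_scope.

(** * Smooth maps between normed spaces *)

(** The almost complex structure [J] is only compatible with [w]. The action need not preserve it,
    so its differentials need not be complex linear. Their complex linear parts are used instead:
    preservation of [w] makes these invertible, and at an extremum of [h] the sign of the Hessian
    survives as the sign of a trace, that of a semidefinite matrix times one with positive quadratic
    form. The 1-form on the strip belongs to a map between two pulled-back tangent bundles. The
    source, pulled back along [(s, a) -> gamma s], contributes no curvature, so only the Chern-Weil
    form of the target remains. A strip from p to q does not send the boundary of a square to one
    point. The sphere therefore runs back along the path without rotation, a degenerate half without
    area. Stokes' theorem takes the form of differentiation under an iterated integral and the
    fundamental theorem of calculus. A single chart need not contain the strip, so local expressions
    are first shown to be independent of the charts. *)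

Section Calculus.
Variable R : realType.
Implicit Types (V W : normedModType R) (k : nat).

(** An explicit error estimate gives differentiability and the differential together. This serves
    maps known only through their values, such as a potential built from path integrals. *)
Lemma diff_of_bound V W (g : V -> W) x (L : {linear V -> W}) :
  continuous L ->
  (forall e : R, 0 < e -> \forall h \near (0 : V),
     `|g (h + x) - g x - L h| <= e * `|h|) ->
  differentiable g x /\ 'd g x = L :> (V -> W).
Proof.
move=> Lc H.
have E : g \o shift x = cst (g x) + L +o_ (0 : V) id.
  apply/eqaddoP => e e0; near=> h; rewrite /= /shift /=.
  rewrite (_ : (g \o +%R^~ x - (cst (g x) + L)) h = g (h + x) - g x - L h).
    by near: h; apply: H.
  by rewrite /= !fctE /= opprD addrA.
have D : 'd g x = L :> (V -> W) by apply: diff_unique.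
by split => //; apply/diff_locallyP; rewrite D.
Unshelve. all: by end_near. Qed.

Lemma near_eq_differentiable V W (f g : V -> W) x :
  (\forall y \near x, f y = g y) -> differentiable f x -> differentiable g x.
Proof.
move=> fg df; apply: (proj1 (@diff_of_bound V W g x ('d f x) _ _)).
  exact: diff_continuous.
move=> e e0; have /diff_locallyP[_ /eqaddoP/(_ e e0) H] := df.
have gx : f x = g x by apply: (nbhs_singleton fg).
have fg0 : \forall h \near (0 : V), f (h + x) = g (h + x).
  have : ((fun h : V => h + x) @ (0 : V) --> x).
    rewrite -[X in _ --> X]add0r; apply: cvgD; [exact: cvg_id|exact: cvg_cst].
  by move=> /(_ _ fg).
near=> h; rewrite -gx -(near fg0 h) //.
have -> : f (h + x) - f x - 'd f x h = (f \o shift x - (cst (f x) + 'd f x)) h.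
  by rewrite /= !fctE /= opprD addrA.
by near: h.
Unshelve. all: by end_near. Qed.

Lemma Ck_onS V W k (U : set V) (f : V -> W) : Ck_on k.+1 U f -> Ck_on k U f.
Proof.
elim: k f => [|k IH] f [df Df].
  by move=> x Ux; apply: differentiable_continuous; exact: df.
by split => // v; apply: IH.
Qed.

Lemma Ck_on_sub V W k (U U' : set V) (f : V -> W) :
  U' `<=` U -> Ck_on k U f -> Ck_on k U' f.
Proof.
move=> sU; elim: k f => [|k IH] f.
  by move=> H x Ux; exact: (H x (sU x Ux)).
by move=> [df Df]; split => [x Ux|v]; [exact: (df x (sU x Ux))|exact: IH (Df v)].
Qed.

(** Continuity and directional derivatives depend only on the germ, so the induction passes to
    derivatives of the local models. Objects assembled from chart expressions become smooth through
    this lemma. *)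
Lemma Ck_on_local V W k (U : set V) (g : V -> W) :
  (forall x, U x -> exists O : set V, exists f : V -> W,
    [/\ open O, O x, (forall y, O y -> f y = g y) & Ck_on k O f]) ->
  Ck_on k U g.
Proof.
elim: k g => [|k IH] g H.
  move=> x /H [A [f [oA Ax fg cf]]].
  have nf : {near x, g =1 f}.
    by apply: filterS (open_nbhs_nbhs (conj oA Ax)) => y Ay; rewrite fg.
  rewrite /prop_for /continuous_at (nbhs_singleton nf).
  by apply: cvg_trans (cf _ Ax); apply: near_eq_cvg; apply: filterS nf.
split=> [x /H [A [f [oA Ax fg [df _]]]]|v].
  apply: (@near_eq_differentiable _ _ f); last exact: df.
  by apply: filterS (open_nbhs_nbhs (conj oA Ax)) => y; exact: fg.
apply: IH => x /H [A [f [oA Ax fg [_ Df]]]].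
exists A, ('D_v f); split; [by []|by []| |exact: Df] => y Ay; apply: near_eq_derive.
by apply: filterS (open_nbhs_nbhs (conj oA Ay)) => z; exact: fg.
Qed.

Lemma Ck_on_eq V W k (U : set V) (f g : V -> W) : open U ->
  (forall x, U x -> f x = g x) -> Ck_on k U f -> Ck_on k U g.
Proof. by move=> oU fg cf; apply: Ck_on_local => x Ux; exists U, f; split. Qed.

Lemma Ck_on_cst V W k (U : set V) (a : W) : Ck_on k U (fun _ => a).
Proof.
elim: k a => [|k IH] a; first by move=> x _; exact: cst_continuous.
split=> [x _|v]; first exact: differentiable_cst.
rewrite (_ : 'D_v _ = fun _ => 0) //; apply/funext => x; exact: derive_cst.
Qed.

Lemma Ck_on_lin V W k (U : set V) (f : {linear V -> W}) :
  continuous f -> Ck_on k U f.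
Proof.
move=> fc; case: k => [|k]; first by move=> x _; exact: fc.
split=> [x _|v]; first exact: linear_differentiable.
rewrite (_ : 'D_v _ = fun _ => f v); first exact: Ck_on_cst.
apply/funext => x; rewrite deriveE ?diff_lin //.
exact: linear_differentiable.
Qed.

Lemma Ck_on_id V k (U : set V) : Ck_on k U (fun x : V => x).
Proof. by apply: (@Ck_on_lin V V k U idfun) => x; exact: cvg_id. Qed.

Lemma Ck_on_add V W k (U : set V) (f g : V -> W) : open U ->
  Ck_on k U f -> Ck_on k U g -> Ck_on k U (fun x => f x + g x).
Proof.
move=> oU; elim: k f g => [|k IH] f g.
  by move=> cf cg x Ux; apply: cvgD; [exact: cf|exact: cg].
move=> [df Df] [dg Dg]; split=> [x Ux|v].
  by apply: differentiableD; [exact: df|exact: dg].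
apply: (Ck_on_eq oU _ (IH _ _ (Df v) (Dg v))) => x Ux.
by rewrite -deriveD //; apply: diff_derivable; [exact: df|exact: dg].
Qed.

Lemma Ck_on_sum V W k (U : set V) (I : Type) (r : seq I) (P : pred I)
    (f : I -> V -> W) : open U -> (forall i, P i -> Ck_on k U (f i)) ->
  Ck_on k U (fun x => \sum_(i <- r | P i) f i x).
Proof.
move=> oU H; elim: r => [|i r IH].
  rewrite (_ : (fun _ => _) = fun _ => 0); first exact: Ck_on_cst.
  by apply/funext => x; rewrite big_nil.
case Pi : (P i).
  rewrite (_ : (fun _ => _) = fun x => f i x + \sum_(j <- r | P j) f j x).
    by apply: Ck_on_add => //; exact: H.
  by apply/funext => x; rewrite big_cons Pi.
rewrite (_ : (fun _ => _) = fun x => \sum_(j <- r | P j) f j x) //.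
by apply/funext => x; rewrite big_cons Pi.
Qed.

Lemma Ck_on_mul V k (U : set V) (f g : V -> R) : open U ->
  Ck_on k U f -> Ck_on k U g -> Ck_on k U (fun x => f x * g x).
Proof.
move=> oU; elim: k f g => [|k IH] f g.
  by move=> cf cg x Ux; apply: cvgM; [exact: cf|exact: cg].
move=> cf cg; have [df Df] := cf; have [dg Dg] := cg; split=> [x Ux|v].
  by apply: differentiableM; [exact: df|exact: dg].
have H : Ck_on k U (fun x => f x * 'D_v g x + g x * 'D_v f x).
  apply: (Ck_on_add oU); apply: IH.
  - exact: Ck_onS cf.
  - exact: Dg.
  - exact: Ck_onS cg.
  - exact: Df.
apply: (Ck_on_eq oU _ H) => x Ux.
rewrite [RHS]deriveM //; apply: diff_derivable; [exact: df|exact: dg].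
Qed.

Lemma Ck_on_prod V k (U : set V) (I : Type) (r : seq I)
    (f : I -> V -> R) : open U -> (forall i, Ck_on k U (f i)) ->
  Ck_on k U (fun x => \prod_(i <- r) f i x).
Proof.
move=> oU H; elim: r => [|i r IH].
  rewrite (_ : (fun _ => _) = fun _ => 1); first exact: Ck_on_cst.
  by apply/funext => x; rewrite big_nil.
rewrite (_ : (fun _ => _) = fun x => f i x * \prod_(j <- r) f j x).
  by apply: Ck_on_mul => //; exact: H.
by apply/funext => x; rewrite big_cons.
Qed.

Lemma Ck_on_opp V W k (U : set V) (f : V -> W) : open U ->
  Ck_on k U f -> Ck_on k U (fun x => - f x).
Proof.
move=> oU; elim: k f => [|k IH] f; first by move=> cf x Ux; apply: cvgN; exact: cf.
move=> [df Df]; split=> [x Ux|v]; first by apply: differentiableN; exact: df.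
apply: (Ck_on_eq oU _ (IH _ (Df v))) => x Ux.
by rewrite -deriveN //; apply: diff_derivable; exact: df.
Qed.

Lemma Ck_on_sub_fun V W k (U : set V) (f g : V -> W) : open U ->
  Ck_on k U f -> Ck_on k U g -> Ck_on k U (fun x => f x - g x).
Proof. by move=> oU cf cg; apply: Ck_on_add => //; exact: Ck_on_opp oU cg. Qed.

Lemma Ck_on_inv V k (U : set V) (f : V -> R) : open U ->
  (forall x, U x -> f x != 0) -> Ck_on k U f -> Ck_on k U (fun x => (f x)^-1).
Proof.
move=> oU f0; elim: k => [|k IH].
  by move=> cf x Ux; apply: cvgV; [exact: f0|exact: cf].
move=> cf; have [df Df] := cf; split=> [x Ux|v].
  by apply: differentiableV; [exact: df|exact: f0].
have H : Ck_on k U (fun x => - ((f x)^-1 * ((f x)^-1 * 'D_v f x))).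
  have ci := IH (Ck_onS cf).
  by apply: (Ck_on_opp oU); do 2!apply: (Ck_on_mul oU ci); exact: Df.
apply: (Ck_on_eq oU _ H) => x Ux.
rewrite [RHS]deriveV ?f0 //; last by apply: diff_derivable; exact: df.
by rewrite mulrA -exprVn expr2 scaleNr.
Qed.

Lemma differentiable_mxP V m n (f : V -> 'M[R]_(m, n)) x :
  (forall i j, differentiable (fun y => f y i j) x) -> differentiable f x.
Proof.
move=> H.
have -> : f = \sum_(i < m) (\sum_(j < n) (fun y => f y i j *: delta_mx i j)).
  apply/funext => y; rewrite fct_sumE [LHS]matrix_sum_delta; apply: eq_bigr => i _.
  by rewrite fct_sumE.
apply: differentiable_sum => i; apply: differentiable_sum => j.
exact: differentiableZl.
Qed.

Lemma derive_mx_entry V m n (f : V -> 'M[R]_(m, n)) x v i j :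
  derivable f x v -> ('D_v f x) i j = 'D_v (fun y => f y i j) x.
Proof. by move=> df; rewrite derive_mx // mxE. Qed.

Lemma Ck_on_entry V k m n (U : set V) (f : V -> 'M[R]_(m, n)) i j : open U ->
  Ck_on k U f -> Ck_on k U (fun x => f x i j).
Proof.
move=> oU; elim: k f => [|k IH] f.
  move=> cf x Ux; apply: (@continuous_comp _ _ _ f (fun M : 'M[R]_(m, n) => M i j)).
    exact: cf.
  exact: coord_continuous.
move=> [df Df]; split=> [x Ux|v].
  apply: (@differentiable_comp _ _ _ _ f (fun M : 'M[R]_(m, n) => M i j : R)).
    exact: df.
  exact: differentiable_coord.
apply: (Ck_on_eq oU _ (IH _ (Df v))) => x Ux.
by rewrite derive_mx_entry //; apply: diff_derivable; exact: df.
Qed.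

Lemma Ck_on_mx V k m n (U : set V) (f : V -> 'M[R]_(m, n)) : open U ->
  (forall i j, Ck_on k U (fun x => f x i j)) -> Ck_on k U f.
Proof.
move=> oU; elim: k f => [|k IH] f H.
  move=> x Ux.
  have -> : f = fun y => \sum_i \sum_j f y i j *: delta_mx i j.
    by apply/funext => y; rewrite [LHS]matrix_sum_delta.
  rewrite /prop_for /continuous_at; apply: cvg_big => [|i _].
    exact: add_continuous.
  apply: cvg_big => [|j _]; first exact: add_continuous.
  by apply: cvgZr_tmp; exact: H.
have df x : U x -> differentiable f x.
  by move=> Ux; apply: differentiable_mxP => i j; have [+ _] := H i j; apply.
split=> // v; apply: IH => i j; have [_ /(_ v) Df] := H i j.
apply: (Ck_on_eq oU _ Df) => x Ux.
by rewrite derive_mx_entry //; apply: diff_derivable; exact: df.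
Qed.

Lemma Ck_on_pair V W W' k (U : set V) (f : V -> W) (g : V -> W') : open U ->
  Ck_on k U f -> Ck_on k U g -> Ck_on k U (fun x => (f x, g x)).
Proof.
move=> oU; elim: k f g => [|k IH] f g.
  by move=> cf cg x Ux; apply: cvg_pair; [exact: cf|exact: cg].
move=> [df Df] [dg Dg]; split=> [x Ux|v].
  by apply: differentiable_pair; [exact: df|exact: dg].
apply: (Ck_on_eq oU _ (IH _ _ (Df v) (Dg v))) => x Ux.
have dfx := df _ Ux; have dgx := dg _ Ux.
rewrite [RHS]deriveE; last exact: differentiable_pair.
by rewrite diff_pair // !deriveE.
Qed.

Lemma Ck_on_lin_comp V W W' k (U : set V) (f : V -> W) (L : {linear W -> W'}) :
  open U -> continuous L -> Ck_on k U f -> Ck_on k U (fun x => L (f x)).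
Proof.
move=> oU cL; elim: k f => [|k IH] f.
  move=> cf x Ux; apply: (@continuous_comp _ _ _ f L); first exact: cf.
  exact: cL.
move=> [df Df]; split=> [x Ux|u].
  apply: (@differentiable_comp _ _ _ _ f L); first exact: df.
  exact: linear_differentiable.
apply: (Ck_on_eq oU _ (IH _ (Df u))) => x Ux.
have dfx := df _ Ux; have dL := linear_differentiable (f x) cL.
rewrite [RHS](deriveE _ (differentiable_comp dfx dL)).
by rewrite (diff_comp dfx dL) /= diff_lin // deriveE.
Qed.

(* A finite frame makes the chain rule a finite sum of products. *)
Definition finite_dim W := exists (m : nat) (e : 'I_m -> W)
  (c : 'I_m -> {linear W -> R}),
  (forall i, continuous (c i)) /\ forall w, w = \sum_i c i w *: e i.

(** With target [R] the chain rule only involves products of scalar functions; matrix-valued maps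
    follow entrywise. *)
Lemma Ck_on_comp V W k (U : set V) (O : set W) (f : V -> W) (g : W -> R) :
  finite_dim W -> open U -> (forall x, U x -> O (f x)) ->
  Ck_on k U f -> Ck_on k O g -> Ck_on k U (fun x => g (f x)).
Proof.
move=> [m [e [c [cc ec]]]] oU fO; elim: k f g fO => [|k IH] f g fO.
  move=> cf cg x Ux; apply: (@continuous_comp _ _ _ f g); first exact: cf.
  by apply: cg; exact: fO.
move=> cf cg; have [df Df] := cf; have [dg Dg] := cg; split=> [x Ux|v].
  apply: (@differentiable_comp _ _ _ _ f g); first exact: df.
  by apply: dg; exact: fO.
(* The chain rule in the frame [e]; the induction hypothesis treats the partial derivatives of [g],
   with [f] seen as a C^k map. *)
have H : Ck_on k U (fun x => \sum_i c i ('D_v f x) * 'D_(e i) g (f x)).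
  apply: Ck_on_sum => // i _; apply: Ck_on_mul => //.
    exact: (Ck_on_lin_comp oU (cc i) (Df v)).
  exact: (IH f ('D_(e i) g) fO (Ck_onS cf) (Dg _)).
apply: (Ck_on_eq oU _ H) => x Ux.
have dfx := df _ Ux; have dgx := dg _ (fO _ Ux).
rewrite [RHS](deriveE _ (differentiable_comp dfx dgx)).
rewrite (diff_comp dfx dgx) /= -(deriveE _ dfx).
rewrite [in RHS](ec ('D_v f x)) linear_sum; apply: eq_bigr => i _.
by rewrite linearZ /= (deriveE _ dgx).
Qed.

Lemma finite_dim_R : finite_dim R.
Proof.
exists 1, (fun _ => 1), (fun _ => idfun); split => [_ x|w]; first exact: cvg_id.
by rewrite big_ord1 /= /GRing.scale /= mulr1.
Qed.

Lemma finite_dim_mx m n : finite_dim 'M[R]_(m, n).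
Proof.
have Hl (p : 'I_m * 'I_n) : linear (fun M : 'M[R]_(m, n) => M p.1 p.2 : R).
  by move=> a M N; rewrite !mxE.
pose cl p : {linear 'M[R]_(m, n) -> R} :=
  HB.pack (fun M : 'M[R]_(m, n) => M p.1 p.2 : R) (GRing.isLinear.Build _ _ _ _ _ (Hl p)).
exists #|{: 'I_m * 'I_n}|, (fun i => delta_mx (enum_val i).1 (enum_val i).2),
  (fun i => cl (enum_val i)); split=> [i|M].
  exact: coord_continuous.
rewrite [LHS]matrix_sum_delta pair_big /= (reindex (@enum_val _ [pred _ | true])) //=.
exact/onW_bij/enum_val_bij.
Qed.

Lemma finite_dim_pair V W : finite_dim V -> finite_dim W ->
  finite_dim (V * W)%type.
Proof.
move=> [m [e [c [cc ec]]]] [m' [e' [c' [cc' ec']]]].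
have Hl1 i : linear (fun z : V * W => c i z.1 : R) by move=> a z z'; rewrite linearP.
have Hl2 i : linear (fun z : V * W => c' i z.2 : R) by move=> a z z'; rewrite linearP.
pose cl1 i : {linear (V * W)%type -> R} :=
  HB.pack (fun z : V * W => c i z.1 : R) (GRing.isLinear.Build _ _ _ _ _ (Hl1 i)).
pose cl2 i : {linear (V * W)%type -> R} :=
  HB.pack (fun z : V * W => c' i z.2 : R) (GRing.isLinear.Build _ _ _ _ _ (Hl2 i)).
exists (m + m')%N,
  (fun i : 'I_(m + m') => match fintype.split i with inl j => (e j, 0) | inr j => (0, e' j) end),
  (fun i : 'I_(m + m') => match fintype.split i with inl j => cl1 j | inr j => cl2 j end); split.
  move=> i; case: (fintype.split i) => j z.
    apply: (@continuous_comp _ _ _ (fun z : V * W => z.1) (c j)); last exact: cc.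
    exact: cvg_fst.
  apply: (@continuous_comp _ _ _ (fun z : V * W => z.2) (c' j)); last exact: cc'.
  exact: cvg_snd.
move=> [v w]; rewrite big_split_ord /=.
under eq_bigr => i _ do rewrite (unsplitK (inl i)) /=.
under [X in _ + X]eq_bigr => i _ do rewrite (unsplitK (inr i)) /=.
have -> : \sum_(i < m) c i v *: (e i, 0 : W) = (v, 0).
  rewrite [in RHS](ec v); elim/big_rec2: _ => //= i y [z1 z2] _ ->.
  by congr (_, _); rewrite /= scaler0 add0r.
have -> : \sum_(i < m') c' i w *: (0 : V, e' i) = (0, w).
  rewrite [in RHS](ec' w); elim/big_rec2: _ => //= i y [z1 z2] _ ->.
  by congr (_, _); rewrite /= scaler0 add0r.
by congr (_, _); rewrite /= ?addr0 ?add0r.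
Qed.

End Calculus.

(** * The mean value theorem on lines *)

Section OneVariable.
Variable R : realType.
Implicit Types (V W : normedModType R).

Lemma is_derive_line V W (f : V -> W) (a v : V) (s : R) :
  differentiable f (a + s *: v) ->
  is_derive s 1 (fun s : R => f (a + s *: v)) ('D_v f (a + s *: v)).
Proof.
move=> df.
pose l (s : R) := a + s *: v.
have dl : is_diff s l (fun s : R => s *: v).
  apply: (is_diff_eq (is_diffD (is_diff_cst a s) (is_diff_scalel s v))).
  exact: add0r.
have dfl : differentiable f (l s) by [].
have dl' : differentiable l s by [].
have dc : differentiable (f \o l) s by exact: differentiable_comp.
rewrite -[fun s => _]/(f \o l) -/(l s); split.
  by apply: diff_derivable; exact: dc.
by rewrite (deriveE _ dc) (diff_comp dl' dfl) /= diff_val scale1r deriveE.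
Qed.

Lemma MVT_line V (f : V -> R) (a v : V) (h : R) : 0 < h ->
  (forall s, 0 <= s <= h -> differentiable f (a + s *: v)) ->
  exists c, 0 < c < h /\ f (a + h *: v) - f a = h * 'D_v f (a + c *: v).
Proof.
move=> h0 df.
have [| |c] := @MVT R (fun s : R => f (a + s *: v))
    (fun s => 'D_v f (a + s *: v)) 0 h h0.
- move=> x; rewrite in_itv /= => /andP[x0 xh]; apply: is_derive_line.
  by apply: df; rewrite !ltW.
- apply/continuous_in_subspaceT => x; rewrite inE /= in_itv /= => xh.
  apply: differentiable_continuous; apply/derivable1_diffP.
  by have [] := is_derive_line (df x xh).
move=> ch; rewrite scale0r addr0 subr0 => E.
move: ch; rewrite in_itv /= => ch.
by exists c; split => //; rewrite E mulrC.
Qed.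

Lemma line_near V (x v w : V) (U : set V) : nbhs x U ->
  exists2 h : R, 0 < h & forall s t : R, 0 <= s <= h -> 0 <= t <= h ->
    U (x + s *: v + t *: w).
Proof.
move=> /nbhs_ballP[r /= r0 H].
have m0 : 0 < `|v| + `|w| + 1 by rewrite ltr_wpDl // addr_ge0.
(* Adding 1 keeps the denominator positive when both directions vanish; the half makes the final
   bound strict. *)
exists (r / 2 / (`|v| + `|w| + 1)); first by rewrite !divr_gt0.
move=> s t /andP[s0 sh] /andP[t0 th]; apply: H.
rewrite -ball_normE /ball_ /= -addrA opprD addrA subrr sub0r normrN.
apply: (@le_lt_trans _ _ (r / 2)); last by rewrite gtr_pMr // invf_lt1 ?ltr1n.
rewrite (le_trans (ler_normD _ _)) // !normrZ !ger0_norm //.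
rewrite ler_pdivlMr // in sh; rewrite ler_pdivlMr // in th.
move: (normr_ge0 v) (normr_ge0 w) sh th.
move: `|v| `|w| => p q p0 q0 sh th.
have := ler_wpM2r p0 (lexx s); nra.
Qed.

(** The mean value theorem is applied twice: along [v] to the difference [g] of [f] on two parallel
    segments, then along [w] to ['D_v f]. *)
Lemma second_difference V (f : V -> R) (x v w : V) (h : R) : 0 < h ->
  (forall s t : R, 0 <= s <= h -> 0 <= t <= h ->
     differentiable f (x + s *: v + t *: w) /\
     differentiable ('D_v f) (x + s *: v + t *: w)) ->
  exists c d, [/\ 0 <= c <= h, 0 <= d <= h &
   f (x + h *: v + h *: w) - f (x + h *: v) - (f (x + h *: w) - f x) =
   h * (h * 'D_w ('D_v f) (x + c *: v + d *: w))].
Proof.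
move=> h0 H.
have h0' : 0 <= h <= h by rewrite lexx ltW.
have z0' : 0 <= (0 : R) <= h by rewrite lexx ltW.
pose g s := f (x + s *: v + h *: w) - f (x + s *: v).
have dg s : 0 <= s <= h ->
    is_derive s 1 g ('D_v f (x + s *: v + h *: w) - 'D_v f (x + s *: v)).
  move=> sh; apply: is_deriveB.
    rewrite addrAC (_ : (fun _ => _) = fun s => f (x + h *: w + s *: v)); last first.
      by apply/funext => y; rewrite addrAC.
    by apply: is_derive_line; rewrite addrAC; have [] := H _ _ sh h0'.
  by apply: is_derive_line; have [] := H _ _ sh z0'; rewrite scale0r addr0.
have [| |c cin E] := @MVT R g
    (fun s => 'D_v f (x + s *: v + h *: w) - 'D_v f (x + s *: v)) 0 h h0.
- move=> s; rewrite in_itv /= => /andP[s0 sh]; apply: dg.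
  by rewrite !ltW.
- apply/continuous_in_subspaceT => s; rewrite inE /= in_itv /= => sh.
  by apply: differentiable_continuous; apply/derivable1_diffP; have [] := dg s sh.
move: cin; rewrite in_itv /= => /andP[c0 ch].
have ch' : 0 <= c <= h by rewrite !ltW.
have [|d [/andP[d0 dh] E2]] := @MVT_line V ('D_v f) (x + c *: v) w h h0.
  by move=> s sh; have [] := H _ _ ch' sh.
exists c, d; split => //; first by rewrite !ltW.
rewrite -E2 mulrC -[X in _ * X]subr0 -E /g scale0r addr0; ring.
Qed.

Lemma lt_quarters_False (e p q z : R) :
  e = `|p - q| -> `|p - z| < e / 4 -> `|q - z| < e / 4 -> False.
Proof.
move=> Ee pz qz; have e0 : 0 <= e by rewrite Ee.
have : e < e / 4 + e / 4.
  rewrite [ltLHS]Ee (_ : p - q = (p - z) - (q - z)); last by ring.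
  by rewrite (le_lt_trans (ler_normB _ _)) // ltrD.
by lra.
Qed.

(** The second difference is symmetric in [v] and [w], so on a small parallelogram both mixed
    derivatives take a common value at points close to [x]. If they differed at [x] by [e],
    continuity would put that value within [e / 4] of both. *)
Lemma schwarz V (f : V -> R) (U : set V) (v w : V) (x : V) : open U -> U x ->
  Ck_on 2 U f -> 'D_v ('D_w f) x = 'D_w ('D_v f) x.
Proof.
move=> oU Ux [df Df].
have cvw : {for x, continuous ('D_v ('D_w f))}.
  by have [_ /(_ v)] := Df w; apply.
have cwv : {for x, continuous ('D_w ('D_v f))}.
  by have [_ /(_ w)] := Df v; apply.
apply/eqP; rewrite -subr_eq0 -normr_eq0; apply/negPn/negP => n0.
set e := `|_| in n0; have e0 : 0 < e by rewrite lt_def n0 normr_ge0.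
have e4 : 0 < e / 4 by rewrite divr_gt0.
have N : nbhs x (fun y => [/\ U y,
    `|'D_v ('D_w f) x - 'D_v ('D_w f) y| < e / 4 &
    `|'D_w ('D_v f) x - 'D_w ('D_v f) y| < e / 4]).
  have H1 := open_nbhs_nbhs (conj oU Ux).
  move/cvgrPdist_lt: cvw => /(_ _ e4) H2.
  move/cvgrPdist_lt: cwv => /(_ _ e4) H3.
  apply: (@filterS _ (nbhs x) _ _ _ _ (@filterI _ (nbhs x) _ _ _ H1
    (@filterI _ (nbhs x) _ _ _ H2 H3))).
  by move=> y [Uy [y1 y2]]; exact: (And3 Uy y1 y2).
have [h h0 H] := @line_near V x v w _ N.
have dd (u : V) y : U y -> differentiable ('D_u f) y.
  by move=> Uy; have [+ _] := Df u; apply.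
have [|c1 [d1 [c1h d1h E1]]] := @second_difference V f x v w h h0.
  by move=> s t sh th; have [Uy _ _] := H s t sh th; split; auto.
have [|c2 [d2 [c2h d2h E2]]] := @second_difference V f x w v h h0.
  by move=> s t sh th; have [Uy _ _] := H t s th sh; rewrite addrAC; split; auto.
have E : 'D_w ('D_v f) (x + c1 *: v + d1 *: w) =
         'D_v ('D_w f) (x + d2 *: v + c2 *: w).
  have EE (p q r s A B : R) : p - q - (r - s) = h * (h * A) ->
      p - r - (q - s) = h * (h * B) -> A = B.
    move=> e1 e2; apply: (mulfI (lt0r_neq0 h0)); apply: (mulfI (lt0r_neq0 h0)).
    by rewrite -e1 -e2; ring.
  rewrite [x + h *: w + h *: v]addrAC [x + c2 *: w + _]addrAC in E2.
  exact: (EE _ _ _ _ _ _ E1 E2).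
have [_ _ H1] := H _ _ c1h d1h; have [_ H2 _] := H _ _ d2h c2h.
rewrite E in H1; exact: (lt_quarters_False erefl H2 H1).
Qed.

End OneVariable.

(** * A smooth step function and integrals over the unit interval *)

Section Step.
Variable R : realType.

(** Termwise, [y ^+ i <= i! exp y] by the exponential series. *)
Lemma poly_le_expR (p : {poly R}) :
  exists2 C : R, 0 <= C & forall y, 0 <= y -> `|p.[y]| <= C * expR y.
Proof.
exists (\sum_(i < size p) `|p`_i| * i`!%:R).
  by apply: sumr_ge0 => i _; rewrite mulr_ge0.
move=> y y0; rewrite horner_coef mulr_suml (le_trans (ler_norm_sum _ _ _)) //.
apply: ler_sum => i _; rewrite normrM -mulrA ler_wpM2l // ger0_norm ?exprn_ge0 //.
have f0 : 0 < (i`!%:R : R) by rewrite ltr0n fact_gt0.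
case: (nat_of_ord i) f0 => [|k] f0.
  rewrite expr0 mul1r (le_trans _ (expR_ge1Dx y)) // lerDl //.
rewrite mulrC -ler_pdivrMr //.
by apply: le_trans (expR_ge1Dxn k y0); rewrite lerDr.
Qed.

(* The functions [p(1/x) exp(-1/x)] on [x > 0] are closed under derivation. *)
Definition flat (p : {poly R}) (x : R) : R :=
  if 0 < x then p.[x^-1] * expR (- x^-1) else 0.

Lemma flat_le0 p x : x <= 0 -> flat p x = 0.
Proof. by rewrite /flat ltNge => ->. Qed.

(** With [y = 1/x], the bound for ['X^2 * p] reads [|p(1/x)| exp(-1/x) <= C x^2]. Being quadratic,
    it forces the derivative at the origin to vanish. *)
Lemma flat_bound p : exists2 C : R, 0 <= C & forall x, `|flat p x| <= C * x ^+ 2.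
Proof.
have [C C0 H] := poly_le_expR ('X^2 * p); exists C => // x.
rewrite /flat; case: ltP => [x0|_]; last by rewrite normr0 mulr_ge0 ?sqr_ge0.
have xi0 : 0 < x^-1 by rewrite invr_gt0.
have := H _ (ltW xi0); rewrite hornerM hornerXn normrM ger0_norm ?sqr_ge0 //.
rewrite normrM (ger0_norm (expR_ge0 _)) expRN exprVn.
have e0 := expR_gt0 x^-1; have x20 : 0 < x ^+ 2 by rewrite exprn_gt0.
by rewrite ler_pdivrMl // ler_pdivrMr // mulrA (mulrC C).
Qed.

(** The polynomial comes from [d(1/x)/dx = - (1/x)^2]; at the origin [flat_bound] controls the
    difference quotient. *)
Lemma is_derive_flat (p : {poly R}) (x : R) :
  is_derive x 1 (flat p) (flat ('X^2 * (p - deriv p)) x).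
Proof.
have [x0|x0|->] := ltgtP x 0.
- rewrite flat_le0 ?ltW //.
  apply: (@near_eq_is_derive _ _ _ (cst (0 : R))).
  near=> y; rewrite flat_le0 //; apply: ltW; near: y; exact: lt_nbhsl.
- suff D : is_derive x 1 (fun x : R => p.[x^-1] * expR (- x^-1))
      (flat ('X^2 * (p - deriv p)) x).
    apply: (near_eq_is_derive _ D).
    near=> y; rewrite /flat ifT //; near: y; exact: lt_nbhsr.
  have xn0 : x != 0 by rewrite gt_eqF.
  have di : is_derive x 1 (fun y : R => y^-1) (- x ^- 2).
    split; first exact: derivableV.
    by rewrite (@deriveV _ _ id) // derive_id; rewrite /GRing.scale /= mulr1.
  have dp : is_derive x 1 (horner p \o (fun y => y^-1)) ((deriv p).[x^-1] * (- x ^- 2)).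
    by have hp := is_derive_poly p x^-1; exact: (is_derive1_comp hp di).
  have dn : is_derive x 1 (fun y : R => - y^-1) (x ^- 2).
    by apply: is_derive_eq; rewrite opprK.
  have de : is_derive x 1 (expR \o (fun y : R => - y^-1)) (expR (- x^-1) * x ^- 2).
    have he := is_derive_expR (- x^-1).
    exact: (@is_derive1_comp _ expR (fun y : R => - y^-1) x _ _ he dn).
  apply: (is_derive_eq (is_deriveM dp de)).
  rewrite /flat x0 /= /GRing.scale /= hornerM hornerXn hornerD hornerN exprVn.
  by ring.
- rewrite flat_le0 //.
  have [C C0 H] := flat_bound p.
  suff D : (fun h => h^-1 *: (flat p (h *: 1 + 0) - flat p 0)) @ 0^' --> (0 : R).
    by split; [apply/cvg_ex; exists 0|exact/cvg_lim].
  apply/cvgrPdist_le => e e0; near=> h.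
  have hn0 : h != 0 by near: h; exact: nbhs_dnbhs_neq.
  rewrite sub0r normrN (flat_le0 _ (lexx 0)) subr0 addr0 /GRing.scale /= mulr1.
  rewrite normrM normfV mulrC ler_pdivrMr ?normr_gt0 //.
  apply: (le_trans (H h)); rewrite -(real_normK (num_real h)) expr2 mulrA.
  rewrite ler_wpM2r //.
  have : `|h| <= e / (C + 1).
    by near: h; apply: dnbhs0_le; rewrite divr_gt0 // ltr_wpDl.
  rewrite ler_pdivlMr ?ltr_wpDl // => /(le_trans _); apply.
  by rewrite mulrC ler_wpM2l // lerDl.
Unshelve. all: by end_near. Qed.

Lemma derive_R (W : normedModType R) (f : R -> W) (x v : R) :
  differentiable f x -> 'D_v f x = v *: 'D_1 f x.
Proof.
move=> df; rewrite !deriveE //.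
by rewrite -[in LHS](mulr1 v) -[v * 1]/(v *: (1 : R)) linearZ.
Qed.

Lemma Ck_flat k p : Ck_on k setT (flat p).
Proof.
elim: k p => [|k IH] p.
  move=> x _; apply: differentiable_continuous; apply/derivable1_diffP.
  by have [] := is_derive_flat p x.
have df x : differentiable (flat p) x.
  by apply/derivable1_diffP; have [] := is_derive_flat p x.
split=> [x _|v]; first exact: df.
have oT : open [set: R] by exact: openT.
have cv := Ck_on_cst k [set: R] v.
apply: (Ck_on_eq oT _ (Ck_on_mul oT cv (IH ('X^2 * (p - deriv p))))) => x _.
rewrite (derive_R _ (df x)) /GRing.scale /=; congr (_ * _).
by have [_ ->] := is_derive_flat p x.
Qed.

Lemma flat1_ge0 x : 0 <= flat 1 x.
Proof. by rewrite /flat; case: ifP => // _; rewrite hornerE mul1r expR_ge0. Qed.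

Lemma flat1_gt0 x : 0 < x -> 0 < flat 1 x.
Proof. by move=> x0; rewrite /flat x0 hornerE mul1r expR_gt0. Qed.

Definition step (x : R) : R := flat 1 x / (flat 1 x + flat 1 (1 - x)).

Lemma step_den x : 0 < flat 1 x + flat 1 (1 - x).
Proof.
have [x0|x0] := ltP 0 x; first by rewrite ltr_pwDl ?flat1_gt0 ?flat1_ge0.
by rewrite ltr_wpDl ?flat1_ge0 // flat1_gt0 //; lra.
Qed.

Lemma step_le0 x : x <= 0 -> step x = 0.
Proof. by move=> x0; rewrite /step (flat_le0 _ x0) mul0r. Qed.

Lemma step_ge1 x : 1 <= x -> step x = 1.
Proof.
move=> x1; have d := step_den x; rewrite /step.
by rewrite (_ : flat 1 (1 - x) = 0) ?addr0 in d *; [rewrite divff ?gt_eqF|apply: flat_le0; lra].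
Qed.

Lemma step_ge0 x : 0 <= step x.
Proof. by rewrite divr_ge0 ?flat1_ge0 // ltW // step_den. Qed.

Lemma smooth_step : smooth_on setT step.
Proof.
move=> k; have oT : open [set: R] by exact: openT.
have c1 := Ck_flat k 1.
have c2 : Ck_on k setT (fun x : R => flat 1 (1 - x)).
  apply: (@Ck_on_comp R R R k _ setT (fun x => 1 - x) (flat 1)) => //.
    exact: finite_dim_R.
  by apply: Ck_on_sub_fun => //; [exact: Ck_on_cst|exact: Ck_on_id].
apply: Ck_on_mul => //; apply: Ck_on_inv => //; last exact: Ck_on_add.
by move=> x _; rewrite gt_eqF // step_den.
Qed.

End Step.

Section Integrals.
Variable R : realType.
Local Notation mu := (@lebesgue_measure R).

Lemma integrable01 (f : R -> R) : continuous f ->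
  mu.-integrable `[0, 1] (EFin \o f).
Proof.
move=> cf; apply: continuous_compact_integrable; first exact: segment_compact.
exact: continuous_subspaceT.
Qed.

Lemma Rintegral01_FTC (f F : R -> R) : continuous f ->
  (forall x : R, is_derive x 1 F (f x)) -> Rintegral mu `[0, 1] f = F 1 - F 0.
Proof.
move=> cf dF.
have cF x : {for x, continuous F}.
  apply: differentiable_continuous; apply/derivable1_diffP.
  by have [] := dF x.
rewrite /Rintegral (@continuous_FTC2 _ f F 0 1) ?ltr01 //.
- exact: continuous_subspaceT.
- split; first by move=> x _; have [] := dF x.
    by apply: cvg_at_right_filter; exact: cF.
  by apply: cvg_at_left_filter; exact: cF.
- by move=> x _; rewrite derive1E; have [_ ->] := dF x.
Qed.

(** Provides the dominating constant when a limit or a derivative in the first variable is taken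
    under the integral over the second. *)
Lemma square_bound (f : R * R -> R) (y : R) : continuous f ->
  exists C : R, forall x t, `]y - 1, y + 1[%classic x -> `[0, 1]%classic t ->
    `|f (x, t)| <= C.
Proof.
move=> cf.
have K : compact (`[y - 1, y + 1]%classic `*` `[0 : R, 1]%classic : set (R * R)).
  by apply: compact_setX; exact: segment_compact.
have [| |[c d] _ H] := @compact_EVT_max _ R (fun z => `|f z|) _ _ K.
- exists (y, 0); split; rewrite /= in_itv /= ?lexx ?ler01 //.
  by apply/andP; split; lra.
- apply: continuous_subspaceT => z.
  by apply: (@continuous_comp _ _ _ f (fun x : R => `|x|)); [exact: cf|exact: norm_continuous].
exists `|f (c, d)| => x t xy t01; apply: (H (x, t)); rewrite inE; split => //.
by move: xy; rewrite /= !in_itv /= => /andP[x1 x2]; rewrite !ltW.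
Qed.

Lemma continuous_slice1 (f : R * R -> R) x : continuous f ->
  continuous (fun t => f (x, t)).
Proof.
move=> cf t; have cp : {for t, continuous (fun t : R => (x, t))}.
  exact: (@cvg_pair R R R (nbhs t) (nbhs x) (nbhs t) _ _ _ (fun=> x) id (cvg_cst x) cvg_id).
exact: (continuous_comp cp (cf (x, t))).
Qed.

Lemma continuous_slice2 (f : R * R -> R) t : continuous f ->
  continuous (fun x => f (x, t)).
Proof.
move=> cf x; have cp : {for x, continuous (fun x : R => (x, t))}.
  exact: (@cvg_pair R R R (nbhs x) (nbhs x) (nbhs t) _ _ _ id (fun=> t) cvg_id (cvg_cst t)).
exact: (continuous_comp cp (cf (x, t))).
Qed.

Lemma continuous_Rintegral01 (f : R * R -> R) : continuous f ->
  continuous (fun y => Rintegral mu `[0, 1] (fun t => f (y, t))).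
Proof.
move=> cf y; have [C H] := square_bound y cf.
apply: (@continuity_under_integral R _ _ mu (fun x t => f (x, t)) `[0, 1]
  _ (y - 1) (y + 1) _ _ (cst C)) => //=.
- by move=> x _; apply: integrable01; exact: continuous_slice1.
- by apply: aeW => t _ x _; exact: continuous_slice2.
- by apply: integrable01; exact: cst_continuous.
- by move=> x xy; apply: aeW => t; exact: H.
- by rewrite inE /= in_itv /=; apply/andP; split; lra.
Qed.

Lemma is_derive_Rintegral01 (f : R * R -> R) (y : R) :
  (forall z, differentiable f z) -> continuous ('D_(1, 0) f) ->
  is_derive y 1 (fun y => Rintegral mu `[0, 1] (fun t => f (y, t)))
    (Rintegral mu `[0, 1] (fun t => 'D_(1, 0) f (y, t))).
Proof.
move=> df cdf; have cf : continuous f by move=> z; exact: differentiable_continuous.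
have dfx (x t : R) : is_derive x 1 (fun x => f (x, t)) ('D_(1, 0) f (x, t)).
  have e (s : R) : (s, t) = (0, t) + s *: (1, 0).
    by congr (_, _); rewrite /= ?add0r ?scaler0 ?addr0 // /GRing.scale /= mulr1.
  rewrite e (_ : (fun x => _) = fun s : R => f ((0, t) + s *: (1, 0))).
    exact: is_derive_line.
  by apply/funext => s; rewrite e.
have [C H] := square_bound y cdf.
have yI : `]y - 1, y + 1[%classic y by rewrite /= in_itv /=; apply/andP; split; lra.
have d1 x t : partial1of2 (fun x t => f (x, t)) x t = 'D_(1, 0) f (x, t).
  by rewrite partial1of2E; have [_ ->] := dfx x t.
have intf (x : R) : `]y - 1, y + 1[%classic x ->
    mu.-integrable `[0, 1] (EFin \o (fun t => f (x, t))).
  by move=> _; apply: integrable01; exact: continuous_slice1.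
have derf (x t : R) : `]y - 1, y + 1[%classic x -> `[0, 1]%classic t ->
    derivable ((fun x t => f (x, t)) ^~ t) x 1 by move=> _ _; have [] := dfx x t.
have intG : mu.-integrable `[0, 1] (EFin \o (cst `|C|)).
  by apply: integrable01; exact: cst_continuous.
have Gub (x t : R) : `]y - 1, y + 1[%classic x -> `[0, 1]%classic t ->
    `|partial1of2 (fun x t => f (x, t)) x t| <= cst `|C| t.
  by move=> xy t01; rewrite d1 (le_trans (H _ _ xy t01)) // ler_norm.
have C0 (t : R) : 0 <= cst `|C| t by [].
have m01 : measurable (`[0 : R, 1]%classic : set (measurableTypeR R)) by [].
split.
  exact: (@derivable_under_integral R _ _ mu (fun x t => f (x, t)) `[0, 1]
    m01 y (y - 1) (y + 1) yI intf derf (cst `|C|) C0 intG Gub).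
rewrite -derive1E.
rewrite (@differentiation_under_integral R _ _ mu (fun x t => f (x, t)) `[0, 1]
    m01 y (y - 1) (y + 1) yI intf derf (cst `|C|) C0 intG Gub).
by congr (Rintegral _ _ _); apply/funext => t; exact: d1.
Qed.

(* [F x] is the integral of [x f(x t)] over [t] in [0,1]; its derivative
   integrates [d/dt (t f(x t))]. *)
Lemma primitive_ex (f : R -> R) : (forall x, differentiable f x) ->
  continuous ('D_1 f) -> exists F : R -> R, forall x : R, is_derive x 1 F (f x).
Proof.
move=> df cdf; pose g (z : R * R) := z.1 * f (z.1 * z.2).
have cf : continuous f by move=> x; exact: differentiable_continuous.
have cm : continuous (fun z : R * R => z.1 * z.2).
  by move=> z; apply: mul_continuous.
have d1 (z : R * R) : is_diff z (fun z : R * R => z.1) (fun z => z.1).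
  pose L : {linear (R * R)%type -> R} := @fst R R.
  have cL : continuous L by move=> y; exact: cvg_fst.
  by split; [exact: (linear_differentiable z cL)|exact: (diff_lin z cL)].
have dm (z : R * R) : is_diff z (fun q : R * R => q.1 * q.2)
    (fun q => z.1 * q.2 + q.1 * z.2) by exact: is_diff_mulr.
have dc (z : R * R) : differentiable (f \o (fun q : R * R => q.1 * q.2)) z.
  exact: differentiable_comp.
have dg z : differentiable g z.
  by apply: (@differentiableM _ _ (fun z : R * R => z.1)
    (f \o (fun q : R * R => q.1 * q.2))).
have Dg z : 'D_(1, 0) g z = f (z.1 * z.2) + z.2 * (z.1 * 'D_1 f (z.1 * z.2)).
  have df1 : differentiable (fun z : R * R => z.1) z by [].
  have e1 : 'D_(1, 0) (fun z : R * R => z.1) z = 1 by rewrite (deriveE _ df1) diff_val.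
  have e2 : 'D_(1, 0) (f \o (fun q : R * R => q.1 * q.2)) z = z.2 * 'D_1 f (z.1 * z.2).
    have dmz : differentiable (fun q : R * R => q.1 * q.2) z by [].
    rewrite (deriveE _ (dc z)) (diff_comp dmz (df _)).
    have -> : ('d f (z.1 * z.2) \o 'd (fun q : R * R => q.1 * q.2) z) (1, 0) =
        'd f (z.1 * z.2) z.2 by rewrite /comp diff_val /= mulr0 add0r mul1r.
    by rewrite -(deriveE _ (df _)) (derive_R _ (df _)).
  apply: (etrans (deriveM (diff_derivable df1) (diff_derivable (dc z)))).
  by rewrite e1 e2 /GRing.scale /= mulr1 addrC; congr (_ + _); exact: mulrCA.
have cD : continuous ('D_(1, 0) g).
  have -> : 'D_(1, 0) g = fun z => f (z.1 * z.2) + z.2 * (z.1 * 'D_1 f (z.1 * z.2)).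
    by apply/funext => z; exact: Dg.
  move=> z; apply: cvgD.
    by apply: (@continuous_comp _ _ _ (fun z : R * R => z.1 * z.2) f); [exact: cm|exact: cf].
  apply: cvgM; first exact: cvg_snd.
  apply: cvgM; first exact: cvg_fst.
  by apply: (@continuous_comp _ _ _ (fun z : R * R => z.1 * z.2) ('D_1 f)); [exact: cm|exact: cdf].
exists (fun x => Rintegral mu `[0, 1] (fun t => g (x, t))) => x.
apply: (is_derive_eq (is_derive_Rintegral01 x dg cD)).
have dF (t : R) : is_derive t 1 (fun t => t * f (x * t)) ('D_(1, 0) g (x, t)).
  rewrite Dg /=.
  have dl : is_derive t 1 (fun t => x * t) x.
    apply: (is_derive_eq (@is_deriveZ _ _ _ id x t 1 1 _)).
    by rewrite /GRing.scale /= mulr1.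
  have dft : is_derive (x * t) 1 f ('D_1 f (x * t)).
    by apply: derivableP; apply/derivable1_diffP; exact: df.
  have dcc := @is_derive1_comp _ f (fun t => x * t) t _ _ dft dl.
  apply: (is_derive_eq (is_deriveM (is_derive_id t 1) dcc)).
  by rewrite /GRing.scale /=; ring.
rewrite (Rintegral01_FTC (continuous_slice1 cD) dF).
by rewrite mulr1 mul1r mul0r subr0.
Qed.

End Integrals.

(** * Matrix calculus *)

Section Smooth.
Variable R : realType.
Implicit Types (V W : normedModType R).

Lemma smooth_on_sub V W (U U' : set V) (f : V -> W) :
  U' `<=` U -> smooth_on U f -> smooth_on U' f.
Proof. by move=> sU sf k; exact: Ck_on_sub sU (sf k). Qed.

Lemma smooth_on_local V W (U : set V) (g : V -> W) :
  (forall x, U x -> exists A : set V, exists f : V -> W,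
    [/\ open A, A x, (forall y, A y -> f y = g y) & smooth_on A f]) ->
  smooth_on U g.
Proof.
move=> H k; apply: Ck_on_local => x /H [A [f [oA Ax fg sf]]].
by exists A, f; split => //; exact: sf.
Qed.

Lemma smooth_on_eq V W (U : set V) (f g : V -> W) : open U ->
  (forall x, U x -> f x = g x) -> smooth_on U f -> smooth_on U g.
Proof. by move=> oU fg sf k; exact: Ck_on_eq oU fg (sf k). Qed.

Lemma smooth_on_cst V W (U : set V) (a : W) : smooth_on U (fun _ => a).
Proof. by move=> k; exact: Ck_on_cst. Qed.

Lemma smooth_on_id V (U : set V) : smooth_on U (fun x : V => x).
Proof. by move=> k; exact: Ck_on_id. Qed.

Lemma smooth_on_fst V W (U : set (V * W)) : smooth_on U (fun z => z.1).
Proof.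
by move=> k; apply: (@Ck_on_lin R _ _ k U (@fst V W)) => x; exact: cvg_fst.
Qed.

Lemma smooth_on_snd V W (U : set (V * W)) : smooth_on U (fun z => z.2).
Proof.
by move=> k; apply: (@Ck_on_lin R _ _ k U (@snd V W)) => x; exact: cvg_snd.
Qed.

Lemma smooth_on_add V W (U : set V) (f g : V -> W) : open U ->
  smooth_on U f -> smooth_on U g -> smooth_on U (fun x => f x + g x).
Proof. by move=> oU sf sg k; exact: Ck_on_add (sf k) (sg k). Qed.

Lemma smooth_on_opp V W (U : set V) (f : V -> W) : open U ->
  smooth_on U f -> smooth_on U (fun x => - f x).
Proof. by move=> oU sf k; exact: Ck_on_opp (sf k). Qed.

Lemma smooth_on_subf V W (U : set V) (f g : V -> W) : open U ->
  smooth_on U f -> smooth_on U g -> smooth_on U (fun x => f x - g x).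
Proof. by move=> oU sf sg k; exact: Ck_on_sub_fun (sf k) (sg k). Qed.

Lemma smooth_on_sum V W (U : set V) (I : Type) (r : seq I) (P : pred I)
    (f : I -> V -> W) : open U -> (forall i, P i -> smooth_on U (f i)) ->
  smooth_on U (fun x => \sum_(i <- r | P i) f i x).
Proof. by move=> oU sf k; apply: Ck_on_sum => // i Pi; exact: sf. Qed.

Lemma smooth_on_mul V (U : set V) (f g : V -> R) : open U ->
  smooth_on U f -> smooth_on U g -> smooth_on U (fun x => f x * g x).
Proof. by move=> oU sf sg k; exact: Ck_on_mul (sf k) (sg k). Qed.

Lemma smooth_on_inv V (U : set V) (f : V -> R) : open U ->
  (forall x, U x -> f x != 0) -> smooth_on U f -> smooth_on U (fun x => (f x)^-1).
Proof. by move=> oU f0 sf k; exact: Ck_on_inv (sf k). Qed.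

Lemma smooth_on_entry V m n (U : set V) (f : V -> 'M[R]_(m, n)) i j : open U ->
  smooth_on U f -> smooth_on U (fun x => f x i j).
Proof. by move=> oU sf k; exact: Ck_on_entry (sf k). Qed.

Lemma smooth_on_mx V m n (U : set V) (f : V -> 'M[R]_(m, n)) : open U ->
  (forall i j, smooth_on U (fun x => f x i j)) -> smooth_on U f.
Proof. by move=> oU sf k; apply: Ck_on_mx => // i j; exact: sf. Qed.

Lemma smooth_on_pair V W W' (U : set V) (f : V -> W) (g : V -> W') : open U ->
  smooth_on U f -> smooth_on U g -> smooth_on U (fun x => (f x, g x)).
Proof. by move=> oU sf sg k; exact: Ck_on_pair (sf k) (sg k). Qed.

Lemma smooth_on_comp V W (U : set V) (A : set W) (f : V -> W) (g : W -> R) :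
  finite_dim W -> open U -> (forall x, U x -> A (f x)) ->
  smooth_on U f -> smooth_on A g -> smooth_on U (fun x => g (f x)).
Proof. by move=> fW oU fA sf sg k; exact: Ck_on_comp fW oU fA (sf k) (sg k). Qed.

Lemma smooth_on_comp_mx V W m n (U : set V) (A : set W) (f : V -> W)
    (g : W -> 'M[R]_(m, n)) :
  finite_dim W -> open U -> open A -> (forall x, U x -> A (f x)) ->
  smooth_on U f -> smooth_on A g -> smooth_on U (fun x => g (f x)).
Proof.
move=> fW oU oA fA sf sg; apply: smooth_on_mx => // i j.
apply: (smooth_on_comp (g := fun y => g y i j) fW oU fA sf).
exact: smooth_on_entry.
Qed.

Lemma smooth_on_derive V W (U : set V) (f : V -> W) v :
  smooth_on U f -> smooth_on U ('D_v f).
Proof. by move=> sf k; have [_] := sf k.+1; apply. Qed.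

Lemma smooth_on_diff V W (U : set V) (f : V -> W) x :
  smooth_on U f -> U x -> differentiable f x.
Proof. by move=> sf; have [+ _] := sf 1%N; apply. Qed.

Lemma smooth_on_cont V W (U : set V) (f : V -> W) x :
  smooth_on U f -> U x -> {for x, continuous f}.
Proof. by move=> sf Ux; exact: (sf 0%N x Ux). Qed.

Lemma smooth_on_scale V m n (U : set V) (f : V -> R) (g : V -> 'M[R]_(m, n)) :
  open U -> smooth_on U f -> smooth_on U g -> smooth_on U (fun x => f x *: g x).
Proof.
move=> oU sf sg; apply: smooth_on_mx => // i j.
have h := smooth_on_mul oU sf (smooth_on_entry i j oU sg).
by apply: (smooth_on_eq oU _ h) => x _; rewrite mxE.
Qed.

Lemma smooth_on_mulmx V m n p (U : set V) (f : V -> 'M[R]_(m, n))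
    (g : V -> 'M[R]_(n, p)) : open U ->
  smooth_on U f -> smooth_on U g -> smooth_on U (fun x => f x *m g x).
Proof.
move=> oU sf sg; apply: smooth_on_mx => // i j.
have h : smooth_on U (fun x => \sum_k f x i k * g x k j).
  apply: smooth_on_sum => // k _.
  by apply: smooth_on_mul => //; exact: smooth_on_entry.
by apply: (smooth_on_eq oU _ h) => x _; rewrite mxE.
Qed.

Lemma smooth_on_trmx V m n (U : set V) (f : V -> 'M[R]_(m, n)) : open U ->
  smooth_on U f -> smooth_on U (fun x => (f x)^T).
Proof.
move=> oU sf; apply: smooth_on_mx => // i j.
by apply: (smooth_on_eq oU _ (smooth_on_entry j i oU sf)) => x _; rewrite mxE.
Qed.

Lemma smooth_on_mxtrace V n (U : set V) (f : V -> 'M[R]_n) : open U ->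
  smooth_on U f -> smooth_on U (fun x => \tr (f x)).
Proof.
by move=> oU sf; apply: smooth_on_sum => // i _; exact: smooth_on_entry.
Qed.

Lemma smooth_on_det V n (U : set V) (f : V -> 'M[R]_n) : open U ->
  smooth_on U f -> smooth_on U (fun x => \det (f x)).
Proof.
move=> oU sf; apply: smooth_on_sum => // s _; apply: smooth_on_mul => //.
  exact: smooth_on_cst.
by move=> k; apply: Ck_on_prod => // i; exact: (smooth_on_entry _ _ oU sf).
Qed.

(** Cramer's rule: the adjugate is polynomial in the entries and the determinant does not vanish. *)
Lemma smooth_on_invmx V n (U : set V) (f : V -> 'M[R]_n) : open U ->
  (forall x, U x -> f x \in unitmx) -> smooth_on U f ->
  smooth_on U (fun x => invmx (f x)).
Proof.
move=> oU fu sf.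
have si : smooth_on U (fun x => (\det (f x))^-1).
  apply: smooth_on_inv => //; last exact: smooth_on_det.
  by move=> x /fu; rewrite unitmxE unitfE.
have sa : smooth_on U (fun x => \adj (f x)).
  apply: smooth_on_mx => // i j.
  have h : smooth_on U (fun x => cofactor (f x) j i).
    apply: smooth_on_mul => //; first exact: smooth_on_cst.
    apply: smooth_on_det => //; apply: smooth_on_mx => // a b.
    apply: (smooth_on_eq oU _ (smooth_on_entry (lift j a) (lift i b) oU sf)) => x _.
    by rewrite !mxE.
  by apply: (smooth_on_eq oU _ h) => x _; rewrite mxE.
apply: (smooth_on_eq oU _ (smooth_on_scale oU si sa)) => x Ux.
by rewrite /invmx fu.
Qed.

Lemma derive_entry V m n (f : V -> 'M[R]_(m, n)) x v i j :
  differentiable f x -> 'D_v (fun y => f y i j) x = 'D_v f x i j.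
Proof. by move=> df; rewrite derive_mx_entry //; exact: diff_derivable. Qed.

Lemma differentiable_entry V m n (f : V -> 'M[R]_(m, n)) x i j :
  differentiable f x -> differentiable (fun y => f y i j) x.
Proof.
move=> df.
apply: (@differentiable_comp _ _ _ _ f (fun M : 'M[R]_(m, n) => M i j : R)) => //.
exact: differentiable_coord.
Qed.

Lemma derive_comp V W W' (f : V -> W) (g : W -> W') x v :
  differentiable f x -> differentiable g (f x) ->
  'D_v (fun y => g (f y)) x = 'D_('D_v f x) g (f x).
Proof.
move=> df dg; have dc : differentiable (g \o f) x by exact: differentiable_comp.
by rewrite (deriveE _ dc) (diff_comp df dg) /= -(deriveE _ df) -deriveE.
Qed.

Lemma derive_dirD V W (f : V -> W) x u v :
  differentiable f x -> 'D_(u + v) f x = 'D_u f x + 'D_v f x.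
Proof. by move=> df; rewrite !deriveE // linearD. Qed.

Lemma derive_dirZ V W (f : V -> W) x a u :
  differentiable f x -> 'D_(a *: u) f x = a *: 'D_u f x.
Proof. by move=> df; rewrite !deriveE // linearZ. Qed.

Lemma derive_rV n W (f : 'rV[R]_n -> W) x v :
  differentiable f x -> 'D_v f x = \sum_j v 0 j *: partial j f x.
Proof.
move=> df; rewrite deriveE // [in LHS](row_sum_delta v) linear_sum.
by apply: eq_bigr => j _; rewrite linearZ /= /partial deriveE.
Qed.

Lemma derive_jacobian m n (f : 'rV[R]_m -> 'rV[R]_n) x v :
  differentiable f x -> 'D_v f x = v *m 'J f x.
Proof. by move=> df; exact: deriveEjacobian. Qed.

Lemma jacobian_partial m n (f : 'rV[R]_m -> 'rV[R]_n) x i j :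
  differentiable f x -> 'J f x i j = partial i f x 0 j.
Proof.
by move=> df; rewrite /partial derive_jacobian // -rowE [RHS]mxE.
Qed.

Lemma differentiable_mulmx V m n p (f : V -> 'M[R]_(m, n)) (g : V -> 'M[R]_(n, p)) x :
  differentiable f x -> differentiable g x ->
  differentiable (fun y => f y *m g y) x.
Proof.
move=> df dg; apply: differentiable_mxP => i j.
rewrite (_ : (fun y => _) = \sum_k (fun y => f y i k * g y k j)).
  apply: differentiable_sum => k.
  by apply: differentiableM; exact: differentiable_entry.
by apply/funext => y; rewrite mxE fct_sumE.
Qed.

Lemma derive_mulmx V m n p (f : V -> 'M[R]_(m, n)) (g : V -> 'M[R]_(n, p)) x v :
  differentiable f x -> differentiable g x ->
  'D_v (fun y => f y *m g y) x = 'D_v f x *m g x + f x *m 'D_v g x.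
Proof.
move=> df dg; have dfg := differentiable_mulmx df dg.
apply/matrixP => i j; rewrite -derive_entry // !mxE.
rewrite (_ : (fun y => _) = \sum_k ((fun y => f y i k) * (fun y => g y k j))).
  rewrite derive_sum -?big_split /=; last first.
    by move=> k; apply: diff_derivable; apply: differentiableM; exact: differentiable_entry.
  apply: eq_bigr => k _; rewrite deriveM; try by apply: diff_derivable; exact: differentiable_entry.
  by rewrite !derive_entry // /GRing.scale /= addrC [g x k j * _]mulrC.
by apply/funext => y; rewrite mxE fct_sumE.
Qed.

Lemma differentiable_trmx V m n (f : V -> 'M[R]_(m, n)) x :
  differentiable f x -> differentiable (fun y => (f y)^T) x.
Proof.
move=> df; apply: differentiable_mxP => i j.
rewrite (_ : (fun y => _) = fun y => f y j i); first exact: differentiable_entry.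
by apply/funext => y; rewrite mxE.
Qed.

Lemma derive_trmx V m n (f : V -> 'M[R]_(m, n)) x v :
  differentiable f x -> 'D_v (fun y => (f y)^T) x = ('D_v f x)^T.
Proof.
move=> df; apply/matrixP => i j; rewrite -derive_entry ?mxE.
  rewrite (_ : (fun y => _) = fun y => f y j i); first exact: derive_entry.
  by apply/funext => y; rewrite mxE.
exact: differentiable_trmx.
Qed.

Lemma derive_mxtrace V n (f : V -> 'M[R]_n) x v :
  differentiable f x -> 'D_v (fun y => \tr (f y)) x = \tr ('D_v f x).
Proof.
move=> df; rewrite (_ : (fun y => _) = \sum_i (fun y => f y i i)).
  rewrite derive_sum; last first.
    by move=> i; apply: diff_derivable; exact: differentiable_entry.
  by apply: eq_bigr => i _; exact: derive_entry.
by apply/funext => y; rewrite fct_sumE.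
Qed.

Lemma derive_add V W (f g : V -> W) x v :
  differentiable f x -> differentiable g x ->
  'D_v (fun y => f y + g y) x = 'D_v f x + 'D_v g x.
Proof. by move=> df dg; rewrite -deriveD //; apply: diff_derivable. Qed.

Lemma derive_sub V W (f g : V -> W) x v :
  differentiable f x -> differentiable g x ->
  'D_v (fun y => f y - g y) x = 'D_v f x - 'D_v g x.
Proof. by move=> df dg; rewrite -deriveB //; apply: diff_derivable. Qed.

Lemma derive_sumf V W m (f : 'I_m -> V -> W) x v :
  (forall i, differentiable (f i) x) ->
  'D_v (fun y => \sum_i f i y) x = \sum_i 'D_v (f i) x.
Proof.
move=> df; rewrite -derive_sum; last by move=> i; exact: diff_derivable.
by congr ('D_v _ x); apply/funext => y; rewrite fct_sumE.
Qed.

Lemma derive_scalemx V m n (a : V -> R) (f : V -> 'M[R]_(m, n)) x v :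
  differentiable a x -> differentiable f x ->
  differentiable (fun y => a y *: f y) x /\
  'D_v (fun y => a y *: f y) x = 'D_v a x *: f x + a x *: 'D_v f x.
Proof.
move=> da df.
have e i j : (fun y => (a y *: f y) i j) = a * (fun y => f y i j).
  by apply/funext => y; rewrite mxE.
have D : differentiable (fun y => a y *: f y) x.
  apply: differentiable_mxP => i j; rewrite e; apply: differentiableM => //.
  exact: differentiable_entry.
split=> //; apply/matrixP => i j; rewrite -derive_entry // e.
rewrite (@deriveM _ _ a (fun y => f y i j) x v); first last.
- by apply: diff_derivable; exact: differentiable_entry.
- exact: diff_derivable.
by rewrite derive_entry // !mxE /GRing.scale /= addrC [f x i j * _]mulrC.
Qed.

Lemma derive_near V W (U : set V) (f g : V -> W) x v : open U -> U x ->
  (forall y, U y -> f y = g y) -> 'D_v f x = 'D_v g x.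
Proof.
move=> oU Ux fg; apply: near_eq_derive.
by apply: filterS (open_nbhs_nbhs (conj oU Ux)) => y; exact: fg.
Qed.

(** Differentiate [f * f^-1 = 1], which holds on a neighbourhood of [x]. *)
Lemma derive_invmx V n (U : set V) (f : V -> 'M[R]_n) x v : open U -> U x ->
  (forall y, U y -> f y \in unitmx) -> smooth_on U f ->
  'D_v (fun y => invmx (f y)) x = - invmx (f x) *m 'D_v f x *m invmx (f x).
Proof.
move=> oU Ux fu sf.
have df := smooth_on_diff sf Ux.
have di := smooth_on_diff (smooth_on_invmx oU fu sf) Ux.
have := derive_mulmx v df di.
rewrite (derive_near (g := fun=> 1%:M) v oU Ux); last by move=> y /fu /mulmxV.
rewrite derive_cst => /esym/eqP; rewrite addrC addr_eq0 => /eqP E.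
rewrite -[LHS](mulKmx (fu _ Ux)) E.
by rewrite mulmxN !mulNmx mulmxA.
Qed.

Lemma smooth_schwarz_mx V m n (f : V -> 'M[R]_(m, n)) (U : set V) (v w : V) (x : V) :
  open U -> U x -> smooth_on U f -> 'D_v ('D_w f) x = 'D_w ('D_v f) x.
Proof.
move=> oU Ux sf; apply/matrixP => i j.
have d1 u : differentiable ('D_u f) x := smooth_on_diff (smooth_on_derive u sf) Ux.
have E1 := derive_entry v i j (d1 w); have E2 := derive_entry w i j (d1 v).
pose g y := f y i j.
have e u y : U y -> 'D_u f y i j = 'D_u g y.
  by move=> Uy; exact: (esym (derive_entry u i j (smooth_on_diff sf Uy))).
have sg : smooth_on U g := smooth_on_entry i j oU sf.
have E3 := derive_near v oU Ux (e w); have E4 := derive_near w oU Ux (e v).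
exact: (etrans (esym E1) (etrans E3 (etrans (schwarz v w oU Ux (sg 2%N))
  (etrans (esym E4) E2)))).
Qed.

End Smooth.

(** * Charts *)

Lemma mulmx_row_inj (R : pzSemiRingType) (m p : nat) (A B : 'M[R]_(m, p)) :
  (forall v : 'rV_m, v *m A = v *m B) -> A = B.
Proof. by move=> H; apply/row_matrixP => i; rewrite !rowE H. Qed.

Lemma invmx_mul (R : comUnitRingType) (m : nat) (A B : 'M[R]_m) :
  A \in unitmx -> B \in unitmx -> invmx (A *m B) = invmx B *m invmx A.
Proof.
move=> uA uB; have uAB : A *m B \in unitmx by rewrite unitmx_mul uA uB.
by rewrite -[RHS](mulKmx uAB) (mulmxA (A *m B)) (mulmxK uB) mulmxV // mulmx1.
Qed.

(** [T] stands for the Jacobian of a change of charts and [F] for the frame of the second chart: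
    this is the transformation rule of an endomorphism field. *)
Lemma conj_frame_mul (R : comUnitRingType) (m : nat) (A T F : 'M[R]_m) :
  T \in unitmx -> F \in unitmx ->
  (T *m F *m A *m invmx (T *m F)) *m T = T *m (F *m A *m invmx F).
Proof.
by move=> uT uF; rewrite (invmx_mul uT uF) -!mulmxA mulVmx // mulmx1.
Qed.

Section Charts.
Variables (R : realType) (n : nat) (M : topologicalType).
Implicit Types (c : chart R n M).

Lemma fwd_bwd c x : cod c x -> fwd c (bwd c x) = x.
Proof. by move=> [p cp <-]; rewrite fwdK // inE. Qed.

Lemma dom_bwd c x : cod c x -> dom c (bwd c x).
Proof. by move=> [p cp <-]; rewrite fwdK // inE. Qed.

Lemma bwd_fwd c p : dom c p -> bwd c (fwd c p) = p.
Proof. by move=> cp; rewrite fwdK // inE. Qed.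

Lemma cod_fwd c p : dom c p -> cod c (fwd c p).
Proof. by exists p. Qed.

Lemma open_cod c : open (cod c). Proof. exact: cod_open. Qed.

Lemma openI_preimage (T U : topologicalType) (A : set T) (B : set U) (f : T -> U) :
  open A -> open B -> (forall x, A x -> {for x, continuous f}) ->
  open (A `&` f @^-1` B).
Proof.
move=> oA oB cf; rewrite openE => x [Ax Bfx]; apply: filterI.
  exact: open_nbhs_nbhs.
by apply: (cf x Ax); exact: open_nbhs_nbhs.
Qed.

Lemma open_overlap c c' : open (overlap c c').
Proof.
apply: openI_preimage; [exact: open_cod|exact: dom_open|].
by move=> x cx; exact: bwd_continuous.
Qed.

Arguments open_cod : clear implicits.
Arguments open_overlap : clear implicits.

Lemma overlapP c c' x : cod c x -> dom c' (bwd c x) -> overlap c c' x.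
Proof. by []. Qed.

Lemma overlap_fwd c c' p : dom c p -> dom c' p -> overlap c c' (fwd c p).
Proof. by move=> cp c'p; split; [exact: cod_fwd|rewrite /= bwd_fwd]. Qed.

Lemma transition_id c x : cod c x -> transition c c x = x.
Proof. exact: fwd_bwd. Qed.

Lemma bwd_transition c c' x : dom c' (bwd c x) -> bwd c' (transition c c' x) = bwd c x.
Proof. exact: bwd_fwd. Qed.

Lemma cod_transition c c' x : dom c' (bwd c x) -> cod c' (transition c c' x).
Proof. exact: cod_fwd. Qed.

Lemma transition_comp c c' c'' x : dom c' (bwd c x) ->
  transition c' c'' (transition c c' x) = transition c c'' x.
Proof. by move=> h; rewrite /transition /= bwd_fwd. Qed.

Variable S : smooth_structure R n M.

Lemma jacobian_id c x : cod c x -> 'J (transition c c) x = 1%:M.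
Proof.
move=> cx; apply: mulmx_row_inj => v; rewrite mulmx1.
have oc := open_cod c.
have d : differentiable (transition c c) x.
  apply: (@near_eq_differentiable _ _ _ id); last exact: ex_diff.
  apply: filterS (open_nbhs_nbhs (conj oc cx)) => y cy.
  by rewrite transition_id.
rewrite -derive_jacobian // (derive_near (g := id) _ oc cx) ?derive_id //.
exact: transition_id.
Qed.

Lemma smooth_transition c c' : atlas S c -> atlas S c' ->
  smooth_on (overlap c c') (transition c c').
Proof. exact: atlas_smooth. Qed.

Lemma jacobian_comp (m p q : nat) (f : 'rV[R]_m -> 'rV[R]_p) (g : 'rV[R]_p -> 'rV[R]_q) x :
  differentiable f x -> differentiable g (f x) ->
  'J (fun y => g (f y)) x = 'J f x *m 'J g (f x).
Proof.
move=> df dg; apply: mulmx_row_inj => v; rewrite mulmxA.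
have dc : differentiable (fun y => g (f y)) x by exact: differentiable_comp.
by rewrite -(derive_jacobian _ dc) (derive_comp _ df dg) -!derive_jacobian.
Qed.

Lemma jacobian_near (m p : nat) (f g : 'rV[R]_m -> 'rV[R]_p) (U : set 'rV[R]_m) x :
  open U -> U x -> (forall y, U y -> f y = g y) -> differentiable f x ->
  'J f x = 'J g x.
Proof.
move=> oU Ux fg df; apply: mulmx_row_inj => v.
have dg : differentiable g x.
  apply: near_eq_differentiable df.
  by apply: filterS (open_nbhs_nbhs (conj oU Ux)) => y; exact: fg.
apply: (etrans (esym (derive_jacobian v df))).
apply: (etrans _ (derive_jacobian v dg)).
exact: (derive_near v oU Ux fg).
Qed.

Lemma jacobian_transition c c' c'' x : atlas S c -> atlas S c' -> atlas S c'' ->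
  cod c x -> dom c' (bwd c x) -> dom c'' (bwd c x) ->
  'J (transition c c'') x =
  'J (transition c c') x *m 'J (transition c' c'') (transition c c' x).
Proof.
move=> ac ac' ac'' cx c'x c''x.
have d1 := smooth_on_diff (smooth_transition ac ac') (overlapP cx c'x).
have d3 := smooth_on_diff (smooth_transition ac ac'') (overlapP cx c''x).
have d2 : differentiable (transition c' c'') (transition c c' x).
  apply: (smooth_on_diff (smooth_transition ac' ac'')).
  by apply: overlapP; [exact: cod_transition|rewrite bwd_transition].
rewrite -(jacobian_comp d1 d2); apply: (jacobian_near (open_overlap c c')) => //.
by move=> y [_ h]; rewrite transition_comp.
Qed.

(** Going to [c'] and back is the identity of [c], so the Jacobian has a right inverse, which
    suffices for a square matrix. *)
Lemma jacobian_unit c c' x : atlas S c -> atlas S c' -> overlap c c' x ->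
  'J (transition c c') x \in unitmx.
Proof.
move=> ac ac' [cx c'x].
have := jacobian_transition ac ac' ac cx c'x (dom_bwd cx).
rewrite (jacobian_id cx) => /esym/mulmx1_unit[u _]; exact: u.
Qed.

Lemma frame_unit c x : atlas S c -> cod c x -> frame S c x \in unitmx.
Proof.
move=> ac cx; apply: jacobian_unit => //; first exact: chart_at_atlas.
by apply: overlapP => //; exact: mem_chart_at.
Qed.

Lemma frame_transition c c' x : atlas S c -> atlas S c' -> overlap c c' x ->
  frame S c x = 'J (transition c c') x *m frame S c' (transition c c' x).
Proof.
move=> ac ac' [cx c'x]; rewrite /frame bwd_transition //.
apply: jacobian_transition => //; first exact: chart_at_atlas.
exact: mem_chart_at.
Qed.

Lemma frame_chart_at p : frame S (chart_at S p) (fwd (chart_at S p) p) = 1%:M.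
Proof.
have h := mem_chart_at S p.
by rewrite /frame bwd_fwd // jacobian_id //; exact: cod_fwd.
Qed.

Lemma twoform_in_transition (w : M -> 'M[R]_n) c c' x :
  atlas S c -> atlas S c' -> overlap c c' x ->
  twoform_in S w c x = 'J (transition c c') x *m
    twoform_in S w c' (transition c c' x) *m ('J (transition c c') x)^T.
Proof.
move=> ac ac' o; rewrite /twoform_in (frame_transition ac ac' o).
by rewrite (bwd_transition o.2) trmx_mul !mulmxA.
Qed.

Lemma endo_in_transition (J : M -> 'M[R]_n) c c' x :
  atlas S c -> atlas S c' -> overlap c c' x ->
  endo_in S J c x *m 'J (transition c c') x =
  'J (transition c c') x *m endo_in S J c' (transition c c' x).
Proof.
move=> ac ac' o; rewrite /endo_in (frame_transition ac ac' o).
rewrite (bwd_transition o.2).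
have u1 := jacobian_unit ac ac' o.
have u2 := frame_unit ac' (cod_transition o.2).
exact: (conj_frame_mul _ u1 u2).
Qed.

Lemma twoform_in_chart_at (w : M -> 'M[R]_n) p :
  twoform_in S w (chart_at S p) (fwd (chart_at S p) p) = w p.
Proof.
rewrite /twoform_in frame_chart_at mul1mx trmx1 mulmx1 bwd_fwd //.
exact: mem_chart_at.
Qed.

Lemma endo_in_chart_at (J : M -> 'M[R]_n) p :
  endo_in S J (chart_at S p) (fwd (chart_at S p) p) = J p.
Proof.
rewrite /endo_in frame_chart_at mul1mx invmx1 mulmx1 bwd_fwd //.
exact: mem_chart_at.
Qed.

Section Maps.
Implicit Types (V W : normedModType R).

Lemma smooth_into_open V (U : set V) (g : V -> M) c : open U ->
  smooth_into S U g -> open (U `&` g @^-1` dom c).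
Proof. by move=> oU [cg _]; apply: openI_preimage => //; exact: dom_open. Qed.

Lemma smooth_into_sub V (U U' : set V) (g : V -> M) : U' `<=` U ->
  smooth_into S U g -> smooth_into S U' g.
Proof.
move=> sU [cg sg]; split=> [z Uz|c ac]; first exact: (cg z (sU z Uz)).
by apply: smooth_on_sub (sg c ac) => z [/sU].
Qed.

Lemma smooth_into_local V (U : set V) (g : V -> M) :
  (forall z, U z -> exists A : set V, exists f : V -> M,
    [/\ open A, A z, (forall y, A y -> f y = g y) & smooth_into S A f]) ->
  smooth_into S U g.
Proof.
move=> H; split=> [z /H [A [f [oA Az fg [cf _]]]]|c ac].
  have nf : {near z, g =1 f}.
    by apply: filterS (open_nbhs_nbhs (conj oA Az)) => y Ay; rewrite fg.
  rewrite /prop_for /continuous_at (nbhs_singleton nf).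
  by apply: cvg_trans (cf _ Az); apply: near_eq_cvg; apply: filterS nf.
apply: smooth_on_local => z [/H [A [f [oA Az fg sf]]] gz].
exists (A `&` f @^-1` dom c), (fwd c \o f); split.
- exact: smooth_into_open.
- by split => //=; rewrite fg.
- by move=> y [Ay _] /=; rewrite fg.
- by have [_] := sf; apply.
Qed.

Lemma smooth_into_comp V W (U : set V) (A : set W) (f : V -> W) (g : W -> M) :
  finite_dim W -> open U -> open A -> (forall x, U x -> A (f x)) ->
  smooth_on U f -> smooth_into S A g -> smooth_into S U (fun x => g (f x)).
Proof.
move=> fW oU oA fA sf [cg sg]; split=> [z Uz|c ac].
  apply: (@continuous_comp _ _ _ f g); first exact: (smooth_on_cont sf).
  exact: (cg _ (fA _ Uz)).
have oAc : open (A `&` g @^-1` dom c) by exact: smooth_into_open.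
have oUc : open (U `&` (g \o f) @^-1` dom c).
  rewrite (_ : _ `&` _ = U `&` f @^-1` (A `&` g @^-1` dom c)).
    by apply: openI_preimage => // z Uz; exact: (smooth_on_cont sf).
  by apply/seteqP; split=> z /= [Uz]; [move=> h; split; auto|case].
apply: (smooth_on_comp_mx (f := f) (g := fwd c \o g) fW oUc oAc _ _ (sg c ac)).
  by move=> x [Ux h]; split; auto.
by apply: smooth_on_sub sf => x [].
Qed.

Lemma smooth_into_bwd c : atlas S c -> smooth_into S (cod c) (bwd c).
Proof.
move=> ac; split=> [z cz|c' ac']; first exact: bwd_continuous.
exact: smooth_transition.
Qed.

Lemma smooth_into_cst V (U : set V) p : smooth_into S U (fun _ => p).
Proof.
split=> [z _|c ac]; first exact: cst_continuous.
exact: smooth_on_cst.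
Qed.

Lemma derive_chart V (U : set V) (g : V -> M) c c' z v : open U ->
  smooth_into S U g -> U z -> atlas S c -> atlas S c' ->
  dom c (g z) -> dom c' (g z) ->
  'D_v (fwd c' \o g) z =
  'D_v (fwd c \o g) z *m 'J (transition c c') (fwd c (g z)).
Proof.
move=> oU sg Uz ac ac' cz c'z; have [_ sgc] := sg.
have oc := smooth_into_open c oU sg.
have d1 : differentiable (fwd c \o g) z by exact: (smooth_on_diff (sgc c ac)).
have d2 : differentiable (transition c c') (fwd c (g z)).
  exact: (smooth_on_diff (smooth_transition ac ac') (overlap_fwd cz c'z)).
rewrite -(derive_jacobian _ d2) -(derive_comp v d1 d2).
apply: (derive_near v oc (conj Uz cz)) => y [_ cy].
by rewrite /transition /= bwd_fwd.
Qed.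

End Maps.
End Charts.

Arguments open_cod {R n M} c.
Arguments open_overlap {R n M} c c'.

(** * The circle action in charts *)

Section Slices.
Variable R : realType.
Implicit Types (V W Z : normedModType R).

Lemma derive_pair V W Z (a : Z -> V) (b : Z -> W) z v :
  differentiable a z -> differentiable b z ->
  'D_v (fun y => (a y, b y)) z = ('D_v a z, 'D_v b z).
Proof.
move=> da db; have dp := differentiable_pair da db.
by rewrite (deriveE _ dp) (diff_pair da db) (deriveE _ da) (deriveE _ db).
Qed.

Lemma derive_slice1 V W Z (f : V * W -> Z) t x v : differentiable f (t, x) ->
  'D_v (fun s => f (s, x)) t = 'D_(v, 0) f (t, x).
Proof.
move=> df; have d1 : differentiable (fun s : V => s) t by exact: ex_diff.
have d2 : differentiable (fun _ : V => x) t by exact: differentiable_cst.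
have dp := differentiable_pair d1 d2.
rewrite (derive_comp v dp df) (derive_pair v d1 d2).
by rewrite (f_equal2 pair (derive_id t v) (derive_cst x t v)).
Qed.

Lemma derive_slice2 V W Z (f : V * W -> Z) t x v : differentiable f (t, x) ->
  'D_v (fun y => f (t, y)) x = 'D_(0, v) f (t, x).
Proof.
move=> df; have d1 : differentiable (fun _ : W => t) x by exact: differentiable_cst.
have d2 : differentiable (fun y : W => y) x by exact: ex_diff.
have dp := differentiable_pair d1 d2.
rewrite (derive_comp v dp df) (derive_pair v d1 d2).
by rewrite (f_equal2 pair (derive_cst t x v) (derive_id x v)).
Qed.

Lemma derive_split V W Z (f : V * W -> Z) z u v : differentiable f z ->
  'D_(u, v) f z = 'D_(u, 0) f z + 'D_(0, v) f z.
Proof.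
move=> df; rewrite -(derive_dirD _ _ df).
by rewrite (_ : (u, v) = (u, 0) + (0, v)) //; congr (_, _); rewrite /= ?addr0 ?add0r.
Qed.

Lemma differentiable_slice1 V W Z (f : V * W -> Z) t x : differentiable f (t, x) ->
  differentiable (fun s => f (s, x)) t.
Proof.
move=> df; have d1 : differentiable (fun s : V => s) t by exact: ex_diff.
have d2 : differentiable (fun _ : V => x) t by exact: differentiable_cst.
exact: (differentiable_comp (differentiable_pair d1 d2) df).
Qed.

Lemma differentiable_slice2 V W Z (f : V * W -> Z) t x : differentiable f (t, x) ->
  differentiable (fun y => f (t, y)) x.
Proof.
move=> df; have d1 : differentiable (fun _ : W => t) x by exact: differentiable_cst.
have d2 : differentiable (fun y : W => y) x by exact: ex_diff.
exact: (differentiable_comp (differentiable_pair d1 d2) df).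
Qed.

Lemma derive_shift0 W (f : R -> W) (t : R) : differentiable f t ->
  'D_1 (fun s => f (t + s)) 0 = 'D_1 f t.
Proof.
move=> df.
have ds : is_diff 0 (fun s : R => t + s) id.
  apply: (is_diff_eq (is_diffD (is_diff_cst t 0) (is_diff_id 0))).
  exact: add0r.
have d1 : differentiable (fun s : R => t + s) 0 by [].
have df' : differentiable f (t + 0) by rewrite addr0.
by rewrite (derive_comp (1 : R) d1 df') (deriveE _ d1) diff_val addr0.
Qed.

Lemma derive0_const_mx m p (f : R -> 'M[R]_(m, p)) :
  (forall t, differentiable f t) -> (forall t, 'D_1 f t = 0) ->
  forall t, f t = f 0.
Proof.
move=> df f0 t; apply/matrixP => i j.
have d0 (s : R) : is_derive s 1 (fun y => f y i j) 0.
  have d := differentiable_entry i j (df s).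
  split; first exact: diff_derivable.
  by rewrite (derive_entry _ _ _ (df s)) f0 mxE.
exact: (@is_derive_0_is_cst _ (fun y => f y i j) t 0 d0).
Qed.

End Slices.

Definition flow (R : realType) (n : nat) (M : topologicalType)
    (S : smooth_structure R n M) (rho : circle_action S) (c c' : chart R n M)
    (t : R) (x : 'rV[R]_n) : 'rV[R]_n := fwd c' (rho t (bwd c x)).

(* Jacobians are locked: unification would otherwise unfold the derivatives. *)
HB.lock Definition trans_jac (R : realType) (n : nat) (M : topologicalType)
    (c c' : chart R n M) (x : 'rV[R]_n) : 'M[R]_n := 'J (transition c c') x.

HB.lock Definition flow_jac (R : realType) (n : nat) (M : topologicalType)
    (S : smooth_structure R n M) (rho : circle_action S) (c c' : chart R n M)
    (t : R) (x : 'rV[R]_n) : 'M[R]_n := 'J (flow rho c c' t) x.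

HB.lock Definition field_in (R : realType) (n : nat) (M : topologicalType)
    (S : smooth_structure R n M) (rho : circle_action S) (c : chart R n M)
    (x : 'rV[R]_n) : 'rV[R]_n := 'D_1 (fun t => flow rho c c t x) 0.

HB.lock Definition form_in (R : realType) (n : nat) (M : topologicalType)
    (S : smooth_structure R n M) (w : symplectic_form S) (c : chart R n M)
    (x : 'rV[R]_n) : 'M[R]_n := twoform_in S w c x.

Section Flow.
Variables (R : realType) (n : nat) (M : topologicalType).
Variables (S : smooth_structure R n M) (rho : circle_action S).
Implicit Types (c : chart R n M) (x : 'rV[R]_n) (t : R).

Definition flow_dom c c' : set (R * 'rV[R]_n) :=
  [set z | cod c z.2] `&` (fun z => rho z.1 (bwd c z.2)) @^-1` dom c'.

Lemma open_cod2 c : open [set z : R * 'rV[R]_n | cod c z.2].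
Proof.
apply: open_comp; last exact: open_cod.
by move=> z _; exact: cvg_snd.
Qed.

Arguments open_cod2 : clear implicits.

Lemma open_flow_dom c c' : atlas S c -> open (flow_dom c c').
Proof.
by move=> ac; exact: (smooth_into_open c' (open_cod2 c) (act_smooth rho ac)).
Qed.

Arguments open_flow_dom : clear implicits.

Lemma smooth_flow c c' : atlas S c -> atlas S c' ->
  smooth_on (flow_dom c c') (fun z => flow rho c c' z.1 z.2).
Proof. by move=> ac ac'; have [_ /(_ c' ac')] := act_smooth rho ac. Qed.

Lemma differentiable_flow c c' z : atlas S c -> atlas S c' -> flow_dom c c' z ->
  differentiable (fun z => flow rho c c' z.1 z.2) z.
Proof. by move=> ac ac' h; exact: (smooth_on_diff (smooth_flow ac ac') h). Qed.

Lemma flow_jacE c c' t x v : atlas S c -> atlas S c' -> flow_dom c c' (t, x) ->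
  v *m flow_jac rho c c' t x = 'D_(0, v) (fun z => flow rho c c' z.1 z.2) (t, x).
Proof.
move=> ac ac' h; have df := differentiable_flow ac ac' h.
rewrite flow_jac.unlock -(derive_slice2 v df).
by rewrite -(derive_jacobian _ (differentiable_slice2 df)).
Qed.

Lemma smooth_flow_jac c c' : atlas S c -> atlas S c' ->
  smooth_on (flow_dom c c') (fun z => flow_jac rho c c' z.1 z.2).
Proof.
move=> ac ac'; have oF := open_flow_dom c c' ac.
apply: (smooth_on_mx oF) => i j.
have := smooth_on_entry 0 j oF (smooth_on_derive (0, delta_mx 0 i) (smooth_flow ac ac')).
apply: (smooth_on_eq oF) => -[t x] h.
by rewrite -(flow_jacE _ ac ac' h) -rowE [LHS]mxE.
Qed.

Lemma bwd_flow c c' t x : flow_dom c c' (t, x) ->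
  bwd c' (flow rho c c' t x) = rho t (bwd c x).
Proof. by move=> [_ h]; exact: bwd_fwd. Qed.

Lemma cod_flow c c' t x : flow_dom c c' (t, x) -> cod c' (flow rho c c' t x).
Proof. by move=> [_ h]; exact: cod_fwd. Qed.

Lemma flow_dom0 c x : cod c x -> flow_dom c c (0, x).
Proof. by move=> cx; split => //=; rewrite act0; exact: dom_bwd. Qed.

Lemma flow0 c x : cod c x -> flow rho c c 0 x = x.
Proof. by move=> cx; rewrite /flow act0 fwd_bwd. Qed.

Lemma field_inE c x : atlas S c -> cod c x ->
  field_in rho c x = 'D_(1, 0) (fun z => flow rho c c z.1 z.2) (0, x).
Proof.
move=> ac cx; have df := differentiable_flow ac ac (flow_dom0 cx).
by rewrite field_in.unlock -(derive_slice1 _ df).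
Qed.

Lemma smooth_field_in c : atlas S c -> smooth_on (cod c) (field_in rho c).
Proof.
move=> ac; have oc := open_cod c.
have sD := smooth_on_derive ((1, 0) : R * 'rV[R]_n) (smooth_flow ac ac).
have s0 : smooth_on (cod c) (fun x : 'rV[R]_n => (0 : R, x)).
  by apply: smooth_on_pair => //; [exact: smooth_on_cst|exact: smooth_on_id].
have := smooth_on_comp_mx (finite_dim_pair (finite_dim_R R) (finite_dim_mx R 1 n))
  oc (open_flow_dom c c ac) (fun x cx => flow_dom0 cx) s0 sD.
by apply: (smooth_on_eq oc) => x cx; rewrite field_inE.
Qed.

Lemma derive_flow_t c c' t x : atlas S c -> atlas S c' -> flow_dom c c' (t, x) ->
  'D_(1, 0) (fun z => flow rho c c' z.1 z.2) (t, x) =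
  field_in rho c' (flow rho c c' t x).
Proof.
move=> ac ac' h; have df := differentiable_flow ac ac' h.
rewrite -(derive_slice1 _ df) /= -(derive_shift0 (differentiable_slice1 df)).
rewrite field_in.unlock; congr (derive _ (0 : R) (1 : R)); apply/funext => s /=.
have h2 : dom c' (rho t (bwd c x)) := h.2.
by rewrite /flow (bwd_fwd h2) addrC actD.
Qed.

(** The group law read as [rho t (rho s p)]: the velocity at time [t] is the pushforward of the
    velocity at time 0. Reading it as [rho s (rho t p)] gives [derive_flow_t]; together they say
    that the flow preserves its generator. *)
Lemma derive_flow_t' c c' t x : atlas S c -> atlas S c' -> flow_dom c c' (t, x) ->
  'D_(1, 0) (fun z => flow rho c c' z.1 z.2) (t, x) =
  field_in rho c x *m flow_jac rho c c' t x.
Proof.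
move=> ac ac' h; have df := differentiable_flow ac ac' h; have cx := h.1.
rewrite (flow_jacE _ ac ac' h) -(derive_slice2 _ df) /=.
rewrite -(derive_slice1 _ df) /= -(derive_shift0 (differentiable_slice1 df)).
have d0 : differentiable (fun s => flow rho c c s x) 0 :=
  differentiable_slice1 (differentiable_flow ac ac (flow_dom0 cx)).
have d2 : differentiable (flow rho c c' t) (flow rho c c 0 x).
  by rewrite flow0 //; exact: (differentiable_slice2 df).
have E := derive_comp (1 : R) d0 d2; rewrite (flow0 cx) in E.
rewrite field_in.unlock; apply: (etrans _ E).
have oU : open ((fun s : R => (s, x)) @^-1` flow_dom c c).
  apply: open_comp; last exact: open_flow_dom.
  move=> s _; exact: (@cvg_pair R R 'rV[R]_n (nbhs s) (nbhs s) (nbhs x) _ _ _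
    id (fun=> x) cvg_id (cvg_cst x)).
apply: (derive_near (1 : R) oU (flow_dom0 cx)) => s hs.
by rewrite /flow (bwd_flow hs) actD.
Qed.

Lemma flow_jac_act_id c t x : (forall p, rho t p = p) -> atlas S c -> cod c x ->
  flow_jac rho c c t x = 1%:M.
Proof.
move=> rt ac cx; rewrite flow_jac.unlock -(jacobian_id cx).
by congr ('J _ x); apply/funext => y; rewrite /flow rt.
Qed.

Lemma flow_jac_id c x : atlas S c -> cod c x -> flow_jac rho c c 0 x = 1%:M.
Proof. by apply: flow_jac_act_id => p; exact: act0. Qed.

Lemma flow_jac_right c c' c'' t x : atlas S c -> atlas S c' -> atlas S c'' ->
  flow_dom c c' (t, x) -> flow_dom c c'' (t, x) ->
  flow_jac rho c c'' t x =
  flow_jac rho c c' t x *m trans_jac c' c'' (flow rho c c' t x).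
Proof.
move=> ac ac' ac'' h h'; rewrite flow_jac.unlock trans_jac.unlock.
have df := differentiable_slice2 (differentiable_flow ac ac' h).
have o : overlap c' c'' (flow rho c c' t x).
  by split; [exact: cod_flow|rewrite /= bwd_flow //; case: h'].
have dt := smooth_on_diff (smooth_transition ac' ac'') o.
have df' := differentiable_slice2 (differentiable_flow ac ac' h).
rewrite -(jacobian_comp df dt) /=; apply/esym.
have oU : open ((fun y : 'rV[R]_n => (t, y)) @^-1` flow_dom c c').
  apply: open_comp; last exact: open_flow_dom.
  move=> s _; exact: (@cvg_pair _ R 'rV[R]_n (nbhs s) (nbhs t) (nbhs s) _ _ _
    (fun=> t) id (cvg_cst t) cvg_id).
apply: (jacobian_near oU h) => [y hy|].
  by rewrite /transition /= (bwd_flow hy).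
exact: (differentiable_comp df dt).
Qed.

Lemma flow_jac_left c c' c'' t x : atlas S c -> atlas S c' -> atlas S c'' ->
  flow_dom c c'' (t, x) -> dom c' (bwd c x) ->
  flow_jac rho c c'' t x =
  trans_jac c c' x *m flow_jac rho c' c'' t (transition c c' x).
Proof.
move=> ac ac' ac'' h c'x; rewrite flow_jac.unlock trans_jac.unlock.
have o : overlap c c' x by split; [case: h|].
have h' : flow_dom c' c'' (t, transition c c' x).
  by split; [exact: cod_transition|rewrite /= bwd_transition //; case: h].
have dt := smooth_on_diff (smooth_transition ac ac') o.
have df := differentiable_slice2 (differentiable_flow ac' ac'' h').
rewrite -(jacobian_comp dt df) /=; apply/esym.
apply: (jacobian_near (open_overlap c c') o) => [y [_ hy]|].
  by rewrite /flow /= bwd_transition.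
exact: (differentiable_comp dt df).
Qed.

Lemma trans_jac_unit c c' x : atlas S c -> atlas S c' -> overlap c c' x ->
  trans_jac c c' x \in unitmx.
Proof. by rewrite trans_jac.unlock; exact: jacobian_unit. Qed.

Lemma smooth_orbit p : smooth_into S setT (fun t : R => rho t p).
Proof.
pose c := chart_at S p; have ac := chart_at_atlas S p.
have cx := cod_fwd (mem_chart_at S p).
rewrite (_ : (fun t => _) = fun t => rho (t, fwd c p).1 (bwd c (t, fwd c p).2)).
  apply: (smooth_into_comp (f := fun t => (t, fwd c p))
    (finite_dim_pair (finite_dim_R R) (finite_dim_mx R 1 n)) openT (open_cod2 c) _ _
    (act_smooth rho ac)) => //.
  by apply: smooth_on_pair; [exact: openT|exact: smooth_on_id|exact: smooth_on_cst].
by apply/funext => t /=; rewrite bwd_fwd //; exact: mem_chart_at.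
Qed.

Lemma field_in_transition c c' x : atlas S c -> atlas S c' -> overlap c c' x ->
  field_in rho c' (transition c c' x) = field_in rho c x *m trans_jac c c' x.
Proof.
move=> ac ac' [cx c'x]; rewrite field_in.unlock trans_jac.unlock.
have g0 : rho 0 (bwd c x) = bwd c x by exact: act0.
have d0 : dom c (rho 0 (bwd c x)) by rewrite g0; exact: dom_bwd.
have d0' : dom c' (rho 0 (bwd c x)) by rewrite g0.
have E := @derive_chart R n M S _ setT (fun t : R => rho t (bwd c x)) c c' 0 (1 : R)
  openT (smooth_orbit _) I ac ac' d0 d0'.
rewrite g0 (fwd_bwd cx) in E; apply: (etrans _ E).
congr (derive _ (0 : R) (1 : R)); apply/funext => t /=.
by rewrite /flow bwd_transition.
Qed.

Lemma field_in_frame c x : atlas S c -> cod c x ->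
  field_in rho c x *m frame S c x = generator rho (bwd c x).
Proof.
move=> ac cx; have ac' := chart_at_atlas S (bwd c x).
have c'x := mem_chart_at S (bwd c x).
have := field_in_transition ac ac' (overlapP cx c'x).
rewrite trans_jac.unlock => <-; rewrite field_in.unlock /generator derive1E.
by congr (derive _ (0 : R) (1 : R)); apply/funext => t; rewrite /flow bwd_transition.
Qed.

Section Form.
Variable w : symplectic_form S.

Lemma form_in_chart_at p :
  form_in w (chart_at S p) (fwd (chart_at S p) p) = w p.
Proof. by rewrite form_in.unlock; exact: twoform_in_chart_at. Qed.

Lemma smooth_form_in c : atlas S c -> smooth_on (cod c) (form_in w c).
Proof.
move=> ac; apply: (smooth_on_eq (open_cod c) _ (omega_smooth w ac)) => x _.
by rewrite form_in.unlock.
Qed.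

Lemma form_in_skew c x : (form_in w c x)^T = - form_in w c x.
Proof.
by rewrite form_in.unlock /twoform_in !trmx_mul trmxK omega_skew mulNmx
  mulmxN mulmxA.
Qed.

Lemma form_in_unit c x : atlas S c -> cod c x -> form_in w c x \in unitmx.
Proof.
move=> ac cx; have fu := frame_unit ac cx.
by rewrite form_in.unlock /twoform_in !unitmx_mul unitmx_tr fu omega_nondegenerate.
Qed.

Lemma form_in_transition c c' x : atlas S c -> atlas S c' -> overlap c c' x ->
  form_in w c x = trans_jac c c' x *m form_in w c' (transition c c' x)
    *m (trans_jac c c' x)^T.
Proof.
by move=> ac ac' o; rewrite form_in.unlock trans_jac.unlock; exact: twoform_in_transition.
Qed.

Lemma contraction_in c x : atlas S c -> cod c x ->
  oneform_in S (Defs.contraction (generator rho) w) c x =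
  (field_in rho c x *m form_in w c x)^T.
Proof.
move=> ac cx; rewrite /oneform_in /Defs.contraction -(field_in_frame ac cx).
rewrite form_in.unlock /twoform_in; move: (field_in rho c x) (frame S c x) => X F.
by rewrite -[LHS]trmxK; congr (_^T); rewrite trmx_mul trmxK !mulmxA.
Qed.

End Form.
End Flow.

Arguments open_cod2 {R n M} c.
Arguments open_flow_dom {R n M S} rho c c'.

(** * Invariance of the symplectic form under the flow *)

HB.lock Definition field_jac (R : realType) (n : nat) (M : topologicalType)
    (S : smooth_structure R n M) (rho : circle_action S) (c : chart R n M)
    (x : 'rV[R]_n) : 'M[R]_n := 'J (field_in rho c) x.

(* Entrywise Cartan formula: [B] stands for [DX Omega], [P k] for the k-th
   partial derivative of Omega. *)
Lemma cartan_entries (R : realType) (n : nat) (X : 'rV[R]_n) (B : 'M[R]_n)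
    (P : 'I_n -> 'M[R]_n) :
  (forall i j, B i j + (X *m P i) 0 j = B j i + (X *m P j) 0 i) ->
  (forall i, (P i)^T = - P i) ->
  (forall i j k, P i j k + P j k i + P k i j = 0) ->
  B - B^T + \sum_k X 0 k *: P k = 0.
Proof.
move=> H1 H2 H3; apply/matrixP => i j; rewrite !mxE summxE.
have -> : \sum_k (X 0 k *: P k) i j = (X *m P i) 0 j - (X *m P j) 0 i.
  rewrite !mxE -sumrB; apply: eq_bigr => k _; rewrite !mxE.
  have /matrixP/(_ j k) := H2 i; rewrite !mxE => ->.
  have /eqP := H3 i j k; rewrite addr_eq0 => /eqP E.
  by rewrite -[P k i j]opprK -E; ring.
have -> : B i j = B j i + (X *m P j) 0 i - (X *m P i) 0 j by rewrite -H1 addrK.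
by ring.
Qed.

Section Symplectic.
Variables (R : realType) (n : nat) (M : topologicalType).
Variables (S : smooth_structure R n M) (rho : circle_action S).
Implicit Types (c : chart R n M) (x : 'rV[R]_n) (t : R).

Lemma field_jacE c x v : atlas S c -> cod c x ->
  v *m field_jac rho c x = 'D_v (field_in rho c) x.
Proof.
move=> ac cx; have df := smooth_on_diff (smooth_field_in rho ac) cx.
by rewrite field_jac.unlock (derive_jacobian v df).
Qed.

Lemma derive_mulmxl m p q (A : 'M[R]_(m, p)) (V : normedModType R)
    (f : V -> 'M[R]_(p, q)) z v : differentiable f z ->
  'D_v (fun y => A *m f y) z = A *m 'D_v f z.
Proof.
move=> df; have dc : differentiable (fun _ : V => A) z by exact: differentiable_cst.
by rewrite (derive_mulmx v dc df) derive_cst mul0mx add0r.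
Qed.

Lemma flow_jac_dirE c c' z v : atlas S c -> atlas S c' -> flow_dom rho c c' z ->
  v *m flow_jac rho c c' z.1 z.2 = 'D_(0, v) (fun z => flow rho c c' z.1 z.2) z.
Proof. by case: z => t x ac ac' h; exact: flow_jacE. Qed.

Lemma derive_flow_jac_comm c c' z v : atlas S c -> atlas S c' ->
  flow_dom rho c c' z ->
  v *m 'D_(1, 0) (fun z => flow_jac rho c c' z.1 z.2) z =
  'D_(0, v) ('D_(1, 0) (fun z => flow rho c c' z.1 z.2)) z.
Proof.
move=> ac ac' h; have oF := open_flow_dom rho c c' ac.
have dA := smooth_on_diff (smooth_flow_jac rho ac ac') h.
rewrite -(derive_mulmxl v _ dA).
have := smooth_schwarz_mx ((1, 0) : R * 'rV[R]_n) ((0, v) : R * 'rV[R]_n) oF h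
  (smooth_flow rho ac ac').
move=> <-; apply: (derive_near _ oF h) => y hy.
exact: (flow_jac_dirE v ac ac' hy).
Qed.

(** The variational equation of the flow: time and space derivatives commute, and the generator is
    then differentiated at the moving point. *)
Lemma derive_flow_jac c c' z : atlas S c -> atlas S c' -> flow_dom rho c c' z ->
  'D_(1, 0) (fun z => flow_jac rho c c' z.1 z.2) z =
  flow_jac rho c c' z.1 z.2 *m field_jac rho c' (flow rho c c' z.1 z.2).
Proof.
move=> ac ac' h; apply: mulmx_row_inj => v.
rewrite (derive_flow_jac_comm v ac ac' h) mulmxA.
have oF := open_flow_dom rho c c' ac.
have e y : flow_dom rho c c' y -> 'D_(1, 0) (fun z => flow rho c c' z.1 z.2) y =
    field_in rho c' (flow rho c c' y.1 y.2).
  by case: y => t x hy; exact: derive_flow_t.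
apply: (etrans (derive_near _ oF h e)).
have cF : cod c' (flow rho c c' z.1 z.2) by case: (z) h => t x /=; exact: cod_flow.
have df := differentiable_flow ac ac' h.
have dX := smooth_on_diff (smooth_field_in rho ac') cF.
rewrite (derive_comp _ df dX) (flow_jac_dirE v ac ac' h).
exact: (esym (field_jacE _ ac' cF)).
Qed.

Variable w : symplectic_form S.
Hypothesis hw : symplectic_action w rho.

Lemma derive_form_sum c x v : atlas S c -> cod c x ->
  'D_v (form_in w c) x = \sum_k v 0 k *: partial k (form_in w c) x.
Proof.
move=> ac cx; apply: derive_rV.
exact: (smooth_on_diff (smooth_form_in w ac) cx).
Qed.

Lemma derive_alpha c x i j : atlas S c -> cod c x ->
  partial i (fun y => oneform_in S (Defs.contraction (generator rho) w) c y j 0) x =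
  (field_jac rho c x *m form_in w c x) i j +
  (field_in rho c x *m partial i (form_in w c) x) 0 j.
Proof.
move=> ac cx; have dX := smooth_on_diff (smooth_field_in rho ac) cx.
have dO := smooth_on_diff (smooth_form_in w ac) cx.
have e y : cod c y -> oneform_in S (Defs.contraction (generator rho) w) c y j 0 =
    (field_in rho c y *m form_in w c y) 0 j.
  by move=> cy; rewrite (contraction_in rho w ac cy) [LHS]mxE.
apply: (etrans (derive_near (delta_mx 0 i) (open_cod c) cx e)).
rewrite (derive_entry _ _ _ (differentiable_mulmx dX dO)) (derive_mulmx _ dX dO).
rewrite [LHS]mxE -(field_jacE (delta_mx 0 i) ac cx) -mulmxA -rowE.
by rewrite [X in X + _]mxE.
Qed.

(** Cartan's formula: the Lie derivative of [w] along the generator is [d i_X w + i_X dw], and both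
    terms vanish. Skewness turns the second summand into minus the transpose of the first, as
    [cartan_entries] expects. *)
Lemma lie_derivative0 c x : atlas S c -> cod c x ->
  field_jac rho c x *m form_in w c x + form_in w c x *m (field_jac rho c x)^T +
  'D_(field_in rho c x) (form_in w c) x = 0.
Proof.
move=> ac cx; have dO := smooth_on_diff (smooth_form_in w ac) cx.
have E : form_in w c x *m (field_jac rho c x)^T =
    - (field_jac rho c x *m form_in w c x)^T.
  by rewrite trmx_mul form_in_skew mulNmx opprK.
rewrite E (derive_form_sum _ ac cx); apply: cartan_entries => [i j|i|i j k].
- by have := hw ac cx i j; rewrite (derive_alpha i j ac cx) (derive_alpha j i ac cx).
- have e : (fun y => (form_in w c y)^T) = - form_in w c.
    by apply/funext => y; rewrite form_in_skew.
  rewrite /partial -(derive_trmx _ dO) e deriveN //; exact: diff_derivable dO.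
have := omega_closed w ac cx i j k; rewrite /partial.
rewrite form_in.unlock in dO *.
by rewrite !(derive_entry _ _ _ dO).
Qed.

(** The time derivative of the pulled-back form is [A (L_X w) A^T], the pullback of the Lie
    derivative. *)
Lemma flow_symplectic_deriv c c' z : atlas S c -> atlas S c' ->
  flow_dom rho c c' z ->
  let Q z := flow_jac rho c c' z.1 z.2 *m form_in w c' (flow rho c c' z.1 z.2) *m
    (flow_jac rho c c' z.1 z.2)^T in
  differentiable Q z /\ 'D_(1, 0) Q z = 0.
Proof.
move=> ac ac' h Q.
have cF : cod c' (flow rho c c' z.1 z.2) by case: (z) h => t x /=; exact: cod_flow.
have df := differentiable_flow ac ac' h.
have dA := smooth_on_diff (smooth_flow_jac rho ac ac') h.
have dO := smooth_on_diff (smooth_form_in w ac') cF.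
have dOF : differentiable
    (fun z : R * 'rV[R]_n => form_in w c' (flow rho c c' z.1 z.2)) z.
  exact: (differentiable_comp df dO).
have dAO := differentiable_mulmx dA dOF; have dT := differentiable_trmx dA.
split; first exact: (differentiable_mulmx dAO dT).
rewrite /Q (derive_mulmx _ dAO dT) (derive_mulmx _ dA dOF) (derive_trmx _ dA).
rewrite (derive_flow_jac ac ac' h) (derive_comp _ df dO).
have e : 'D_(1, 0) (fun z => flow rho c c' z.1 z.2) z =
    field_in rho c' (flow rho c c' z.1 z.2).
  by case: (z) h => t x hy; exact: derive_flow_t.
rewrite e; have := lie_derivative0 ac' cF.
move: (flow_jac _ _ _ _ _) (field_jac _ _ _) (form_in _ _ _) (derive _ _ _).
move=> A B O D H.
rewrite (_ : _ + _ = A *m (B *m O + O *m B^T + D) *m A^T).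
  by rewrite H mulmx0 mul0mx.
by rewrite trmx_mul !mulmxDr !mulmxDl !mulmxA addrAC.
Qed.

(** The pulled-back form has zero time derivative and is [w] at time 0. The work lies in the charts,
    since the orbit may leave any of them. *)
Lemma flow_symplectic c c' t x : atlas S c -> atlas S c' -> flow_dom rho c c' (t, x) ->
  flow_jac rho c c' t x *m form_in w c' (flow rho c c' t x) *m
  (flow_jac rho c c' t x)^T = form_in w c x.
Proof.
move=> ac ac' h; have cx : cod c x := h.1.
pose q c1 s := flow_jac rho c c1 s x *m form_in w c1 (flow rho c c1 s x) *m
  (flow_jac rho c c1 s x)^T.
(* The pulled-back form does not depend on the target chart: the Jacobian on the right of [flow_jac]
   is absorbed by the change of [form_in]. *)
have qq c1 c2 s : atlas S c1 -> atlas S c2 -> flow_dom rho c c1 (s, x) ->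
    flow_dom rho c c2 (s, x) -> q c1 s = q c2 s.
  move=> a1 a2 h1 h2; rewrite /q (flow_jac_right ac a1 a2 h1 h2).
  have o : overlap c1 c2 (flow rho c c1 s x).
    by split; [exact: cod_flow|rewrite /= (bwd_flow h1); case: h2].
  rewrite (form_in_transition w a1 a2 o) trmx_mul !mulmxA.
  by rewrite {1}/transition /= (bwd_flow h1).
(* The target chart follows the orbit. Near each time it may be frozen, by the independence just
   shown. *)
pose ch s := chart_at S (rho s (bwd c x)).
have ach s : atlas S (ch s) by exact: chart_at_atlas.
have hch s : flow_dom rho c (ch s) (s, x) by split => //; exact: mem_chart_at.
have E s : differentiable (fun s => q (ch s) s) s /\ 'D_1 (fun s => q (ch s) s) s = 0.
  have [dQ DQ] := flow_symplectic_deriv ac (ach s) (hch s).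
  have dq : differentiable (q (ch s)) s by exact: (differentiable_slice1 dQ).
  have Dq : 'D_1 (q (ch s)) s = 0 := etrans (derive_slice1 (1 : R) dQ) DQ.
  have oU : open ((fun u : R => (u, x)) @^-1` flow_dom rho c (ch s)).
    apply: open_comp; last exact: open_flow_dom.
    move=> u _; exact: (@cvg_pair R R 'rV[R]_n (nbhs u) (nbhs u) (nbhs x) _ _ _
      id (fun=> x) cvg_id (cvg_cst x)).
  have e (u : R) : flow_dom rho c (ch s) (u, x) ->
      q (ch s) u = q (ch u) u by move=> hu; exact: (qq _ _ _ (ach s) (ach u) hu (hch u)).
  split; last by rewrite -(derive_near (1 : R) oU (hch s) e) Dq.
  apply: near_eq_differentiable dq.
  by apply: filterS (open_nbhs_nbhs (conj oU (hch s))) => u; exact: e.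
have C := derive0_const_mx (fun s => (E s).1) (fun s => (E s).2) t.
rewrite -/(q c' t) (qq c' (ch t) t ac' (ach t) h (hch t)) C.
rewrite -(qq c (ch 0) 0 ac (ach 0) (flow_dom0 rho cx) (hch 0)).
by rewrite /q (flow_jac_id rho ac cx) mul1mx trmx1 mulmx1 flow0.
Qed.

End Symplectic.

(** * Traces of complex linear parts *)

Section EntryRules.
Variables (R : pzRingType) (m p : nat).
Implicit Types A B : 'M[R]_(m, p).

Lemma mx_addE A B i j : (A + B) i j = A i j + B i j. Proof. by rewrite mxE. Qed.
Lemma mx_oppE A i j : (- A) i j = - A i j. Proof. by rewrite mxE. Qed.
Lemma mx_scaleE a A i j : (a *: A) i j = a * A i j. Proof. by rewrite mxE. Qed.
(** Expands sums, opposites and multiples entrywise but leaves matrix products as atoms for [ring]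
    and [lra]. *)
Definition mx_linE := (mx_addE, mx_oppE, mx_scaleE).

End EntryRules.

Section PsdTrace.
Variables (R : realFieldType) (n : nat).
Implicit Types (S N : 'M[R]_n) (u v : 'rV[R]_n).

Definition psd S := S^T = S /\ forall v, 0 <= (v *m S *m v^T) 0 0.

Lemma delta_form S i j : ((delta_mx 0 i : 'rV_n) *m S *m (delta_mx 0 j : 'rV_n)^T) 0 0 = S i j.
Proof. by rewrite trmx_delta -rowE -colE !mxE. Qed.

Lemma psd_diag S i : psd S -> 0 <= S i i.
Proof. by move=> [_ /(_ (delta_mx 0 i))]; rewrite delta_form. Qed.

Lemma formD S u v : S^T = S ->
  ((u + v) *m S *m (u + v)^T) 0 0 =
  (u *m S *m u^T) 0 0 + (v *m S *m v^T) 0 0 + 2 * (u *m S *m v^T) 0 0.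
Proof.
move=> sS; rewrite linearD /= !mulmxDl !mulmxDr !mx_linE.
have -> : (v *m S *m u^T) 0 0 = (u *m S *m v^T) 0 0.
  have -> : v *m S *m u^T = (u *m S *m v^T)^T by rewrite !trmx_mul trmxK sS mulmxA.
  by rewrite mxE.
by ring.
Qed.

Lemma formZ S u v a b : ((a *: u) *m S *m (b *: v)^T) 0 0 = a * b * (u *m S *m v^T) 0 0.
Proof. by rewrite linearZ /= -!scalemxAl -scalemxAr scalerA mx_scaleE. Qed.

Lemma formZr S u v b : (u *m S *m (b *: v)^T) 0 0 = b * (u *m S *m v^T) 0 0.
Proof. by rewrite linearZ /= -scalemxAr mx_scaleE. Qed.

(** On [e_i + e_j] and [e_i - e_j] the form takes the values [2 S i j] and [- 2 S i j], both
    nonnegative. *)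
Lemma psd_diag0 S : psd S -> (forall i, S i i = 0) -> S = 0.
Proof.
move=> [sS S0] d0; apply/matrixP => i j; rewrite mxE.
have := S0 (delta_mx 0 i + delta_mx 0 j).
have := S0 (delta_mx 0 i + (-1) *: delta_mx 0 j).
rewrite !formD // formZ formZr !delta_form !d0.
by lra.
Qed.

Lemma mul_row_col_form N (c : 'rV[R]_n) : (c *m N *m c^T) 0 0 = \tr (c^T *m c *m N).
Proof. by rewrite -[in RHS]mulmxA mxtrace_mulC /mxtrace big_ord1. Qed.

(* Peeling off the rank-one part [c^T c / S i i] of a row [c] of [S] is one
   step of the Cholesky decomposition. *)
Lemma psd_step S i : psd S -> S i i != 0 ->
  let c := row i S in psd (S - (S i i)^-1 *: (c^T *m c)).
Proof.
move=> hS Sii c; have [sS S0] := hS; split.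
  by rewrite linearB linearZ /= trmx_mul trmxK sS.
move=> v; set a := (v *m c^T) 0 0.
have ca : (v *m (c^T *m c) *m v^T) 0 0 = a ^+ 2.
  rewrite mulmxA -mulmxA mxE big_ord1 expr2; congr (_ * _).
  by rewrite -[c in c *m _]trmxK -trmx_mul mxE.
(* Completing the square: this translate of [v] minimises the form along the direction of the [i]-th
   basis vector. *)
have := S0 (v + (- (a / S i i)) *: delta_mx 0 i).
rewrite formD // formZ formZr delta_form.
have -> : (v *m S *m (delta_mx 0 i : 'rV_n)^T) 0 0 = a.
  by rewrite /a /c rowE trmx_mul sS mulmxA.
rewrite mulmxBr mulmxBl -scalemxAr -scalemxAl [X in 0 <= X -> _](_ : _ =
  (v *m S *m v^T) 0 0 - a ^+ 2 / S i i); last by field.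
by rewrite !mx_linE ca mulrC.
Qed.

(** Cholesky decomposition by induction on the number of nonzero diagonal entries: each peeled
    rank-one part [c^T c / S i i] adds [c N c^T / S i i > 0] to the trace. Only the quadratic form
    of [N] enters. *)
Lemma psd_trace S N : psd S ->
  (forall x : 'rV[R]_n, x != 0 -> 0 < (x *m N *m x^T) 0 0) ->
  0 <= \tr (S *m N) /\ (S != 0 -> 0 < \tr (S *m N)).
Proof.
move=> hS hN.
have [k hk] : exists k, (#|[set i | S i i != 0%R]%SET| <= k)%N.
  by exists #|[set i | S i i != 0%R]%SET|.
elim: k S hS hk => [|k IH] S hS hk.
  have S0 : S = 0.
    apply: psd_diag0 => // i; apply/eqP; move: hk; rewrite leqn0 cards_eq0.
    by move=> /eqP/setP/(_ i); rewrite !inE => /negbFE.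
  by rewrite S0 mul0mx mxtrace0 eqxx.
have [S0|Sn0] := eqVneq S 0; first by rewrite S0 mul0mx mxtrace0.
have [i Sii] : exists i, S i i != 0.
  apply/existsP; apply: contraNT Sn0; rewrite negb_exists => /forallP H.
  by apply/eqP/psd_diag0 => // i; have := H i; rewrite negbK => /eqP.
have Spos : 0 < S i i by rewrite lt_def Sii psd_diag.
pose c := row i S; pose S' := S - (S i i)^-1 *: (c^T *m c).
have hS' : psd S' by exact: psd_step.
have E : S = S' + (S i i)^-1 *: (c^T *m c) by rewrite subrK.
have c0 : c != 0.
  by apply: contraNneq Sii => /rowP/(_ i); rewrite !mxE => ->.
have cN : 0 < \tr (c^T *m c *m N).
  by have := hN _ c0; rewrite mul_row_col_form.
have [|p _] := IH S' hS'.
  (* A zero diagonal entry stays zero: subtracting a square makes it nonpositive, and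
     semidefiniteness makes it nonnegative. Entry [i] becomes zero, so the count drops. *)
  rewrite -ltnS; apply: leq_trans hk; apply: proper_card; apply/properP; split.
    apply/fintype.subsetP => j; rewrite !inE; apply: contraNneq => Sjj.
    have h := psd_diag j hS'; rewrite eq_le h andbT.
    have -> : S' j j = - ((S i i)^-1 * (S i j * S i j)).
      by rewrite /S' !mxE big_ord1 !mxE Sjj sub0r.
    by rewrite oppr_le0 mulr_ge0 ?invr_ge0 ?(ltW Spos) // -expr2 sqr_ge0.
  exists i; rewrite !inE //; rewrite negbK /S' !mxE big_ord1 !mxE mulKf // subrr //.
suff : 0 < \tr (S *m N) by move=> h; split; [exact: ltW|].
rewrite E mulmxDl mxtraceD -scalemxAl mxtraceZ ltr_wpDl //.
by rewrite mulr_gt0 // invr_gt0.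
Qed.

End PsdTrace.

Section ComplexLinear.
Variables (R : realFieldType) (n : nat).
Implicit Types (A B J O Z : 'M[R]_n) (x y u v : 'rV[R]_n).

(* The complex linear and antilinear parts of a map between two complex vector
   spaces. *)
Definition clin J0 J1 A : 'M[R]_n := 2^-1 *: (A - J0 *m A *m J1).
Definition canti J0 J1 A : 'M[R]_n := 2^-1 *: (A + J0 *m A *m J1).

Definition compatible O J := [/\ J *m J = - 1%:M, J *m O *m J^T = O &
  forall v, v != 0 -> 0 < (v *m O *m (v *m J)^T) 0 0].

Lemma clinD J0 J1 A : clin J0 J1 A + canti J0 J1 A = A.
Proof.
rewrite /clin /canti -scalerDr addrACA addNr addr0 scalerDr -scalerDl.
by rewrite (_ : 2^-1 + 2^-1 = 1 :> R) ?scale1r //; field.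
Qed.

Lemma clin_comm J0 J1 A : J0 *m J0 = - 1%:M -> J1 *m J1 = - 1%:M ->
  J0 *m clin J0 J1 A = clin J0 J1 A *m J1.
Proof.
move=> h0 h1; rewrite /clin -scalemxAr -scalemxAl mulmxBr mulmxBl; congr (_ *: _).
rewrite -[_ *m J1 *m J1]mulmxA h1 !mulmxA h0 mulmxN mulmx1 !mulNmx mul1mx !opprK.
by rewrite addrC.
Qed.

Lemma canti_comm J0 J1 A : J0 *m J0 = - 1%:M -> J1 *m J1 = - 1%:M ->
  J0 *m canti J0 J1 A = - (canti J0 J1 A *m J1).
Proof.
move=> h0 h1; rewrite /canti -scalemxAr -scalemxAl mulmxDr mulmxDl -scalerN; congr (_ *: _).
rewrite -[_ *m J1 *m J1]mulmxA h1 !mulmxA h0 mulmxN mulmx1 !mulNmx mul1mx.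
by rewrite opprD opprK addrC.
Qed.

Lemma clinN J0 J1 A : clin J0 J1 (- A) = - clin J0 J1 A.
Proof. by rewrite /clin mulmxN mulNmx -opprD scalerN. Qed.

(** [O *m J^T] is the matrix of the bilinear form [w(u, J v)], the metric defined by [w] and [J]. *)
Lemma herm_sym O J : O^T = - O -> compatible O J -> (O *m J^T)^T = O *m J^T.
Proof.
move=> sO [jj jo _]; rewrite trmx_mul trmxK sO mulmxN -{1}jo !mulmxA jj.
by rewrite !mulNmx mul1mx opprK.
Qed.

(** Write [a] and [b] for the images of [y] under the two parts. Then [y A = a + b] and
    [y J0 A = (a - b) J1], so preservation of the form gives
    [|y|^2 = g(a + b, a - b) = |a|^2 - |b|^2] in the metrics [w(-, J -)]. *)
Lemma clin_norm O0 O1 J0 J1 A y : O1^T = - O1 -> compatible O0 J0 -> compatible O1 J1 ->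
  A *m O1 *m A^T = O0 ->
  let h u := (u *m O1 *m (u *m J1)^T) 0 0 in
  h (y *m clin J0 J1 A) = h (y *m canti J0 J1 A) + (y *m O0 *m (y *m J0)^T) 0 0.
Proof.
move=> sO1 [j0 _ _] c1 AO h; have [j1 _ _] := c1.
set a := y *m clin J0 J1 A; set b := y *m canti J0 J1 A.
have Ea : y *m A = a + b by rewrite /a /b -mulmxDr clinD.
have Eb : y *m J0 *m A = (a - b) *m J1.
  rewrite -{1}(clinD J0 J1 A) -mulmxA mulmxDr clin_comm // canti_comm // mulmxBr.
  by rewrite mulmxBl !mulmxA.
have -> : y *m O0 *m (y *m J0)^T = (a + b) *m O1 *m ((a - b) *m J1)^T.
  by rewrite -Ea -Eb -AO !trmx_mul !mulmxA.
clearbody a b; rewrite /h !trmx_mul !mulmxA -![_ *m O1 *m J1^T]mulmxA.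
move: (herm_sym sO1 c1); move: (O1 *m J1^T) => G sG.
have -> : (a - b)^T = a^T - b^T by rewrite linearB.
rewrite mulmxBr !mulmxDl !mx_linE.
have -> : (b *m G *m a^T) 0 0 = (a *m G *m b^T) 0 0.
  have -> : b *m G *m a^T = (a *m G *m b^T)^T by rewrite !trmx_mul trmxK sG mulmxA.
  by rewrite mxE.
by ring.
Qed.

Lemma compatible_ge0 O J v : compatible O J -> 0 <= (v *m O *m (v *m J)^T) 0 0.
Proof.
move=> [_ _ h]; have [->|v0] := eqVneq v 0; first by rewrite !mul0mx mxE.
exact: ltW (h _ v0).
Qed.

(** A kernel vector [y] would satisfy [0 = |b|^2 + |y|^2] by [clin_norm]. *)
Lemma clin_unit O0 O1 J0 J1 A : O1^T = - O1 -> compatible O0 J0 -> compatible O1 J1 ->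
  A *m O1 *m A^T = O0 -> clin J0 J1 A \in unitmx.
Proof.
move=> sO1 c0 c1 AO; rewrite -row_free_unit -kermx_eq0; apply/rowV0P => y.
move=> /sub_kermxP y0; apply/eqP; apply: contraT => yn0.
have := clin_norm y sO1 c0 c1 AO; cbv zeta; rewrite y0 !mul0mx mxE.
have := compatible_ge0 (y *m canti J0 J1 A) c1.
by have [_ _ /(_ y yn0)] := c0; lra.
Qed.

(** The inverse of the complex linear part commutes with [J], so the antilinear part of [A B] drops
    out of the trace; cyclicity then isolates [B]. *)
Lemma clin_trace J A B : J *m J = - 1%:M -> clin J J A \in unitmx ->
  \tr (J *m clin J J (A *m B) *m invmx (clin J J A)) =
  \tr (B *m J *m (invmx (clin J J A) *m A)).
Proof.
move=> jj u; have cJ := clin_comm A jj jj; set F := clin J J A in u cJ *.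
have cV : J *m invmx F = invmx F *m J.
  by rewrite -[LHS](mulKmx u) (mulmxA F) -cJ -(mulmxA J) (mulmxV u) mulmx1.
set V := invmx F in cV *; set P := A *m B.
have E : \tr (P *m J *m V) = \tr (J *m P *m V).
  by rewrite -mulmxA cV mulmxA mxtrace_mulC mulmxA.
have -> : J *m clin J J P *m V = 2^-1 *: (J *m P *m V + P *m J *m V).
  rewrite /clin -scalemxAr -scalemxAl mulmxBr mulmxBl !mulmxA jj.
  by rewrite !mulNmx mul1mx opprK.
rewrite mxtraceZ mxtraceD E (_ : 2^-1 * _ = \tr (J *m P *m V)); last by field.
rewrite /P -!mulmxA [in LHS]mulmxA mxtrace_mulC -!mulmxA; congr (\tr (B *m _)).
by rewrite !mulmxA cV.
Qed.

(** The trace is that of [B O] times [N = O^-1 J V A], with [V] the inverse of the complex linear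
    part of [A], so [psd_trace] asks for [x N x^T > 0]. With [x = y O], [v = y J] and [z] the image
    of [v V] under the antilinear part, this number is [g(v + z, v)]. Since [|v|^2 = |z|^2 + Q] with
    [Q > 0] by [clin_norm], it is half of [|v + z|^2 + Q]. *)
Lemma clin_trace_gt0 O J A B : O^T = - O -> compatible O J -> O \in unitmx ->
  A *m O *m A^T = O -> psd (B *m O) -> B *m O != 0 ->
  0 < \tr (J *m clin J J (A *m B) *m invmx (clin J J A)).
Proof.
move=> sO c uO AO hS S0; have [jj jo pos] := c.
have u := clin_unit sO c c AO; rewrite (clin_trace B jj u).
set V := invmx _; pose N := invmx O *m J *m (V *m A).
have -> : \tr (B *m J *m (V *m A)) = \tr (B *m O *m N).
  by rewrite /N !mulmxA (mulmxK uO).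
apply: (psd_trace hS _).2 => // x x0.
have [y xE] : exists y, x = y *m O by exists (x *m invmx O); rewrite mulmxKV.
have [v yE] : exists v, y = - (v *m J).
  by exists (y *m J); rewrite -mulmxA jj mulmxN mulmx1 opprK.
have yJ : y *m J = v by rewrite yE mulNmx -mulmxA jj mulmxN mulmx1 opprK.
have v0 : v != 0.
  by apply: contraNneq x0 => v0; rewrite xE yE v0 mul0mx oppr0 mul0mx.
pose z := v *m V *m canti J J A.
have vz : v *m (V *m A) = v + z.
  by rewrite -[A in V *m A](clinD J J A) mulmxDr (mulVmx u) mulmxDr mulmx1 /z mulmxA.
have xN : x *m N = v + z by rewrite -vz -yJ /N xE !mulmxA (mulmxK uO).
have xT : x^T = O *m (v *m J)^T.
  have -> : x = - (v *m J *m O) by rewrite xE yE mulNmx.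
  have -> : (- (v *m J *m O))^T = - (v *m J *m O)^T by rewrite linearN.
  by rewrite trmx_mul sO mulNmx opprK.
rewrite xN xT mulmxA.
have := clin_norm (v *m V) sO c c AO; cbv zeta; rewrite -/z.
rewrite -[v *m V *m _]mulmxA (mulVmx u) mulmx1 => E.
have P0 : 0 < (v *m V *m O *m (v *m V *m J)^T) 0 0.
  apply: pos; apply: contraNneq v0 => h.
  by rewrite -[v](mulmxKV u) -/V h mul0mx.
clearbody z; have := compatible_ge0 (v + z) c.
move: E P0; rewrite !trmx_mul !mulmxA -![_ *m O *m J^T]mulmxA.
move: (herm_sym sO c); move: (O *m J^T) => G sG.
move: (v *m V *m G *m _) => Q E Q0.
rewrite formD // mulmxDl mulmxDl mx_addE.
have -> : (z *m G *m v^T) 0 0 = (v *m G *m z^T) 0 0.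
  have -> : z *m G *m v^T = (v *m G *m z^T)^T by rewrite !trmx_mul trmxK sG mulmxA.
  by rewrite mxE.
by lra.
Qed.

End ComplexLinear.

(** * The connection form of the complex determinant *)

Section ThetaAlgebra.
Variables (R : fieldType) (n : nat).
Implicit Types (J L P T F : 'M[R]_n).

(* As tr_R (J A) = - 2 Im (tr_C A) for complex linear A, this is -2 times the
   imaginary part of the logarithmic derivative of det_C P along a direction in
   which the covariant derivative of P is L. *)
Definition theta J L P : R := \tr (J *m L *m invmx P).

(** The target change [T1] cancels inside [L P^-1], and the source change [T0] cancels under the
    trace. *)
Lemma theta_change J0 J0' L L' P P' T0 T1 :
  T0 \in unitmx -> T1 \in unitmx -> P' \in unitmx ->
  J0 *m T0 = T0 *m J0' -> T0 *m L' = L *m T1 -> T0 *m P' = P *m T1 ->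
  theta J0 L P = theta J0' L' P'.
Proof.
move=> u0 u1 uP' hJ hL hP.
have LE : L = T0 *m L' *m invmx T1 by rewrite hL mulmxK.
have PE : P = T0 *m P' *m invmx T1 by rewrite hP mulmxK.
have JE : J0 = T0 *m J0' *m invmx T0 by rewrite -hJ mulmxK.
have u1' : invmx T1 \in unitmx by rewrite unitmx_inv.
rewrite /theta JE LE PE invmx_mul ?unitmx_mul ?u0 ?uP' // invmxK (invmx_mul u0 uP').
rewrite -!mulmxA (mulKmx u0) (mulKmx u1) mxtrace_mulC -!mulmxA (mulVmx u0) mulmx1.
by rewrite !mulmxA.
Qed.

(** Curvature of a connection along two commuting directions: [Dab] is the derivative along a of the
    connection matrix [Nb]. The order of the products is that of [curvature]. *)
Definition curv (Dab Dba Na Nb : 'M[R]_n) := Dab - Dba + Nb *m Na - Na *m Nb.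

(* [P] intertwines two connections with covariant derivative [La], [Lb]; the
   commutator of the second covariant derivatives is [P F1 - F0 P]. *)
Lemma theta_curl_algebra J0 J1 P V N0a N0b N1a N1b Pa Pb Pab
    N0ab N0ba N1ab N1ba Ja Jb (Va Vb : 'M[R]_n) :
  J0 *m P = P *m J1 -> V *m P = 1%:M -> P *m V = 1%:M ->
  Ja + J0 *m N0a = N0a *m J0 -> Jb + J0 *m N0b = N0b *m J0 ->
  Va = - V *m Pa *m V -> Vb = - V *m Pb *m V ->
  let La := Pa - N0a *m P + P *m N1a in
  let Lb := Pb - N0b *m P + P *m N1b in
  J0 *m La = La *m J1 ->
  let DaLb := Pab - (N0ab *m P + N0b *m Pa) + (Pa *m N1b + P *m N1ab) in
  let DbLa := Pab - (N0ba *m P + N0a *m Pb) + (Pb *m N1a + P *m N1ba) in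
  \tr (Ja *m Lb *m V + J0 *m DaLb *m V + J0 *m Lb *m Va) -
  \tr (Jb *m La *m V + J0 *m DbLa *m V + J0 *m La *m Vb) =
  \tr (J1 *m curv N1ab N1ba N1a N1b) - \tr (J0 *m curv N0ab N0ba N0a N0b).
Proof.
move=> JP VP PV JaE JbE -> -> La Lb JL DaLb DbLa.
have PaE : Pa = La + N0a *m P - P *m N1a by rewrite /La addrAC addrK subrK.
have PbE : Pb = Lb + N0b *m P - P *m N1b by rewrite /Lb addrAC addrK subrK.
have JaE' : Ja = N0a *m J0 - J0 *m N0a by rewrite -JaE addrK.
have JbE' : Jb = N0b *m J0 - J0 *m N0b by rewrite -JbE addrK.
(* The derivatives of [J0] and of the inverse of [P] supply the connection terms that complete the
   derivative of [K] to a covariant one, and leave a term quadratic in the covariant derivatives of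
   [P]. *)
have key K L N N' Q : Q = L + N *m P - P *m N' ->
    \tr ((N *m J0 - J0 *m N) *m K *m V + J0 *m K *m (- V *m Q *m V)) =
    \tr (J0 *m (K *m N' - N *m K) *m V) - \tr (J0 *m K *m V *m L *m V).
  move=> ->; rewrite -raddfB /= !(mulmxDl, mulmxDr, mulmxBl, mulmxBr, mulmxN, mulNmx, mulmxA).
  rewrite -(mulmxA (J0 *m K *m V *m N)) PV mulmx1.
  have -> : J0 *m K *m V *m P = J0 *m K by rewrite -(mulmxA (J0 *m K)) VP mulmx1.
  have tN (A : 'M[R]_n) : \tr (- A) = - \tr A by rewrite raddfN.
  rewrite !mxtraceD !tN !opprK.
  have -> : \tr (N *m J0 *m K *m V) = \tr (J0 *m K *m V *m N).
    by rewrite -!mulmxA mxtrace_mulC !mulmxA.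
  by ring.
(* The quadratic terms cancel: [La V] commutes with [J0], so their trace is symmetric in the two
   directions. *)
have commL : \tr (J0 *m La *m V *m Lb *m V) = \tr (J0 *m Lb *m V *m La *m V).
  have e : J0 *m (La *m V) = La *m V *m J0.
    have JV : J1 *m V = V *m J0.
      by rewrite -[J1]mul1mx -VP -(mulmxA V) -JP -!mulmxA PV mulmx1.
    by rewrite mulmxA JL -!mulmxA JV.
  rewrite -[J0 *m Lb *m V *m La *m V]mulmxA [RHS]mxtrace_mulC.
  by rewrite -(mulmxA J0 La V) e !mulmxA.
have split3 (A B C : 'M[R]_n) : \tr (A + B + C) = \tr (A + C) + \tr B.
  by rewrite !mxtraceD; ring.
rewrite !split3 JaE' JbE' (key Lb La N0a N1a Pa PaE) (key La Lb N0b N1b Pb PbE) commL.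
(* The second derivatives of [P] cancel, leaving the Ricci identity for a map between the two
   bundles. *)
have E : Lb *m N1a - N0a *m Lb + DaLb - (La *m N1b - N0b *m La + DbLa) =
    P *m curv N1ab N1ba N1a N1b - curv N0ab N0ba N0a N0b *m P.
  rewrite /Lb /La /DaLb /DbLa /curv.
  rewrite !(mulmxDl, mulmxDr, mulmxBl, mulmxBr, mulmxN, mulNmx, mulmxA).
  by apply/matrixP => i j; rewrite !mx_linE; ring.
have -> : \tr (J1 *m curv N1ab N1ba N1a N1b) =
    \tr (J0 *m (P *m curv N1ab N1ba N1a N1b) *m V).
  by rewrite (mulmxA J0 P) JP [RHS]mxtrace_mulC !mulmxA VP mul1mx.
have -> : \tr (J0 *m curv N0ab N0ba N0a N0b) =
    \tr (J0 *m (curv N0ab N0ba N0a N0b *m P) *m V).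
  by rewrite -(mulmxA J0 _ V) -(mulmxA _ P V) PV mulmx1.
have tl (A B : 'M[R]_n) : \tr (J0 *m (A - B) *m V) = \tr (J0 *m A *m V) - \tr (J0 *m B *m V).
  by rewrite mulmxBr mulmxBl raddfB.
have td (A B : 'M[R]_n) : \tr (J0 *m (A + B) *m V) = \tr (J0 *m A *m V) + \tr (J0 *m B *m V).
  by rewrite mulmxDr mulmxDl mxtraceD.
clearbody La Lb DaLb DbLa; rewrite -[RHS]tl -E [RHS]tl !td.
by ring.
Qed.

End ThetaAlgebra.

Section ThetaLocal.
Variables (R : realType) (n : nat) (V : normedModType R) (D : set V) (a b : V).
Variables (J0 J1 P : V -> 'M[R]_n) (N0 N1 : V -> V -> 'M[R]_n).
Hypotheses (oD : open D) (sJ0 : smooth_on D J0) (sJ1 : smooth_on D J1)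
  (sP : smooth_on D P).
Hypotheses (sN0 : forall v, smooth_on D (N0 v)) (sN1 : forall v, smooth_on D (N1 v)).
Hypotheses (uP : forall z, D z -> P z \in unitmx)
  (JP : forall z, D z -> J0 z *m P z = P z *m J1 z).
Hypotheses (JN0 : forall v z, D z -> 'D_v J0 z + J0 z *m N0 v z = N0 v z *m J0 z)
  (JN1 : forall v z, D z -> 'D_v J1 z + J1 z *m N1 v z = N1 v z *m J1 z).

(** [P] maps a bundle with connection [N0] to one with connection [N1]; acting on row vectors, [P]
    receives a term on each side. *)
Definition cov v z := 'D_v P z - N0 v z *m P z + P z *m N1 v z.

Definition thetaf v z := theta (J0 z) (cov v z) (P z).

Lemma smooth_cov v : smooth_on D (cov v).
Proof.
apply: (smooth_on_add oD); last exact: (smooth_on_mulmx oD sP (sN1 v)).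
apply: (smooth_on_subf oD); first exact: smooth_on_derive.
exact: (smooth_on_mulmx oD (sN0 v) sP).
Qed.

Lemma smooth_thetaf v : smooth_on D (thetaf v).
Proof.
apply: (smooth_on_mxtrace oD); apply: (smooth_on_mulmx oD).
  exact: (smooth_on_mulmx oD sJ0 (smooth_cov v)).
exact: smooth_on_invmx.
Qed.

Lemma derive_cov u v z : D z ->
  'D_u (cov v) z = 'D_u ('D_v P) z - ('D_u (N0 v) z *m P z + N0 v z *m 'D_u P z) +
    ('D_u P z *m N1 v z + P z *m 'D_u (N1 v) z).
Proof.
move=> Dz.
have dP := smooth_on_diff sP Dz; have dN0 := smooth_on_diff (sN0 v) Dz.
have dN1 := smooth_on_diff (sN1 v) Dz.
have dDP := smooth_on_diff (smooth_on_derive v sP) Dz.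
have d1 := differentiable_mulmx dN0 dP; have d2 := differentiable_mulmx dP dN1.
have d3 : differentiable (fun z => 'D_v P z - N0 v z *m P z) z.
  exact: (differentiableB dDP d1).
rewrite (derive_add u d3 d2) (derive_sub u dDP d1).
by rewrite (derive_mulmx u dN0 dP) (derive_mulmx u dP dN1).
Qed.

Lemma derive_thetaf u v z : D z ->
  'D_u (thetaf v) z = \tr ('D_u J0 z *m cov v z *m invmx (P z) +
     J0 z *m 'D_u (cov v) z *m invmx (P z) +
     J0 z *m cov v z *m (- invmx (P z) *m 'D_u P z *m invmx (P z))).
Proof.
move=> Dz; have dJ := smooth_on_diff sJ0 Dz.
have dC := smooth_on_diff (smooth_cov v) Dz.
have dV := smooth_on_diff (smooth_on_invmx oD uP sP) Dz.
have d1 := differentiable_mulmx dJ dC; have d2 := differentiable_mulmx d1 dV.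
rewrite (derive_mxtrace u d2) (derive_mulmx u d1 dV) (derive_mulmx u dJ dC).
by rewrite (derive_invmx u oD Dz uP sP) mulmxDl.
Qed.

(** Differentiate [J0 P = P J1], using that both complex structures are parallel. *)
Lemma cov_comm v z : D z -> J0 z *m cov v z = cov v z *m J1 z.
Proof.
move=> Dz; have dJ0 := smooth_on_diff sJ0 Dz; have dJ1 := smooth_on_diff sJ1 Dz.
have dP := smooth_on_diff sP Dz.
have E : 'D_v J0 z *m P z + J0 z *m 'D_v P z = 'D_v P z *m J1 z + P z *m 'D_v J1 z.
  rewrite -(derive_mulmx v dJ0 dP) -(derive_mulmx v dP dJ1).
  exact: (derive_near v oD Dz JP).
have E0 : 'D_v J0 z = N0 v z *m J0 z - J0 z *m N0 v z by rewrite -(JN0 v Dz) addrK.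
have E1 : 'D_v J1 z = N1 v z *m J1 z - J1 z *m N1 v z by rewrite -(JN1 v Dz) addrK.
move: E; rewrite E0 E1 /cov; move: (JP Dz).
move: ('D_v P z) (J0 z) (J1 z) (P z) (N0 v z) (N1 v z) => DP j0 j1 p n0 n1 jp.
rewrite !(mulmxDl, mulmxDr, mulmxN, mulNmx) !mulmxA jp.
rewrite -!(mulmxA _ j0 p) jp !mulmxA => /matrixP E.
by apply/matrixP => i j; have := E i j; rewrite !mx_linE; lra.
Qed.

(** The structure equation of a determinant: the exterior derivative of its connection form is the
    difference of the traced curvatures of target and source. *)
Lemma theta_curl z : D z ->
  'D_a (thetaf b) z - 'D_b (thetaf a) z =
  \tr (J1 z *m curv ('D_a (N1 b) z) ('D_b (N1 a) z) (N1 a z) (N1 b z)) -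
  \tr (J0 z *m curv ('D_a (N0 b) z) ('D_b (N0 a) z) (N0 a z) (N0 b z)).
Proof.
move=> Dz; have sw : 'D_b ('D_a P) z = 'D_a ('D_b P) z.
  exact: (smooth_schwarz_mx b a oD Dz sP).
rewrite (derive_thetaf a b Dz) (derive_thetaf b a Dz) (derive_cov a b Dz).
rewrite (derive_cov b a Dz) sw.
exact: (@theta_curl_algebra _ n (J0 z) (J1 z) (P z) (invmx (P z)) (N0 a z)
  (N0 b z) (N1 a z) (N1 b z) ('D_a P z) ('D_b P z) ('D_a ('D_b P) z)
  ('D_a (N0 b) z) ('D_b (N0 a) z) ('D_a (N1 b) z) ('D_b (N1 a) z)
  ('D_a J0 z) ('D_b J0 z) _ _ (JP Dz)
  (mulVmx (uP Dz)) (mulmxV (uP Dz)) (JN0 a Dz) (JN0 b Dz) erefl erefl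
  (cov_comm a Dz)).
Qed.

End ThetaLocal.

HB.lock Definition acs_in (R : realType) (n : nat) (M : topologicalType)
    (S : smooth_structure R n M) (w : symplectic_form S) (J : compatible_acs w)
    (c : chart R n M) (x : 'rV[R]_n) : 'M[R]_n := endo_in S J c x.

HB.lock Definition conn (R : realType) (n : nat) (M : topologicalType)
    (S : smooth_structure R n M) (nabla : affine_connection S)
    (c : chart R n M) (x v : 'rV[R]_n) : 'M[R]_n := \sum_j v 0 j *: nabla c x j.

Section Connection.
Variables (R : realType) (n : nat) (M : topologicalType).
Variables (S : smooth_structure R n M) (w : symplectic_form S).
Variables (J : compatible_acs w) (nabla : affine_connection S).
Hypothesis pJ : preserves_acs nabla J.
Implicit Types (c : chart R n M) (x v : 'rV[R]_n).

Lemma acs_in_chart_at p : acs_in J (chart_at S p) (fwd (chart_at S p) p) = J p.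
Proof. by rewrite acs_in.unlock; exact: endo_in_chart_at. Qed.

Lemma smooth_acs_in c : atlas S c -> smooth_on (cod c) (acs_in J c).
Proof.
move=> ac; apply: (smooth_on_eq (open_cod c) _ (acs_smooth J ac)) => x _.
by rewrite acs_in.unlock.
Qed.

Lemma acs_in_transition c c' x : atlas S c -> atlas S c' -> overlap c c' x ->
  acs_in J c x *m trans_jac c c' x =
  trans_jac c c' x *m acs_in J c' (transition c c' x).
Proof.
by move=> ac ac' o; rewrite acs_in.unlock trans_jac.unlock; exact: endo_in_transition.
Qed.

Lemma acs_in_compatible c x : atlas S c -> cod c x ->
  compatible (form_in w c x) (acs_in J c x).
Proof.
move=> ac cx; have fu := frame_unit ac cx.
rewrite acs_in.unlock form_in.unlock /endo_in /twoform_in.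
move: (frame S c x) fu => F fu; set p := bwd c x.
have e (X : 'M[R]_n) : F *m X *m invmx F *m F = F *m X by rewrite mulmxKV.
have e' m (X : 'M[R]_(m, n)) : X *m F^T *m (invmx F)^T = X.
  by rewrite -mulmxA -trmx_mul mulVmx // trmx1 mulmx1.
split.
- by rewrite !mulmxA e -[F *m J p *m J p]mulmxA acs_square mulmxN mulmx1 mulNmx mulmxV.
- rewrite !trmx_mul !mulmxA e e'.
  have -> : F *m J p *m w p *m (J p)^T = F *m (J p *m w p *m (J p)^T).
    by rewrite !mulmxA.
  by rewrite acs_invariant.
move=> v v0; have vF0 : v *m F != 0.
  by apply: contraNneq v0 => h; rewrite -[v](mulmxK fu) h mul0mx.
by have := acs_positive J p vF0; rewrite !trmx_mul !mulmxA e'.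
Qed.

Lemma connE c x v : conn nabla c x v = \sum_j v 0 j *: nabla c x j.
Proof. by rewrite conn.unlock. Qed.

Lemma conn_preserves c x v : atlas S c -> cod c x ->
  'D_v (acs_in J c) x + acs_in J c x *m conn nabla c x v =
  conn nabla c x v *m acs_in J c x.
Proof.
move=> ac cx; have dJ := smooth_on_diff (smooth_acs_in ac) cx.
rewrite (derive_rV _ dJ) connE mulmx_sumr mulmx_suml -big_split /=.
apply: eq_bigr => j _; rewrite -scalemxAr -scalemxAl -scalerDr; congr (_ *: _).
have := pJ j ac cx; rewrite acs_in.unlock; exact.
Qed.

Lemma smooth_trans_jac c c' : atlas S c -> atlas S c' ->
  smooth_on (overlap c c') (trans_jac c c').
Proof.
move=> ac ac'; have oo := open_overlap c c'; apply: (smooth_on_mx oo) => i j.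
have := smooth_on_entry 0 j oo (smooth_on_derive (delta_mx 0 i)
  (smooth_transition ac ac')).
apply: (smooth_on_eq oo) => y oy; rewrite trans_jac.unlock.
exact: (esym (jacobian_partial _ _ (smooth_on_diff (smooth_transition ac ac') oy))).
Qed.

Lemma conn_change c c' x v : atlas S c -> atlas S c' -> overlap c c' x ->
  'D_v (trans_jac c c') x +
    trans_jac c c' x *m conn nabla c' (transition c c' x) (v *m trans_jac c c' x) =
  conn nabla c x v *m trans_jac c c' x.
Proof.
move=> ac ac' o.
have sT := smooth_trans_jac ac ac'.
have dT := smooth_on_diff sT o.
rewrite (derive_rV _ dT) !connE mulmx_suml.
have -> : \sum_j (v *m trans_jac c c' x) 0 j *: nabla c' (transition c c' x) j =
    \sum_i v 0 i *: \sum_j trans_jac c c' x i j *: nabla c' (transition c c' x) j.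
  under [RHS]eq_bigr do rewrite scaler_sumr.
  rewrite exchange_big /=; apply: eq_bigr => j _.
  by rewrite mxE scaler_suml; apply: eq_bigr => i _; rewrite scalerA.
rewrite mulmx_sumr -big_split /=; apply: eq_bigr => i _.
rewrite -scalemxAr -scalerDr -scalemxAl; congr (_ *: _).
have := christoffel_change nabla i ac ac' o; cbv zeta.
rewrite trans_jac.unlock; exact.
Qed.

End Connection.

Lemma mxtrace_mul_sum (R : comPzRingType) (n : nat) (J : 'M[R]_n)
    (k : 'I_n -> 'I_n -> R) (F : 'I_n -> 'I_n -> 'M[R]_n) :
  \tr (J *m \sum_i \sum_j k i j *: F i j) = \sum_i \sum_j k i j * \tr (J *m F i j).
Proof.
rewrite mulmx_sumr raddf_sum; apply: eq_bigr => i _ /=.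
rewrite mulmx_sumr raddf_sum; apply: eq_bigr => j _ /=.
by rewrite -scalemxAr mxtraceZ.
Qed.

(** [Q] stands for the terms with second derivatives of the map along which the connection is pulled
    back. They are symmetric in the two directions and cancel. *)
Lemma curv_sum (R : fieldType) (n : nat) (a b : 'rV[R]_n) (G : 'I_n -> 'M[R]_n)
    (P : 'I_n -> 'I_n -> 'M[R]_n) (Q : 'M[R]_n) :
  curv (Q + \sum_i \sum_j (a 0 i * b 0 j) *: P i j)
    (Q + \sum_i \sum_j (b 0 i * a 0 j) *: P i j)
    (\sum_j a 0 j *: G j) (\sum_j b 0 j *: G j) =
  \sum_i \sum_j (a 0 i * b 0 j) *: (P i j - P j i + G j *m G i - G i *m G j).
Proof.
rewrite /curv opprD addrACA subrr add0r.
have -> : (\sum_j b 0 j *: G j) *m (\sum_j a 0 j *: G j) =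
    \sum_i \sum_j (a 0 i * b 0 j) *: (G j *m G i).
  rewrite mulmx_sumr; apply: eq_bigr => i _; rewrite mulmx_suml; apply: eq_bigr => j _.
  by rewrite -scalemxAr -scalemxAl scalerA.
have -> : (\sum_j a 0 j *: G j) *m (\sum_j b 0 j *: G j) =
    \sum_i \sum_j (a 0 i * b 0 j) *: (G i *m G j).
  rewrite mulmx_suml; apply: eq_bigr => i _; rewrite mulmx_sumr; apply: eq_bigr => j _.
  by rewrite -scalemxAr -scalemxAl scalerA mulrC.
rewrite [X in _ - X + _ - _]exchange_big /= -sumrB -big_split -sumrB /=.
apply: eq_bigr => i _; rewrite -sumrB -big_split -sumrB /=; apply: eq_bigr => j _.
by rewrite [b 0 j * a 0 i]mulrC -scalerBr -scalerDr -scalerBr.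
Qed.

(** * Connections pulled back along a map into a chart *)

Section Pullback.
Variables (R : realType) (n : nat) (M : topologicalType).
Variables (S : smooth_structure R n M) (w : symplectic_form S).
Variables (J : compatible_acs w) (nabla : affine_connection S).
Hypothesis pJ : preserves_acs nabla J.
Variables (V : normedModType R) (D : set V) (c : chart R n M) (x : V -> 'rV[R]_n).
Hypotheses (oD : open D) (ac : atlas S c) (sx : smooth_on D x)
  (cx : forall z, D z -> cod c (x z)).

Definition pconn v z := conn nabla c (x z) ('D_v x z).

Lemma smooth_pull m p (f : 'rV[R]_n -> 'M[R]_(m, p)) : smooth_on (cod c) f ->
  smooth_on D (fun z => f (x z)).
Proof. exact: (smooth_on_comp_mx (finite_dim_mx R 1 n) oD (open_cod c) cx sx). Qed.

Lemma smooth_christoffel j : smooth_on D (fun z => nabla c (x z) j).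
Proof. exact: (smooth_pull (christoffel_smooth nabla j ac)). Qed.

Lemma pconnE v : pconn v = fun z => \sum_j ('D_v x z) 0 j *: nabla c (x z) j.
Proof. by apply/funext => z; rewrite /pconn connE. Qed.

Lemma smooth_pconn v : smooth_on D (pconn v).
Proof.
rewrite pconnE; apply: (@smooth_on_sum R V _ D 'I_n (index_enum _) xpredT
  (fun j z => ('D_v x z) 0 j *: nabla c (x z) j) oD) => j _.
apply: (smooth_on_scale oD).
  exact: (smooth_on_entry 0 j oD (smooth_on_derive v sx)).
exact: smooth_christoffel.
Qed.

Lemma pconn_preserves v z : D z ->
  'D_v (fun z => acs_in J c (x z)) z + acs_in J c (x z) *m pconn v z =
  pconn v z *m acs_in J c (x z).
Proof.
move=> Dz; have dx := smooth_on_diff sx Dz.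
have dJ := smooth_on_diff (smooth_acs_in J ac) (cx Dz).
by rewrite (derive_comp v dx dJ); exact: (conn_preserves pJ _ ac (cx Dz)).
Qed.

Lemma derive_pconn a b z : D z ->
  'D_a (pconn b) z = \sum_j ('D_a ('D_b x) z 0 j *: nabla c (x z) j) +
  \sum_i \sum_j ('D_a x z 0 i * 'D_b x z 0 j) *:
     partial i (fun y => nabla c y j) (x z).
Proof.
move=> Dz; rewrite pconnE exchange_big /= -big_split /=.
have dx := smooth_on_diff sx Dz.
have dDx := smooth_on_diff (smooth_on_derive b sx) Dz.
have dG j : differentiable (fun y => nabla c y j) (x z).
  exact: (smooth_on_diff (christoffel_smooth nabla j ac) (cx Dz)).
have dGx j := smooth_on_diff (smooth_christoffel j) Dz.
have ds j := derive_scalemx a (differentiable_entry 0 j dDx) (dGx j).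
rewrite (derive_sumf a (fun j => (ds j).1)); apply: eq_bigr => j _.
rewrite (ds j).2 (derive_entry a 0 j dDx); congr (_ + _).
rewrite (derive_comp a dx (dG j)) (derive_rV _ (dG j)) scaler_sumr.
by apply: eq_bigr => i _; rewrite scalerA mulrC.
Qed.

Lemma pconn_curv a b z : D z ->
  curv ('D_a (pconn b) z) ('D_b (pconn a) z) (pconn a z) (pconn b z) =
  \sum_i \sum_j ('D_a x z 0 i * 'D_b x z 0 j) *: curvature nabla c (x z) i j.
Proof.
move=> Dz; rewrite (derive_pconn a b Dz) (derive_pconn b a Dz) !pconnE.
have E : 'D_b ('D_a x) z = 'D_a ('D_b x) z.
  exact: (smooth_schwarz_mx b a oD Dz sx).
rewrite E; exact: (@curv_sum _ n ('D_a x z) ('D_b x z) (fun j => nabla c (x z) j)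
  (fun i j => partial i (fun y => nabla c y j) (x z))).
Qed.

(** Curvature is bilinear in the two velocities. On the strip this removes the source bundle, whose
    base point does not move in the direction of the action. *)
Lemma pconn_curv0 a b z : D z -> 'D_b x z = 0 ->
  curv ('D_a (pconn b) z) ('D_b (pconn a) z) (pconn a z) (pconn b z) = 0.
Proof.
move=> Dz b0; rewrite (pconn_curv a b Dz) b0 big1 // => i _.
by rewrite big1 // => j _; rewrite mxE mulr0 scale0r.
Qed.

End Pullback.

(** * The strip swept out by a path, in local charts *)

Section Strip.
Variables (R : realType) (n : nat) (M : topologicalType).
Variables (S : smooth_structure R n M) (rho : circle_action S).

Lemma smooth_into_act (V : normedModType R) (U : set V) (a : V -> R) (g : V -> M) :
  open U -> smooth_on U a -> smooth_into S U g ->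
  smooth_into S U (fun z => rho (a z) (g z)).
Proof.
move=> oU sa sg; apply: smooth_into_local => z Uz.
pose c := chart_at S (g z); have ac := chart_at_atlas S (g z).
have oA := smooth_into_open c oU sg; exists (U `&` g @^-1` dom c).
exists (fun y => rho (a y) (bwd c (fwd c (g y)))); split => //.
- by split => //; exact: mem_chart_at.
- by move=> y [_ cy]; rewrite (bwd_fwd cy).
have sgc : smooth_on (U `&` g @^-1` dom c) (fwd c \o g) := sg.2 c ac.
apply: (smooth_into_comp (f := fun y => (a y, fwd c (g y)))
  (finite_dim_pair (finite_dim_R R) (finite_dim_mx R 1 n)) oA (open_cod2 c) _ _
  (act_smooth rho ac)).
  by move=> y [_ cy]; exact: cod_fwd.
by apply: smooth_on_pair => //; apply: smooth_on_sub sa => y [].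
Qed.

Variables (w : symplectic_form S).
Hypothesis hw : symplectic_action w rho.
Variables (J : compatible_acs w) (nabla : affine_connection S).
Hypothesis pJ : preserves_acs nabla J.
Variable gamma : R -> M.
Hypothesis sg : smooth_into S setT gamma.
Implicit Types (c : chart R n M) (z v : R * R).

Definition strip z := rho z.2 (gamma z.1).

Lemma smooth_strip0 : smooth_into S setT (fun z : R * R => gamma z.1).
Proof.
have f1 : smooth_on setT (fun z : R * R => z.1) by exact: smooth_on_fst.
exact: (smooth_into_comp (finite_dim_R R) openT openT (fun _ _ => I) f1 sg).
Qed.

Lemma smooth_strip : smooth_into S setT strip.
Proof.
apply: smooth_into_act; [exact: openT|exact: smooth_on_snd|exact: smooth_strip0].
Qed.

Definition sx0 c z := fwd c (gamma z.1).
Definition sx1 c z := fwd c (strip z).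

Definition sdom c0 c1 : set (R * R) :=
  [set z | dom c0 (gamma z.1)] `&` [set z | dom c1 (strip z)].

Lemma open_sdom c0 c1 : open (sdom c0 c1).
Proof.
apply: openI.
  have := smooth_into_open c0 openT smooth_strip0; by rewrite setTI.
by have := smooth_into_open c1 openT smooth_strip; rewrite setTI.
Qed.

Arguments open_sdom : clear implicits.

Lemma smooth_sx0 c0 c1 : atlas S c0 -> smooth_on (sdom c0 c1) (sx0 c0).
Proof.
move=> ac; have [_ /(_ c0 ac)] := smooth_strip0.
by apply: smooth_on_sub => z [].
Qed.

Lemma smooth_sx1 c0 c1 : atlas S c1 -> smooth_on (sdom c0 c1) (sx1 c1).
Proof.
move=> ac; have [_ /(_ c1 ac)] := smooth_strip.
by apply: smooth_on_sub => z [].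
Qed.

Lemma cod_sx0 c0 c1 z : sdom c0 c1 z -> cod c0 (sx0 c0 z).
Proof. by case=> h _; exact: cod_fwd. Qed.

Lemma cod_sx1 c0 c1 z : sdom c0 c1 z -> cod c1 (sx1 c1 z).
Proof. by case=> _ h; exact: cod_fwd. Qed.

Lemma sdom_flow c0 c1 z : sdom c0 c1 z -> flow_dom rho c0 c1 (z.2, sx0 c0 z).
Proof.
by move=> h; split; [exact: cod_sx0 h|rewrite /= (bwd_fwd h.1); case: h].
Qed.

Lemma flow_sx0 c0 c1 z : sdom c0 c1 z -> flow rho c0 c1 z.2 (sx0 c0 z) = sx1 c1 z.
Proof. by move=> [h _]; rewrite /flow (bwd_fwd h). Qed.

Definition sjac c0 c1 z := flow_jac rho c0 c1 z.2 (sx0 c0 z).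
Definition sJ0 c z := acs_in J c (sx0 c z).
Definition sJ1 c z := acs_in J c (sx1 c z).
(** Over the strip this is a map from the tangent bundle pulled back by [gamma z.1] to the one
    pulled back by [strip]: the complex linear part of the differential of the time-[z.2] map. *)
Definition sphi c0 c1 z := clin (sJ0 c0 z) (sJ1 c1 z) (sjac c0 c1 z).

Lemma smooth_sjac c0 c1 : atlas S c0 -> atlas S c1 ->
  smooth_on (sdom c0 c1) (sjac c0 c1).
Proof.
move=> a0 a1; have sp : smooth_on (sdom c0 c1) (fun z => (z.2, sx0 c0 z)).
  by apply: smooth_on_pair; [exact: open_sdom|exact: smooth_on_snd|exact: smooth_sx0].
exact: (smooth_on_comp_mx (finite_dim_pair (finite_dim_R R) (finite_dim_mx R 1 n))
  (open_sdom c0 c1) (open_flow_dom rho c0 c1 a0) (@sdom_flow c0 c1) sp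
  (smooth_flow_jac rho a0 a1)).
Qed.

Lemma smooth_sJ0 c0 c1 : atlas S c0 -> smooth_on (sdom c0 c1) (sJ0 c0).
Proof.
move=> a0; exact: (smooth_pull (open_sdom c0 c1) (smooth_sx0 c1 a0)
  (@cod_sx0 c0 c1) (smooth_acs_in J a0)).
Qed.

Lemma smooth_sJ1 c0 c1 : atlas S c1 -> smooth_on (sdom c0 c1) (sJ1 c1).
Proof.
move=> a1; exact: (smooth_pull (open_sdom c0 c1) (smooth_sx1 c0 a1)
  (@cod_sx1 c0 c1) (smooth_acs_in J a1)).
Qed.

Lemma smooth_sphi c0 c1 : atlas S c0 -> atlas S c1 ->
  smooth_on (sdom c0 c1) (sphi c0 c1).
Proof.
move=> a0 a1; have oD := open_sdom c0 c1.
have sA := smooth_sjac a0 a1.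
apply: (smooth_on_scale oD); first exact: smooth_on_cst.
apply: (smooth_on_subf oD) => //; apply: (smooth_on_mulmx oD).
  by apply: (smooth_on_mulmx oD) => //; exact: smooth_sJ0.
exact: smooth_sJ1.
Qed.

Lemma sJ0_compatible c0 c1 z : atlas S c0 -> sdom c0 c1 z ->
  compatible (form_in w c0 (sx0 c0 z)) (sJ0 c0 z).
Proof. by move=> a0 h; apply: acs_in_compatible => //; exact: (cod_sx0 h). Qed.

Lemma sJ1_compatible c0 c1 z : atlas S c1 -> sdom c0 c1 z ->
  compatible (form_in w c1 (sx1 c1 z)) (sJ1 c1 z).
Proof. by move=> a1 h; apply: acs_in_compatible => //; exact: (cod_sx1 h). Qed.

Lemma sphi_unit c0 c1 z : atlas S c0 -> atlas S c1 -> sdom c0 c1 z ->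
  sphi c0 c1 z \in unitmx.
Proof.
move=> a0 a1 h; have E := flow_symplectic hw a0 a1 (sdom_flow h).
rewrite (flow_sx0 h) in E.
exact: (clin_unit (form_in_skew w c1 _) (sJ0_compatible a0 h) (sJ1_compatible a1 h) E).
Qed.

Lemma sphi_comm c0 c1 z : atlas S c0 -> atlas S c1 -> sdom c0 c1 z ->
  sJ0 c0 z *m sphi c0 c1 z = sphi c0 c1 z *m sJ1 c1 z.
Proof.
move=> a0 a1 h; apply: clin_comm; first by have [] := sJ0_compatible a0 h.
by have [] := sJ1_compatible a1 h.
Qed.

Definition stheta c0 c1 : R * R -> R * R -> R :=
  thetaf (sJ0 c0) (sphi c0 c1) (pconn nabla c0 (sx0 c0)) (pconn nabla c1 (sx1 c1)).

Lemma smooth_stheta c0 c1 v : atlas S c0 -> atlas S c1 ->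
  smooth_on (sdom c0 c1) (stheta c0 c1 v).
Proof.
move=> a0 a1; have oD := open_sdom c0 c1.
apply: (smooth_thetaf oD (smooth_sJ0 c1 a0) (smooth_sphi a0 a1)) => [u|u|z h].
- exact: (smooth_pconn nabla oD a0 (smooth_sx0 c1 a0) (@cod_sx0 c0 c1)).
- exact: (smooth_pconn nabla oD a1 (smooth_sx1 c0 a1) (@cod_sx1 c0 c1)).
exact: sphi_unit.
Qed.

(** The direction [b] is meant to be that of the action. The source curvature then vanishes, and the
    target curvature alone gives the Chern-Weil integrand. *)
Lemma stheta_curl c0 c1 a b z : atlas S c0 -> atlas S c1 -> sdom c0 c1 z ->
  'D_b (sx0 c0) z = 0 ->
  'D_a (stheta c0 c1 b) z - 'D_b (stheta c0 c1 a) z =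
  \sum_i \sum_j 'D_a (sx1 c1) z 0 i * 'D_b (sx1 c1) z 0 j *
    \tr (sJ1 c1 z *m curvature nabla c1 (sx1 c1 z) i j).
Proof.
move=> a0 a1 h b0; have oD := open_sdom c0 c1.
have s0 := smooth_sx0 c1 a0; have s1 := smooth_sx1 c0 a1.
have k0 := @cod_sx0 c0 c1; have k1 := @cod_sx1 c0 c1.
have E := (theta_curl a b oD (smooth_sJ0 c1 a0) (smooth_sJ1 c0 a1) (smooth_sphi a0 a1)
  (fun v => smooth_pconn nabla oD a0 s0 k0 v) (fun v => smooth_pconn nabla oD a1 s1 k1 v)
  (fun z => sphi_unit a0 a1) (fun z => sphi_comm a0 a1)
  (fun v => pconn_preserves pJ a0 s0 k0 v) (fun v => pconn_preserves pJ a1 s1 k1 v) h).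
have C0 := pconn_curv0 nabla oD a0 s0 k0 a h b0.
have C1 := pconn_curv nabla oD a1 s1 k1 a b h.
apply: (etrans E); apply: (etrans (f_equal2 (fun X Y : 'M[R]_n =>
  \tr (sJ1 c1 z *m X) - \tr (sJ0 c0 z *m Y)) C1 C0)).
have H (A B X : 'M[R]_n) : \tr (A *m X) - \tr (B *m 0) = \tr (A *m X).
  by rewrite mulmx0 mxtrace0 subr0.
apply: (etrans (H _ _ _)).
exact: (mxtrace_mul_sum (sJ1 c1 z) (fun i j =>
  'D_a (sx1 c1) z 0 i * 'D_b (sx1 c1) z 0 j) (curvature nabla c1 (sx1 c1 z))).
Qed.

End Strip.

(** Gauge covariance of the covariant derivative of [P]: the inhomogeneous terms of the two
    connections cancel against the derivatives of [T0] and [T1] in the derivative of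
    [T0 P' = P T1]. *)
Lemma theta_change_algebra (R : realFieldType) (n : nat)
    (T0 T1 P P' DP DP' DT0 DT1 N0 N0' N1 N1' : 'M[R]_n) :
  DT0 + T0 *m N0' = N0 *m T0 -> DT1 + T1 *m N1' = N1 *m T1 ->
  DT0 *m P' + T0 *m DP' = DP *m T1 + P *m DT1 -> T0 *m P' = P *m T1 ->
  T0 *m (DP' - N0' *m P' + P' *m N1') = (DP - N0 *m P + P *m N1) *m T1.
Proof.
move=> e0 e1 eD eP.
have E0 : DT0 = N0 *m T0 - T0 *m N0' by rewrite -e0 addrK.
have E1 : DT1 = N1 *m T1 - T1 *m N1' by rewrite -e1 addrK.
move: eD; rewrite E0 E1 !(mulmxDl, mulmxDr, mulmxN, mulNmx) !mulmxA -eP.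
rewrite -!(mulmxA _ P T1) -eP !mulmxA => /matrixP E.
by apply/matrixP => i j; have := E i j; rewrite !mx_linE; lra.
Qed.

Lemma clin_change (R : realFieldType) (n : nat) (J0 J0' J1 J1' A A' T0 T1 : 'M[R]_n) :
  J0 *m T0 = T0 *m J0' -> J1 *m T1 = T1 *m J1' -> T0 *m A' = A *m T1 ->
  T0 *m clin J0' J1' A' = clin J0 J1 A *m T1.
Proof.
move=> h0 h1 hA; rewrite /clin -scalemxAr -scalemxAl mulmxBr mulmxBl hA.
congr (_ *: (_ - _)).
by rewrite !mulmxA -h0 -(mulmxA J0 T0) hA -!mulmxA h1.
Qed.

Lemma chern_weil_sum (R : realType) (n : nat) (a b : 'rV[R]_n) (J : 'M[R]_n)
    (F : 'I_n -> 'I_n -> 'M[R]_n) :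
  \sum_i \sum_j a 0 i * b 0 j * \tr (J *m F i j) =
  4 * pi * (a *m (\matrix_(i, j) (\tr (J *m F i j) / (4 * pi))) *m b^T) 0 0.
Proof.
have p0 : (4 * pi : R) != 0 by rewrite mulf_neq0 // gt_eqF // pi_gt0.
rewrite -mulmxA [in RHS]mxE mulr_sumr; apply: eq_bigr => i _.
rewrite [in RHS]mxE mulr_sumr mulr_sumr; apply: eq_bigr => j _.
rewrite !mxE; move: (\tr _) (4 * pi) p0 => t q q0; by field.
Qed.

Lemma clin1 (R : realFieldType) (n : nat) (J : 'M[R]_n) :
  J *m J = - 1%:M -> clin J J 1%:M = 1%:M.
Proof.
move=> jj; rewrite /clin mulmx1 jj opprK scalerDr -scalerDl.
by rewrite (_ : 2^-1 + 2^-1 = 1 :> R) ?scale1r //; field.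
Qed.

Lemma theta0 (R : fieldType) (n : nat) (J P : 'M[R]_n) : theta J 0 P = 0.
Proof. by rewrite /theta mulmx0 mul0mx mxtrace0. Qed.

Lemma conn0 (R : realType) (n : nat) (M : topologicalType)
    (S : smooth_structure R n M) (nabla : affine_connection S) c x :
  conn nabla c x 0 = 0.
Proof. by rewrite connE big1 // => j _; rewrite mxE scale0r. Qed.

Lemma derive_clin (R : realType) (n : nat) (V : normedModType R) (J0 J1 : 'M[R]_n)
    (f : V -> 'M[R]_n) z v : differentiable f z ->
  'D_v (fun y => clin J0 J1 (f y)) z = clin J0 J1 ('D_v f z).
Proof.
move=> df; have dc (A : 'M[R]_n) : differentiable (fun _ : V => A) z.
  exact: differentiable_cst.
have d1 := differentiable_mulmx (dc J0) df.
have d2 := differentiable_mulmx d1 (dc J1).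
have d3 : differentiable (fun y => f y - J0 *m f y *m J1) z := differentiableB df d2.
rewrite /clin (@deriveZ _ _ _ (fun y => f y - J0 *m f y *m J1)); last exact: diff_derivable d3.
rewrite (derive_sub v df d2) (derive_mulmx v d1 (dc J1)) (derive_mulmx v (dc J0) df).
by rewrite !derive_cst mul0mx mulmx0 add0r addr0.
Qed.

(** * The connection form on the whole strip *)

Section StripGlobal.
Variables (R : realType) (n : nat) (M : topologicalType).
Variables (S : smooth_structure R n M) (rho : circle_action S).
Variables (w : symplectic_form S).
Hypothesis hw : symplectic_action w rho.
Variables (J : compatible_acs w) (nabla : affine_connection S).
Hypothesis pJ : preserves_acs nabla J.
Variable gamma : R -> M.
Hypothesis sg : smooth_into S setT gamma.
Implicit Types (c : chart R n M) (z v : R * R).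

Local Notation strip := (strip rho gamma).
Local Notation sdom := (sdom rho gamma).
Local Notation sx0 := (sx0 gamma).
Local Notation sx1 := (sx1 rho gamma).
Local Notation sjac := (sjac rho gamma).
Local Notation sJ0 := (sJ0 J gamma).
Local Notation sJ1 := (sJ1 rho J gamma).
Local Notation sphi := (sphi rho J gamma).
Local Notation stheta := (stheta rho J nabla gamma).

Lemma stheta_change c0 c1 c0' c1' v z : atlas S c0 -> atlas S c1 ->
  atlas S c0' -> atlas S c1' -> sdom c0 c1 z -> sdom c0' c1' z ->
  stheta c0 c1 v z = stheta c0' c1' v z.
Proof.
move=> a0 a1 a0' a1' h h'.
pose E := sdom c0 c1 `&` sdom c0' c1'.
have oE : open E by apply: openI; exact: open_sdom.
have hE : E z by split.
pose T0 z := trans_jac c0 c0' (sx0 c0 z); pose T1 z := trans_jac c1 c1' (sx1 c1 z).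
have o0 y : E y -> overlap c0 c0' (sx0 c0 y).
  by move=> [[h0 _] [h0' _]]; exact: overlap_fwd.
have o1 y : E y -> overlap c1 c1' (sx1 c1 y).
  by move=> [[_ h1] [_ h1']]; exact: overlap_fwd.
have t0 y : E y -> transition c0 c0' (sx0 c0 y) = sx0 c0' y.
  by move=> [[h0 _] _]; rewrite /transition /= bwd_fwd.
have t1 y : E y -> transition c1 c1' (sx1 c1 y) = sx1 c1' y.
  by move=> [[_ h1] _]; rewrite /transition /= bwd_fwd.
have jj0 y : E y -> sJ0 c0 y *m T0 y = T0 y *m sJ0 c0' y.
  by move=> hy; rewrite /T0 (acs_in_transition J a0 a0' (o0 y hy)) (t0 y hy).
have jj1 y : E y -> sJ1 c1 y *m T1 y = T1 y *m sJ1 c1' y.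
  by move=> hy; rewrite /T1 (acs_in_transition J a1 a1' (o1 y hy)) (t1 y hy).
have tA y : E y -> T0 y *m sjac c0' c1' y = sjac c0 c1 y *m T1 y.
  move=> hy; have [hy1 hy2] := hy.
  (* The mixed pair lets one chart change at a time: first the source, then the target. *)
  have m : sdom c0 c1' y by split; [case: hy1|case: hy2].
  rewrite /sjac /T0 -(t0 y hy).
  rewrite -(flow_jac_left a0 a0' a1' (sdom_flow m) (o0 y hy).2).
  rewrite (flow_jac_right a0 a1 a1' (sdom_flow hy1) (sdom_flow m)).
  by rewrite (flow_sx0 hy1).
have tP y : E y -> T0 y *m sphi c0' c1' y = sphi c0 c1 y *m T1 y.
  by move=> hy; apply: clin_change; [exact: jj0|exact: jj1|exact: tA].
have dx0 := smooth_on_diff (smooth_sx0 rho sg c1 a0) h.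
have dx1 := smooth_on_diff (smooth_sx1 rho sg c0 a1) h.
have dt0 := smooth_on_diff (smooth_trans_jac a0 a0') (o0 z hE).
have dt1 := smooth_on_diff (smooth_trans_jac a1 a1') (o1 z hE).
have dT0 : differentiable T0 z by exact: (differentiable_comp dx0 dt0).
have dT1 : differentiable T1 z by exact: (differentiable_comp dx1 dt1).
have dP := smooth_on_diff (smooth_sphi rho J sg a0 a1) h.
have dP' := smooth_on_diff (smooth_sphi rho J sg a0' a1') h'.
have eD : 'D_v T0 z *m sphi c0' c1' z + T0 z *m 'D_v (sphi c0' c1') z =
    'D_v (sphi c0 c1) z *m T1 z + sphi c0 c1 z *m 'D_v T1 z.
  apply: (etrans (esym (derive_mulmx v dT0 dP'))).
  apply: (etrans _ (derive_mulmx v dP dT1)).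
  exact: (derive_near v oE hE tP).
have x0' : 'D_v (sx0 c0') z = 'D_v (sx0 c0) z *m T0 z.
  rewrite /T0 trans_jac.unlock; have [k0 _] := h; have [k0' _] := h'.
  exact: (derive_chart v openT (smooth_strip0 sg) I a0 a0' k0 k0').
have x1' : 'D_v (sx1 c1') z = 'D_v (sx1 c1) z *m T1 z.
  rewrite /T1 trans_jac.unlock; have [_ k1] := h; have [_ k1'] := h'.
  exact: (derive_chart v openT (smooth_strip rho sg) I a1 a1' k1 k1').
have e0 : 'D_v T0 z + T0 z *m pconn nabla c0' (sx0 c0') v z =
    pconn nabla c0 (sx0 c0) v z *m T0 z.
  rewrite /pconn x0' -(t0 z hE).
  apply: (etrans _ (conn_change nabla _ a0 a0' (o0 z hE))).
  exact: (f_equal (fun X => X + _) (derive_comp v dx0 dt0)).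
have e1 : 'D_v T1 z + T1 z *m pconn nabla c1' (sx1 c1') v z =
    pconn nabla c1 (sx1 c1) v z *m T1 z.
  rewrite /pconn x1' -(t1 z hE).
  apply: (etrans _ (conn_change nabla _ a1 a1' (o1 z hE))).
  exact: (f_equal (fun X => X + _) (derive_comp v dx1 dt1)).
have u0 : T0 z \in unitmx by exact: (trans_jac_unit a0 a0' (o0 z hE)).
have u1 : T1 z \in unitmx by exact: (trans_jac_unit a1 a1' (o1 z hE)).
exact: (theta_change u0 u1 (sphi_unit hw J a0' a1' h') (jj0 z hE)
  (theta_change_algebra e0 e1 eD (tP z hE)) (tP z hE)).
Qed.

(** Each point uses its own charts. By [stheta_change] this agrees near any point with the
    expression in one fixed pair, so it is smooth on the plane. *)
Definition gtheta v z : R :=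
  stheta (chart_at S (gamma z.1)) (chart_at S (strip z)) v z.

Lemma gtheta_local c0 c1 v z : atlas S c0 -> atlas S c1 -> sdom c0 c1 z ->
  gtheta v z = stheta c0 c1 v z.
Proof.
move=> a0 a1 h; apply: stheta_change => //; try exact: chart_at_atlas.
by split; exact: mem_chart_at.
Qed.

Lemma sdom_chart_at z : sdom (chart_at S (gamma z.1)) (chart_at S (strip z)) z.
Proof. by split; exact: mem_chart_at. Qed.

Lemma smooth_gtheta v : smooth_on setT (gtheta v).
Proof.
apply: smooth_on_local => z _.
have a0 := chart_at_atlas S (gamma z.1); have a1 := chart_at_atlas S (strip z).
exists (sdom (chart_at S (gamma z.1)) (chart_at S (strip z))).
exists (stheta (chart_at S (gamma z.1)) (chart_at S (strip z)) v); split.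
- exact: open_sdom.
- exact: sdom_chart_at.
- by move=> y hy; rewrite (gtheta_local v a0 a1 hy).
- exact: smooth_stheta.
Qed.

Lemma derive_sx0_vert c z : 'D_(0, 1) (sx0 c) z = 0.
Proof.
have e (h : R) : sx0 c (h *: (0, 1) + z) = sx0 c z.
  by rewrite /sx0 /= scaler0 add0r.
rewrite /derive; apply: cvg_lim => //.
under eq_fun do rewrite /= e subrr scaler0.
exact: cvg_cst.
Qed.

(** The curl of [stheta] in the charts distinguished at [z]; [4 pi] undoes the normalisation of the
    Chern-Weil form. *)
Lemma gtheta_curl z :
  'D_(1, 0) (gtheta (0, 1)) z - 'D_(0, 1) (gtheta (1, 0)) z =
  4 * pi * (velocity S strip z (1, 0) *m chern_weil_form J nabla (strip z) *m
    (velocity S strip z (0, 1))^T) 0 0.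
Proof.
pose c0 := chart_at S (gamma z.1); pose c1 := chart_at S (strip z).
have a0 : atlas S c0 by exact: chart_at_atlas.
have a1 : atlas S c1 by exact: chart_at_atlas.
have h : sdom c0 c1 z by exact: sdom_chart_at.
have oD : open (sdom c0 c1) by exact: open_sdom.
have G v y : sdom c0 c1 y -> gtheta v y = stheta c0 c1 v y.
  by move=> hy; exact: gtheta_local.
have E1 := derive_near ((1, 0) : R * R) oD h (G (0, 1)).
have E2 := derive_near ((0, 1) : R * R) oD h (G (1, 0)).
have E := stheta_curl hw pJ sg (1, 0) a0 a1 h (derive_sx0_vert c0 z).
apply: (etrans (f_equal2 (fun x y : R => x - y) E1 E2)); apply: (etrans E).
have -> : sJ1 c1 z = J (strip z) by exact: acs_in_chart_at.
exact: (chern_weil_sum ('D_(1, 0) (sx1 c1) z) ('D_(0, 1) (sx1 c1) z) (J (strip z))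
  (curvature nabla c1 (sx1 c1 z))).
Qed.

(** On this line the strip coincides with [gamma] and the differential is the identity. The two
    pulled-back connections agree there, so the covariant derivative of the identity vanishes. The
    cases of interest are the times 0 and 1. *)
Lemma gtheta_horizontal0 y a : (forall p, rho a p = p) -> gtheta (1, 0) (y, a) = 0.
Proof.
move=> ra; pose c := chart_at S (gamma y); have ac : atlas S c := chart_at_atlas S _.
have st y' : strip (y', a) = gamma y' by exact: ra.
have h : sdom c c (y, a) by split; rewrite /= ?st; exact: mem_chart_at.
rewrite (gtheta_local _ ac ac h).
have oD : open (sdom c c) by exact: open_sdom.
have xx y' : sx1 c (y', a) = sx0 c (y', a) := f_equal (fwd c) (st y').
have d0 := smooth_on_diff (smooth_sx0 rho sg c ac) h.
have d1 := smooth_on_diff (smooth_sx1 rho sg c ac) h.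
have dP := smooth_on_diff (smooth_sphi rho J sg ac ac) h.
have Dx : 'D_(1, 0) (sx1 c) (y, a) = 'D_(1, 0) (sx0 c) (y, a).
  apply: (etrans (esym (derive_slice1 (1 : R) d1))).
  apply: (etrans _ (derive_slice1 (1 : R) d0)).
  by congr (derive _ y (1 : R)); apply/funext => s; exact: xx.
have P1 s : sdom c c (s, a) -> sphi c c (s, a) = 1%:M.
  move=> hs; have jac1 : sjac c c (s, a) = 1%:M.
    exact: (flow_jac_act_id ra ac (cod_sx0 hs)).
  have [jj _ _] := sJ0_compatible J ac hs.
  have e : sJ1 c (s, a) = sJ0 c (s, a) := f_equal (acs_in J c) (xx s).
  by rewrite /sphi e jac1; exact: clin1.
have DP : 'D_(1, 0) (sphi c c) (y, a) = 0.
  have oU : open ((fun s : R => (s, a)) @^-1` sdom c c).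
    apply: open_comp oD => s _.
    exact: (@cvg_pair R R R (nbhs s) (nbhs s) (nbhs a) _ _ _ id (fun=> a) cvg_id (cvg_cst a)).
  apply: (etrans (esym (derive_slice1 (1 : R) dP))).
  by apply: (etrans (derive_near (1 : R) oU h P1)); exact: derive_cst.
have NN : pconn nabla c (sx1 c) (1, 0) (y, a) = pconn nabla c (sx0 c) (1, 0) (y, a).
  exact: (f_equal2 (conn nabla c) (xx y) Dx).
have C0 : cov (sphi c c) (pconn nabla c (sx0 c)) (pconn nabla c (sx1 c)) (1, 0) (y, a) = 0.
  rewrite /cov DP NN (P1 y h) mulmx1 mul1mx; move: (pconn _ _ _ _ _) => N.
  by rewrite sub0r addNr.
exact: (etrans (f_equal (fun X => theta _ X _) C0) (theta0 _ _)).
Qed.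

(** When the linearised action at p commutes with [J], this is the trace of [J B], with [B] the
    linearised generator: up to sign, [4 pi] times the sum of the isotropy weights. In general it
    depends on [a], and only its mean over a period enters the formula. *)
Definition weight p a : R :=
  let c := chart_at S p in let x := fwd c p in
  let A := flow_jac rho c c a x in
  theta (acs_in J c x) (clin (acs_in J c x) (acs_in J c x) (A *m field_jac rho c x))
    (clin (acs_in J c x) (acs_in J c x) A).

(** At a fixed point both pulled-back connections vanish in this direction, because neither base
    point moves. What remains is the time derivative of the complex linear part, given by the
    variational equation. *)
Lemma gtheta_vertical p y a : fixed_point rho p -> gamma y = p ->
  gtheta (0, 1) (y, a) = weight p a.
Proof.
move=> fp gy; pose c := chart_at S p; have ac : atlas S c := chart_at_atlas S _.
have st a' : strip (y, a') = p := etrans (f_equal (rho a') gy) (fp a').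
have hs a' : sdom c c (y, a').
  by split; rewrite /= ?st ?gy; exact: mem_chart_at.
have h := hs a; rewrite (gtheta_local _ ac ac h).
have x0E a' : sx0 c (y, a') = fwd c p := f_equal (fwd c) gy.
have x1E a' : sx1 c (y, a') = fwd c p := f_equal (fwd c) (st a').
have d1 := smooth_on_diff (smooth_sx1 rho sg c ac) h.
have dP := smooth_on_diff (smooth_sphi rho J sg ac ac) h.
have Dx1 : 'D_(0, 1) (sx1 c) (y, a) = 0.
  apply: (etrans (esym (derive_slice2 (1 : R) d1))).
  rewrite (_ : (fun a' => _) = fun=> fwd c p); first exact: derive_cst.
  by apply/funext => a'; exact: x1E.
have N0 : pconn nabla c (sx0 c) (0, 1) (y, a) = 0.
  by rewrite /pconn (derive_sx0_vert c (y, a)); exact: conn0.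
have N1 : pconn nabla c (sx1 c) (0, 1) (y, a) = 0.
  by rewrite /pconn Dx1; exact: conn0.
pose x := fwd c p; pose j := acs_in J c x.
have fd : flow_dom rho c c (a, x) by rewrite /x -(x0E a); exact: (sdom_flow h).
have dA := smooth_on_diff (smooth_flow_jac rho ac ac) fd.
have PE a' : sphi c c (y, a') = clin j j (flow_jac rho c c a' x).
  have -> : sphi c c (y, a') = clin (acs_in J c (sx0 c (y, a')))
    (acs_in J c (sx1 c (y, a'))) (flow_jac rho c c a' (sx0 c (y, a'))) by [].
  by rewrite (x0E a') (x1E a').
have dA1 : differentiable (fun a' => flow_jac rho c c a' x) a := differentiable_slice1 dA.
have DA : 'D_1 (fun a' => flow_jac rho c c a' x) a =
    flow_jac rho c c a x *m field_jac rho c x.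
  apply: (etrans (derive_slice1 (1 : R) dA)).
  apply: (etrans (derive_flow_jac ac ac fd)); congr (_ *m field_jac rho c _).
  by rewrite /flow /x bwd_fwd ?fp //; exact: mem_chart_at.
have DP : 'D_(0, 1) (sphi c c) (y, a) =
    clin j j (flow_jac rho c c a x *m field_jac rho c x).
  apply: (etrans (esym (derive_slice2 (1 : R) dP))).
  rewrite (_ : (fun a' => _) = fun a' => clin j j (flow_jac rho c c a' x)); last first.
    by apply/funext => a'; exact: PE.
  by apply: (etrans (derive_clin j j (1 : R) dA1)); rewrite DA.
have C : cov (sphi c c) (pconn nabla c (sx0 c)) (pconn nabla c (sx1 c)) (0, 1) (y, a) =
    clin j j (flow_jac rho c c a x *m field_jac rho c x).
  by rewrite /cov DP N0 N1 mul0mx mulmx0 subr0 addr0.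
apply: (etrans (f_equal2 (theta _) C (PE a))).
exact: (f_equal (fun X => theta (acs_in J c X) _ _) (x0E a)).
Qed.

End StripGlobal.

(** * The sphere swept out by a path between fixed points *)

Section Profiles.
Variable R : realType.

Lemma smooth_step_aff (k b : R) : smooth_on setT (fun t : R => step (k * t + b)).
Proof.
have sa : smooth_on setT (fun t : R => k * t + b).
  apply: smooth_on_add; [exact: openT| |exact: smooth_on_cst].
  by apply: smooth_on_mul; [exact: openT|exact: smooth_on_cst|exact: smooth_on_id].
exact: (smooth_on_comp (finite_dim_R R) openT (fun _ _ => I) sa (@smooth_step R)).
Qed.

(** The rotation takes place for times in [[1/3, 2/3]], inside [[1/4, 3/4]] where [time_bump] is 1.
    The arc parameter rises to 2 on [[0, 1/3]] and returns to 0 on [[2/3, 1]]. The overshoot beyond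
    1, where [gamma] has reached q, makes the sphere constant on an open set around the part of the
    line [z.1 = 1/2] where rotation occurs. *)
Definition time_ramp (t : R) : R := step (3 * t + -1).
Definition time_bump (t : R) : R := step (4 * t + 0) * step ((-4) * t + 4).
Definition arc_ramp (s : R) : R := 2 * step (3 * s + 0).
Definition arc_bump (s : R) : R := arc_ramp s * step ((-3) * s + 3).

Lemma smooth_time_ramp : smooth_on setT time_ramp.
Proof. exact: smooth_step_aff. Qed.

Lemma smooth_time_bump : smooth_on setT time_bump.
Proof. by apply: smooth_on_mul; [exact: openT|exact: smooth_step_aff..]. Qed.

Lemma smooth_arc_ramp : smooth_on setT arc_ramp.
Proof.
by apply: smooth_on_mul; [exact: openT|exact: smooth_on_cst|exact: smooth_step_aff].
Qed.

Lemma smooth_arc_bump : smooth_on setT arc_bump.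
Proof.
by apply: smooth_on_mul; [exact: openT|exact: smooth_arc_ramp|exact: smooth_step_aff].
Qed.

Lemma time_ramp0 t : t <= 3^-1 -> time_ramp t = 0.
Proof. by move=> h; apply: step_le0; lra. Qed.

Lemma time_ramp1 t : 2 / 3 <= t -> time_ramp t = 1.
Proof. by move=> h; apply: step_ge1; lra. Qed.

Lemma time_bump1 t : 4^-1 <= t <= 3 / 4 -> time_bump t = 1.
Proof. by move=> /andP[h1 h2]; rewrite /time_bump !step_ge1 ?mulr1 //; lra. Qed.

Lemma time_bump_le0 t : t <= 0 -> time_bump t = 0.
Proof. by move=> h; rewrite /time_bump step_le0 ?mul0r //; lra. Qed.

Lemma time_bump_ge1 t : 1 <= t -> time_bump t = 0.
Proof. by move=> h; rewrite /time_bump (@step_le0 _ (_ + 4)) ?mulr0 //; lra. Qed.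

Lemma arc_ramp0 s : s <= 0 -> arc_ramp s = 0.
Proof. by move=> h; rewrite /arc_ramp step_le0 ?mulr0 //; lra. Qed.

Lemma arc_ramp2 s : 3^-1 <= s -> arc_ramp s = 2.
Proof. by move=> h; rewrite /arc_ramp step_ge1 ?mulr1 //; lra. Qed.

Lemma arc_bump_ramp s : s <= 2 / 3 -> arc_bump s = arc_ramp s.
Proof. by move=> h; rewrite /arc_bump step_ge1 ?mulr1 //; lra. Qed.

Lemma arc_bump_le0 s : s <= 0 -> arc_bump s = 0.
Proof. by move=> h; rewrite /arc_bump arc_ramp0 // mul0r. Qed.

Lemma arc_bump_ge1 s : 1 <= s -> arc_bump s = 0.
Proof. by move=> h; rewrite /arc_bump (@step_le0 _ (_ + 3)) ?mulr0 //; lra. Qed.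

Lemma open_lt1 (x : R) : open [set z : R * R | z.1 < x].
Proof.
apply: (@open_comp _ _ (fun z : R * R => z.1) [set y | y < x]); last exact: open_lt.
by move=> z _; exact: cvg_fst.
Qed.

Lemma open_gt1 (x : R) : open [set z : R * R | x < z.1].
Proof.
apply: (@open_comp _ _ (fun z : R * R => z.1) [set y | x < y]); last exact: open_gt.
by move=> z _; exact: cvg_fst.
Qed.

Lemma open_lt2 (x : R) : open [set z : R * R | z.2 < x].
Proof.
apply: (@open_comp _ _ (fun z : R * R => z.2) [set y | y < x]); last exact: open_lt.
by move=> z _; exact: cvg_snd.
Qed.

Lemma open_gt2 (x : R) : open [set z : R * R | x < z.2].
Proof.
apply: (@open_comp _ _ (fun z : R * R => z.2) [set y | x < y]); last exact: open_gt.
by move=> z _; exact: cvg_snd.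
Qed.

Lemma smooth_on_fst_comp (f : R -> R) : smooth_on setT f ->
  smooth_on setT (fun z : R * R => f z.1).
Proof.
have f1 : smooth_on setT (fun z : R * R => z.1) by exact: smooth_on_fst.
by move=> sf; exact: (smooth_on_comp (finite_dim_R R) openT (fun _ _ => I) f1 sf).
Qed.

Lemma smooth_on_snd_comp (f : R -> R) : smooth_on setT f ->
  smooth_on setT (fun z : R * R => f z.2).
Proof.
have f1 : smooth_on setT (fun z : R * R => z.2) by exact: smooth_on_snd.
by move=> sf; exact: (smooth_on_comp (finite_dim_R R) openT (fun _ _ => I) f1 sf).
Qed.

Lemma derive1_locally_cst (W : normedModType R) (f : R -> W) (U : set R) (k : W) x :
  open U -> U x -> (forall y, U y -> f y = k) -> 'D_1 f x = 0.
Proof.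
by move=> oU Ux fk; apply: (etrans (derive_near (1 : R) oU Ux fk)); exact: derive_cst.
Qed.

End Profiles.

Section Sphere.
Variables (R : realType) (n : nat) (M : topologicalType).
Variables (S : smooth_structure R n M) (rho : circle_action S).
Variables (gamma : R -> M) (p q : M).
Hypothesis sg : smooth_into S setT gamma.
Hypotheses (g0 : forall s, s <= 0 -> gamma s = p) (g1 : forall s, 1 <= s -> gamma s = q).
Hypotheses (fp : fixed_point rho p) (fq : fixed_point rho q).
Implicit Types (z v : R * R) (sigma : M -> 'M[R]_n).

Local Notation strip := (strip rho gamma).

Definition height z : R := time_bump z.2 * arc_bump z.1.
Definition strip_arg z : R * R := (height z, time_ramp z.2).

(* The arc from [p] to [q] and back, with the circle rotated once around on the
   first half only. *)
Definition sphere z : M :=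
  if z.1 < 2^-1 then strip (strip_arg z) else gamma (height z).

Lemma sphere_innerE z : z.1 < 2^-1 -> sphere z = strip (strip_arg z).
Proof. by move=> h; rewrite /sphere h. Qed.

Lemma smooth_height : smooth_on setT height.
Proof.
apply: smooth_on_mul; [exact: openT| |].
  by apply: smooth_on_snd_comp; exact: smooth_time_bump.
by apply: smooth_on_fst_comp; exact: smooth_arc_bump.
Qed.

Lemma smooth_strip_arg : smooth_on setT strip_arg.
Proof.
apply: smooth_on_pair; [exact: openT|exact: smooth_height|].
by apply: smooth_on_snd_comp; exact: smooth_time_ramp.
Qed.

Lemma smooth_lower : smooth_into S setT (fun z => gamma (height z)).
Proof.
exact: (smooth_into_comp (finite_dim_R R) openT openT (fun _ _ => I) smooth_height sg).
Qed.

Lemma smooth_upper : smooth_into S setT (fun z => strip (strip_arg z)).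
Proof.
exact: (smooth_into_comp (finite_dim_pair (finite_dim_R R) (finite_dim_R R)) openT openT
  (fun _ _ => I) smooth_strip_arg (smooth_strip rho sg)).
Qed.

Lemma strip_time_end y t : t <= 3^-1 \/ 2 / 3 <= t -> strip (y, time_ramp t) = gamma y.
Proof.
case=> h; rewrite /Defs.act.
  by rewrite (time_ramp0 h); exact: act0.
by rewrite (time_ramp1 h); exact: act1.
Qed.

(** Together with [sphere_middle] this covers the seam [z.1 = 1/2] and all that lies to its right.
    Here no rotation is visible; on the middle set the height exceeds 1 and the sphere rests at the
    fixed point q. Both sides of the case split in [sphere] thus glue smoothly. *)
Definition sphere_outer : set (R * R) :=
  [set z | 2^-1 < z.1] `|` ([set z | z.2 < 3^-1] `|` [set z | 2 / 3 < z.2]).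

Definition sphere_middle : set (R * R) :=
  [set z | z.2 < 3 / 4] `&` [set z | 4^-1 < z.2] `&` [set z | 1 < arc_bump z.1].

Lemma open_sphere_outer : open sphere_outer.
Proof. by apply: openU; [exact: open_gt1|apply: openU; [exact: open_lt2|exact: open_gt2]]. Qed.

Lemma open_sphere_middle : open sphere_middle.
Proof.
apply: openI; first by apply: openI; [exact: open_lt2|exact: open_gt2].
apply: (@open_comp _ _ (fun z : R * R => arc_bump z.1) [set y | 1 < y]); last exact: open_gt.
move=> z _; apply: (smooth_on_cont (U := setT)) => //.
by apply: smooth_on_fst_comp; exact: smooth_arc_bump.
Qed.

Lemma sphere_outerE z : sphere_outer z -> sphere z = gamma (height z).
Proof.
move=> h; rewrite /sphere; case: ifP => // z1.
case: h => [h|h]; first by move: (lt_trans h z1); rewrite ltxx.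
by apply: strip_time_end; case: h => /= h; [left|right]; exact: ltW.
Qed.

Lemma sphere_middleE z : sphere_middle z -> sphere z = q.
Proof.
move=> [[h1 h2] h3]; rewrite /= in h1 h2 h3.
have hh : 1 <= height z by rewrite /height time_bump1 ?mul1r ?ltW // !ltW.
rewrite /sphere; case: ifP => _; last exact: g1.
exact: (etrans (f_equal _ (g1 hh)) (fq _)).
Qed.

Lemma sphere_cover z : 2^-1 <= z.1 -> sphere_outer z \/ sphere_middle z.
Proof.
rewrite le_eqVlt => /orP[/eqP e|h]; last by left; left.
have [h|h] := ltP z.2 3^-1; first by left; right; left.
have [h'|h'] := ltP (2 / 3) z.2; first by left; right; right.
right; split => /=; first by split => /=; lra.
(* On the seam [arc_bump] still has the overshooting value 2. *)
by rewrite -e arc_bump_ramp ?arc_ramp2; lra.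
Qed.

Lemma smooth_sphere : smooth_into S setT sphere.
Proof.
apply: smooth_into_local => z _; have [h|h] := ltP z.1 2^-1.
  exists [set z | z.1 < 2^-1], (fun z => strip (strip_arg z)); split => //.
  - exact: open_lt1.
  - by move=> y hy; rewrite sphere_innerE.
  - by apply: smooth_into_sub smooth_upper.
have [h'|h'] := sphere_cover h.
  exists sphere_outer, (fun z => gamma (height z)); split => //.
  - exact: open_sphere_outer.
  - by move=> y hy; rewrite sphere_outerE.
  - by apply: smooth_into_sub smooth_lower.
exists sphere_middle, (fun=> q); split => //.
- exact: open_sphere_middle.
- by move=> y hy; rewrite sphere_middleE.
- exact: smooth_into_cst.
Qed.

Lemma sphere_spheroid : spheroid p sphere.
Proof.
split=> [z|z h]; first by have [c _] := smooth_sphere; exact: c.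
have h0 : height z = 0.
  rewrite /height; have [a|a] := ltP 0 z.1; last by rewrite arc_bump_le0 ?mulr0.
  have [b|b] := ltP z.1 1; last by rewrite arc_bump_ge1 ?mulr0.
  have [a'|a'] := ltP 0 z.2; last by rewrite time_bump_le0 ?mul0r.
  have [b'|b'] := ltP z.2 1; last by rewrite time_bump_ge1 ?mul0r.
  by exfalso; apply: h; split; apply/andP; split.
have gz : gamma (height z) = p by rewrite h0 g0.
rewrite /sphere; case: ifP => // _.
exact: (etrans (f_equal _ gz) (fp _)).
Qed.

Definition pullback sigma (u : R * R -> M) z : R :=
  (velocity S u z (1, 0) *m sigma (u z) *m (velocity S u z (0, 1))^T) 0 0.

Lemma velocity_near (U : set (R * R)) (u f : R * R -> M) z v : open U -> U z ->
  (forall y, U y -> u y = f y) -> velocity S u z v = velocity S f z v.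
Proof.
move=> oU Uz uf; rewrite /velocity (uf z Uz).
by apply: (derive_near v oU Uz) => y Uy /=; rewrite (uf y Uy).
Qed.

Lemma pullback_near sigma (U : set (R * R)) (u f : R * R -> M) z : open U -> U z ->
  (forall y, U y -> u y = f y) -> pullback sigma u z = pullback sigma f z.
Proof.
move=> oU Uz uf; rewrite /pullback (uf z Uz).
by rewrite (velocity_near _ oU Uz uf) (velocity_near (0, 1) oU Uz uf).
Qed.

Lemma skew_form_diag (A : 'M[R]_n) (x : 'rV[R]_n) : A^T = - A ->
  (x *m A *m x^T) 0 0 = 0.
Proof.
move=> sA; have e : (x *m A *m x^T) 0 0 = - (x *m A *m x^T) 0 0.
  have {1}-> : x *m A *m x^T = (x *m A^T *m x^T)^T by rewrite !trmx_mul !trmxK mulmxA.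
  by rewrite sA mulmxN mulNmx !mxE.
by lra.
Qed.

Lemma derive_chart_line (k : R * R -> R) c z v : smooth_on setT k -> atlas S c ->
  dom c (gamma (k z)) ->
  'D_v (fun y => fwd c (gamma (k y))) z = 'D_v k z *: 'D_1 (fun s => fwd c (gamma s)) (k z).
Proof.
move=> sk ac kz; have dk := smooth_on_diff sk (I : setT z).
have dc : differentiable (fun s => fwd c (gamma s)) (k z).
  by apply: (smooth_on_diff (sg.2 c ac)); split.
by rewrite (derive_comp v dk dc) (derive_R _ dc).
Qed.

(** Both partial velocities are multiples of one vector, on which a skew form vanishes. *)
Lemma pullback_line sigma (k : R * R -> R) z : (forall p, (sigma p)^T = - sigma p) ->
  smooth_on setT k -> pullback sigma (fun y => gamma (k y)) z = 0.
Proof.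
move=> ss sk; have ac := chart_at_atlas S (gamma (k z)).
have hz := mem_chart_at S (gamma (k z)).
have e v := derive_chart_line v sk ac hz.
rewrite /pullback /velocity.
have := skew_form_diag ('D_1 (fun s => fwd (chart_at S (gamma (k z))) (gamma s)) (k z))
  (ss (gamma (k z))).
move: (e (1, 0)) (e (0, 1)) => -> ->; move: (derive _ (k z) _) => x x0.
by rewrite linearZ /= -!scalemxAl -scalemxAr scalerA mxE x0 mulr0.
Qed.

End Sphere.

Lemma skew_form_comb (R : realFieldType) (n : nat) (e1 e2 : 'rV[R]_n) (A : 'M[R]_n)
    (h k r : R) : (e1 *m A *m e1^T) 0 0 = 0 ->
  ((h *: e1) *m A *m (k *: e1 + r *: e2)^T) 0 0 = h * r * (e1 *m A *m e2^T) 0 0.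
Proof.
move=> e0; have -> : (k *: e1 + r *: e2)^T = k *: e1^T + r *: e2^T.
  by rewrite linearD !linearZ.
rewrite mulmxDr -!scalemxAl -!scalemxAr !mx_linE e0.
by ring.
Qed.

Section SphereForm.
Variables (R : realType) (n : nat) (M : topologicalType).
Variables (S : smooth_structure R n M) (rho : circle_action S).
Variables (gamma : R -> M) (p q : M).
Hypothesis sg : smooth_into S setT gamma.
Hypotheses (g0 : forall s, s <= 0 -> gamma s = p) (g1 : forall s, 1 <= s -> gamma s = q).
Hypotheses (fp : fixed_point rho p) (fq : fixed_point rho q).
Implicit Types (z v : R * R) (sigma : M -> 'M[R]_n).

Local Notation strip := (strip rho gamma).
Local Notation sphere := (sphere rho gamma).

Lemma dir_fst (k : R) : (k, 0) = k *: ((1, 0) : R * R).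
Proof. by congr (_, _); rewrite /= ?scaler0 // /GRing.scale /= mulr1. Qed.

Lemma dir_snd (k : R) : (0, k) = k *: ((0, 1) : R * R).
Proof. by congr (_, _); rewrite /= ?scaler0 // /GRing.scale /= mulr1. Qed.

Lemma derive_plane (W : normedModType R) (f : R * R -> W) z a b : differentiable f z ->
  'D_(a, b) f z = a *: 'D_(1, 0) f z + b *: 'D_(0, 1) f z.
Proof.
move=> df; apply: (etrans (derive_split a b df)).
by rewrite (dir_fst a) (dir_snd b) !derive_dirZ.
Qed.

Lemma derive_snd_comp (W : normedModType R) (f : R -> W) z (a b : R) :
  differentiable f z.2 -> 'D_(a, b) (fun y : R * R => f y.2) z = 'D_b f z.2.
Proof.
move=> df; have d2 : differentiable (fun y : R * R => y.2) z.
  exact: (smooth_on_diff (smooth_on_snd setT) I).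
rewrite (derive_comp _ d2 df) (deriveE _ d2) (@diff_lin _ _ _ (@snd R R)) //.
by move=> y; exact: cvg_snd.
Qed.

Lemma derive_fst_comp (W : normedModType R) (f : R -> W) z (a b : R) :
  differentiable f z.1 -> 'D_(a, b) (fun y : R * R => f y.1) z = 'D_a f z.1.
Proof.
move=> df; have d1 : differentiable (fun y : R * R => y.1) z.
  exact: (smooth_on_diff (smooth_on_fst setT) I).
rewrite (derive_comp _ d1 df) (deriveE _ d1) (@diff_lin _ _ _ (@fst R R)) //.
by move=> y; exact: cvg_fst.
Qed.

Lemma derive_height_s z : 'D_(1, 0) (@height R) z = time_bump z.2 * 'D_1 (@arc_bump R) z.1.
Proof.
have s1 := smooth_on_snd_comp (@smooth_time_bump R).
have s2 := smooth_on_fst_comp (@smooth_arc_bump R).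
have d1 := smooth_on_diff s1 (I : setT z); have d2 := smooth_on_diff s2 (I : setT z).
have db := smooth_on_diff (@smooth_time_bump R) (I : setT z.2).
have da := smooth_on_diff (@smooth_arc_bump R) (I : setT z.1).
have := @deriveM _ _ (fun z : R * R => time_bump z.2) (fun z : R * R => arc_bump z.1) z
  ((1, 0) : R * R) (diff_derivable d1) (diff_derivable d2).
rewrite (derive_snd_comp 1 0 db) (derive_fst_comp 1 0 da) derive0 scaler0 addr0.
exact.
Qed.

(** The second component of [strip_arg] depends on [z.2] alone, so the Jacobian determinant is the
    product of two diagonal derivatives. *)
Lemma pullback_upper sigma z : (forall p, (sigma p)^T = - sigma p) ->
  pullback S sigma (fun y => strip (strip_arg y)) z =
  'D_(1, 0) (@height R) z * 'D_1 (@time_ramp R) z.2 *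
    pullback S sigma strip (strip_arg z).
Proof.
move=> ss; set y := strip_arg z; pose c := chart_at S (strip y).
have ac : atlas S c := chart_at_atlas S _.
have cy : dom c (strip y) := mem_chart_at S _.
have dF : differentiable (fwd c \o strip) y.
  by apply: (smooth_on_diff ((smooth_strip rho sg).2 c ac)); split.
have dh := smooth_on_diff (@smooth_height R) (I : setT z).
have dt := smooth_on_diff (smooth_on_snd_comp (@smooth_time_ramp R)) (I : setT z).
have dr := smooth_on_diff (@smooth_time_ramp R) (I : setT z.2).
have da : differentiable (@strip_arg R) z := differentiable_pair dh dt.
pose E1 := velocity S strip y (1, 0); pose E2 := velocity S strip y (0, 1).
have V a b : velocity S (fun y => strip (strip_arg y)) z (a, b) =
    'D_(a, b) (@height R) z *: E1 + 'D_b (@time_ramp R) z.2 *: E2.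
  apply: (etrans (derive_comp (a, b) da dF)).
  rewrite (_ : 'D_(a, b) (@strip_arg R) z =
    ('D_(a, b) (@height R) z, 'D_b (@time_ramp R) z.2)); first exact: derive_plane.
  apply: (etrans (derive_pair _ dh dt)).
  exact: (f_equal (pair _) (derive_snd_comp a b dr)).
have V10 := V 1 0; rewrite (derive0 (@time_ramp R) z.2) scale0r addr0 in V10.
apply: (etrans (f_equal2 (fun X Y : 'rV[R]_n => (X *m sigma (strip y) *m Y^T) 0 0)
  V10 (V 0 1))).
rewrite -[pullback S sigma strip y]/((E1 *m sigma (strip y) *m E2^T) 0 0).
have := skew_form_diag E1 (ss (strip y)); clearbody E1 E2.
exact: skew_form_comb.
Qed.

(** On the left half, either the derivative of [time_ramp] vanishes or [time_bump] is 1 and the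
    formula is [pullback_upper]. On the right half [arc_ramp] is constant and the sphere moves along
    a curve, so both sides are 0. The right-hand side is a change of variables free of case
    distinctions. *)
Lemma pullback_sphere sigma z : (forall p, (sigma p)^T = - sigma p) ->
  pullback S sigma sphere z = 'D_1 (@arc_ramp R) z.1 * 'D_1 (@time_ramp R) z.2 *
    pullback S sigma strip (arc_ramp z.1, time_ramp z.2).
Proof.
move=> ss; have [h|h] := ltP z.1 2^-1.
  have -> : pullback S sigma sphere z =
      pullback S sigma (fun y => strip (strip_arg y)) z.
    apply: (@pullback_near R n M S sigma [set z : R * R | z.1 < 2^-1]) => [|//|y hy].
      exact: open_lt1.
    exact: sphere_innerE.
  rewrite (pullback_upper z ss) derive_height_s.
  have -> : 'D_1 (@arc_bump R) z.1 = 'D_1 (@arc_ramp R) z.1.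
    apply: (derive_near (U := [set x : R | x < 2 / 3]) (1 : R)
      (@open_lt R (2 / 3))) => [/=|x /= hx].
      by rewrite (lt_trans h) //; lra.
    by apply: arc_bump_ramp; exact: ltW.
  have [h1|h1] := ltP z.2 3^-1.
    have -> : 'D_1 (@time_ramp R) z.2 = 0.
      apply: (derive1_locally_cst (@open_lt R 3^-1) h1 (k := (0 : R))) => x /= hx.
      by apply: time_ramp0; exact: ltW.
    by rewrite !(mulr0, mul0r).
  have [h2|h2] := ltP (2 / 3) z.2.
    have -> : 'D_1 (@time_ramp R) z.2 = 0.
      apply: (derive1_locally_cst (@open_gt R (2 / 3)) h2 (k := (1 : R))) => x /= hx.
      by apply: time_ramp1; exact: ltW.
    by rewrite !(mulr0, mul0r).
  have b1 : time_bump z.2 = 1 by apply: time_bump1; apply/andP; split; lra.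
  have -> : strip_arg z = (arc_ramp z.1, time_ramp z.2).
    rewrite /strip_arg /height b1 mul1r arc_bump_ramp //.
    by apply: ltW; apply: (lt_trans h); lra.
  by rewrite b1 mul1r.
have -> : 'D_1 (@arc_ramp R) z.1 = 0.
  apply: (derive1_locally_cst (@open_gt R 3^-1) _ (k := (2 : R))) => [/=|x /= hx].
    by apply: lt_le_trans h; lra.
  by apply: arc_ramp2; exact: ltW.
rewrite !mul0r; have [h'|h'] := sphere_cover h.
  apply: (etrans (@pullback_near R n M S sigma (@sphere_outer R) _ _ z
    (@open_sphere_outer R) h' (@sphere_outerE R n M S rho gamma))).
  by apply: (pullback_line sg) => //; exact: smooth_height.
(* The constant q is written as [gamma] at a constant parameter, so that [pullback_line] covers this
   case too. *)
have e y : sphere_middle y -> sphere y = gamma ((fun=> 1) y).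
  by move=> hy; rewrite (sphere_middleE g1 fq hy) g1.
apply: (etrans (@pullback_near R n M S sigma (@sphere_middle R) _ _ z
  (@open_sphere_middle R) h' e)).
by apply: (pullback_line sg) => //; exact: smooth_on_cst.
Qed.

End SphereForm.

(** * The contracted form along a path and the area of the strip *)

Section PathIntegral.
Variables (R : realType) (n : nat) (M : topologicalType).
Variables (S : smooth_structure R n M) (rho : circle_action S).
Variables (w : symplectic_form S).

Definition path_form (gamma : R -> M) (s : R) : R :=
  ('D_1 (fwd (chart_at S (gamma s)) \o gamma) s *m
   Defs.contraction (generator rho) w (gamma s)) 0 0.

Variable gamma : R -> M.
Hypothesis sg : smooth_into S setT gamma.

Lemma path_form_chart c s : atlas S c -> dom c (gamma s) ->
  path_form gamma s = ('D_1 (fwd c \o gamma) s *m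
    (field_in rho c (fwd c (gamma s)) *m form_in w c (fwd c (gamma s)))^T) 0 0.
Proof.
move=> ac cs; have cx := cod_fwd cs; have ac' := chart_at_atlas S (gamma s).
rewrite -(contraction_in rho w ac cx) /oneform_in (bwd_fwd cs) mulmxA.
rewrite /path_form; congr ((_ *m _) 0 0).
apply: (etrans (derive_chart (1 : R) openT sg I ac ac' cs (mem_chart_at S _))).
by rewrite /frame (bwd_fwd cs).
Qed.

Lemma smooth_path_form : smooth_on setT (path_form gamma).
Proof.
apply: smooth_on_local => s _; pose c := chart_at S (gamma s).
have ac : atlas S c := chart_at_atlas S _.
have oU := smooth_into_open c openT sg.
pose U := setT `&` gamma @^-1` dom c.
have sf : smooth_on U (fwd c \o gamma) := sg.2 c ac.
exists U, (fun s => ('D_1 (fwd c \o gamma) s *m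
    (field_in rho c ((fwd c \o gamma) s) *m form_in w c ((fwd c \o gamma) s))^T) 0 0).
split; [exact: oU|by split => //; exact: mem_chart_at| |].
  by move=> y [_ cy]; rewrite (path_form_chart ac cy).
apply: (smooth_on_entry _ _ oU); apply: (smooth_on_mulmx oU).
  exact: smooth_on_derive.
apply: (smooth_on_trmx oU); apply: (smooth_on_mulmx oU).
  apply: (smooth_pull oU sf _ (smooth_field_in rho ac)) => y [_ cy].
  exact: cod_fwd.
apply: (smooth_pull oU sf _ (smooth_form_in w ac)) => y [_ cy].
exact: cod_fwd.
Qed.

Hypothesis hw : symplectic_action w rho.

(** The two velocities are the images of [gamma'] and of the generator at [gamma] under the same
    time map. Invariance of [w] reduces the value to [w(gamma', X)], which is minus [i_X w] on
    [gamma']. *)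
Lemma pullback_form_strip z :
  pullback S w (strip rho gamma) z = - path_form gamma z.1.
Proof.
pose c0 := chart_at S (gamma z.1); pose c1 := chart_at S (strip rho gamma z).
have a0 : atlas S c0 by exact: chart_at_atlas.
have a1 : atlas S c1 by exact: chart_at_atlas.
have h : sdom rho gamma c0 c1 z by exact: sdom_chart_at.
have oD : open (sdom rho gamma c0 c1) by exact: open_sdom.
have fd := sdom_flow h.
have dF := differentiable_flow a0 a1 fd.
have dx := smooth_on_diff (smooth_sx0 rho sg c1 a0) h.
have d2 : differentiable (fun y : R * R => y.2) z.
  exact: (smooth_on_diff (smooth_on_snd setT) I).
have dp := differentiable_pair d2 dx.
have V v : velocity S (strip rho gamma) z v =
    'D_('D_v (fun y : R * R => y.2) z, 'D_v (sx0 gamma c0) z)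
      (fun z => flow rho c0 c1 z.1 z.2) (z.2, sx0 gamma c0 z).
  apply: (etrans _ (f_equal (fun u => derive _ _ u) (derive_pair v d2 dx))).
  apply: (etrans _ (derive_comp v dp dF)).
  apply: (derive_near v oD h) => y hy.
  exact: (esym (flow_sx0 hy)).
have dg : differentiable (fwd c0 \o gamma) z.1.
  by apply: (smooth_on_diff (sg.2 c0 a0)); split => //; exact: mem_chart_at.
pose u := 'D_1 (fwd c0 \o gamma) z.1.
have V1 : velocity S (strip rho gamma) z (1, 0) =
    u *m flow_jac rho c0 c1 z.2 (sx0 gamma c0 z).
  rewrite V (derive_snd_comp 1 0 (f := fun x : R => x)); last exact: ex_diff.
  rewrite derive0 (derive_fst_comp 1 0 dg).
  exact: (esym (flow_jacE u a0 a1 fd)).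
have V2 : velocity S (strip rho gamma) z (0, 1) =
    field_in rho c0 (sx0 gamma c0 z) *m flow_jac rho c0 c1 z.2 (sx0 gamma c0 z).
  rewrite V (derive_snd_comp 0 1 (f := fun x : R => x)); last exact: ex_diff.
  rewrite derive_id (derive_fst_comp 0 1 dg) derive0.
  exact: (derive_flow_t' a0 a1 fd).
have E := flow_symplectic hw a0 a1 fd.
have o1 : form_in w c1 (flow rho c0 c1 z.2 (sx0 gamma c0 z)) = w (strip rho gamma z).
  rewrite (flow_sx0 h); exact: form_in_chart_at.
rewrite o1 in E.
rewrite /pullback V1 V2 (path_form_chart a0 (mem_chart_at S (gamma z.1))) -/u.
move: E; rewrite -/(sx0 gamma c0 z).
have sk := form_in_skew w c0 (sx0 gamma c0 z).
move: (flow_jac _ _ _ _ _) (field_in _ _ _) (form_in _ _ _) sk => A X O sk E.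
rewrite !trmx_mul !mulmxA sk.
have -> : u *m A *m w (strip rho gamma z) *m A^T = u *m O by rewrite -E !mulmxA.
by rewrite mulmxN mulNmx mx_oppE opprK.
Qed.

End PathIntegral.

Lemma cancel_const (F : fieldType) (q a b k : F) : q != 0 ->
  a * b * k = q^-1 * a * (b * (q * k)).
Proof. by move=> q0; field. Qed.

(** * Area and Chern number of the sphere *)

Section MainFormula.
Variables (R : realType) (n : nat) (M : topologicalType).
Variables (S : smooth_structure R n M) (rho : circle_action S).
Variables (w : symplectic_form S).
Hypothesis hw : symplectic_action w rho.
Variables (J : compatible_acs w) (nabla : affine_connection S).
Hypothesis pJ : preserves_acs nabla J.

Local Notation mu := (@lebesgue_measure R).
Local Notation I01 f := (Rintegral mu `[0, 1] f).

(** Under the substitution [a = time_ramp t] this is the mean of [weight] over one period, in the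
    form in which it arises on the sphere. *)
Definition mean_weight (p : M) : R :=
  I01 (fun t => 'D_1 (@time_ramp R) t * weight rho J p (time_ramp t)).

Lemma is_derive_smooth (f : R -> R) (x : R) : smooth_on setT f ->
  is_derive x 1 f ('D_1 f x).
Proof. by move=> sf; apply: derivableP; apply: diff_derivable; exact: (smooth_on_diff sf). Qed.

Lemma smooth_continuous (V W : normedModType R) (f : V -> W) : smooth_on setT f -> continuous f.
Proof. by move=> sf x; exact: (smooth_on_cont sf). Qed.

Lemma chern_weil_skew q : (chern_weil_form J nabla q)^T = - chern_weil_form J nabla q.
Proof.
apply/matrixP => i j; rewrite !mxE -mulNr; congr (_ / _).
rewrite -raddfN /= -mulmxN; congr (\tr (_ *m _)); rewrite /curvature.
move: (partial _ _ _) (partial _ _ _) (_ *m _) (_ *m _) => A B C D.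
by apply/matrixP => a b; rewrite !mx_linE; ring.
Qed.

Section Gamma.
Variables (gamma : R -> M) (p q : M).
Hypothesis sg : smooth_into S setT gamma.
Hypotheses (g0 : forall s, s <= 0 -> gamma s = p) (g1 : forall s, 1 <= s -> gamma s = q).
Hypotheses (fp : fixed_point rho p) (fq : fixed_point rho q).

Local Notation strip := (strip rho gamma).
Local Notation sphere := (sphere rho gamma).
Local Notation K := (pullback S (chern_weil_form J nabla) strip).
Local Notation Theta := (gtheta rho J nabla gamma).

(** The inner integral contributes the total rise 1 of [time_ramp]. The outer one is a substitution
    by [arc_ramp], which rises from 0 to 2, whence the endpoints of [P]. *)
Lemma sphere_area (P : R -> R) : (forall s : R, is_derive s 1 P (path_form rho w gamma s)) ->
  spheroid_integral S w sphere = - (P 2 - P 0).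
Proof.
move=> dP; have sP := smooth_path_form rho w sg.
have sr := @smooth_time_ramp R; have sa := @smooth_arc_ramp R.
have inner s : I01 (fun t => pullback S w sphere (s, t)) =
    'D_1 (@arc_ramp R) s * - path_form rho w gamma (arc_ramp s).
  pose k := 'D_1 (@arc_ramp R) s * - path_form rho w gamma (arc_ramp s).
  rewrite (_ : (fun t => _) = fun t => k * 'D_1 (@time_ramp R) t); last first.
    apply/funext => t; rewrite (pullback_sphere sg g1 fq) => [|r]; last exact: omega_skew.
    by rewrite (pullback_form_strip sg hw) /k /= mulrAC.
  have sk : smooth_on setT (fun t => k * 'D_1 (@time_ramp R) t).
    apply: smooth_on_mul; [exact: openT|exact: smooth_on_cst|exact: smooth_on_derive].
  have dk (t : R) : is_derive t 1 (fun t => k * time_ramp t) (k * 'D_1 (@time_ramp R) t).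
    exact: (@is_deriveZ _ _ _ _ _ _ _ _ (is_derive_smooth t sr)).
  rewrite (Rintegral01_FTC (smooth_continuous sk) dk).
  by rewrite time_ramp1 ?time_ramp0 ?mulr0 ?subr0 ?mulr1 //; lra.
rewrite /spheroid_integral (_ : (fun s => _) = fun s =>
    'D_1 (@arc_ramp R) s * - path_form rho w gamma (arc_ramp s)); last first.
  by apply/funext => s; exact: inner.
have sc : smooth_on setT (fun s => path_form rho w gamma (arc_ramp s)).
  exact: (smooth_on_comp (finite_dim_R R) openT (fun _ _ => I) sa sP).
have sf : smooth_on setT (fun s => 'D_1 (@arc_ramp R) s * - path_form rho w gamma (arc_ramp s)).
  apply: smooth_on_mul; [exact: openT|exact: smooth_on_derive|].
  by apply: smooth_on_opp; [exact: openT|exact: sc].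
have dQ (s : R) : is_derive s 1 (fun s => - P (arc_ramp s))
    ('D_1 (@arc_ramp R) s * - path_form rho w gamma (arc_ramp s)).
  have h := @is_derive1_comp _ P (@arc_ramp R) s _ _ (dP (arc_ramp s)) (is_derive_smooth s sa).
  apply: (is_derive_eq (is_deriveN h)); ring.
rewrite (Rintegral01_FTC (smooth_continuous sf) dQ).
by rewrite arc_ramp2 ?arc_ramp0 //; [ring|lra].
Qed.

Lemma smooth_weight : smooth_on setT (weight rho J p).
Proof.
have ss := smooth_gtheta hw J nabla sg ((0, 1) : R * R).
have s0 : smooth_on setT (fun a : R => ((0, a) : R * R)).
  by apply: smooth_on_pair; [exact: openT|exact: smooth_on_cst|exact: smooth_on_id].
have sc := smooth_on_comp (finite_dim_pair (finite_dim_R R) (finite_dim_R R)) openT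
  (fun _ _ => I) s0 ss.
apply: (smooth_on_eq openT _ sc) => a _.
by apply: gtheta_vertical => //; exact: g0.
Qed.

(** Green's formula for the form [Theta] on the strip: the edges at times 0 and 1 contribute nothing
    by [gtheta_horizontal0], and the edges over p and q give the mean weights. *)
Lemma sphere_chern : spheroid_integral S (chern_weil_form J nabla) sphere =
  (4 * pi)^-1 * (mean_weight q - mean_weight p).
Proof.
have sr := @smooth_time_ramp R; have sa := @smooth_arc_ramp R.
have s1 := smooth_gtheta hw J nabla sg ((1, 0) : R * R).
have s2 := smooth_gtheta hw J nabla sg ((0, 1) : R * R).
have fRR := finite_dim_pair (finite_dim_R R) (finite_dim_R R).
have sk : smooth_on setT (fun z : R * R => (z.1, time_ramp z.2)).
  apply: smooth_on_pair; [exact: openT|exact: smooth_on_fst|exact: smooth_on_snd_comp].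
(* The vertical component in the parametrised time. Its derivative in the arc direction will be
   moved outside the integral over time. *)
pose g (z : R * R) := 'D_1 (@time_ramp R) z.2 * Theta (0, 1) (z.1, time_ramp z.2).
have sT2 : smooth_on setT (fun z : R * R => Theta (0, 1) (z.1, time_ramp z.2)).
  exact: (smooth_on_comp fRR openT (fun _ _ => I) sk s2).
have sD : smooth_on setT (fun z : R * R => 'D_1 (@time_ramp R) z.2).
  exact: (smooth_on_snd_comp (smooth_on_derive (1 : R) sr)).
have sgg : smooth_on setT g by apply: smooth_on_mul; [exact: openT|exact: sD|exact: sT2].
have cDg : continuous ('D_(1, 0) g).
  exact: smooth_continuous (smooth_on_derive ((1, 0) : R * R) sgg).
have Dg z : 'D_(1, 0) g z =
    'D_1 (@time_ramp R) z.2 * 'D_(1, 0) (Theta (0, 1)) (z.1, time_ramp z.2).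
  have d1 := smooth_on_diff sD (I : setT z); have d2 := smooth_on_diff sT2 (I : setT z).
  have := deriveM (diff_derivable d1) (diff_derivable d2) (v := ((1, 0) : R * R)).
  have dD := smooth_on_diff (smooth_on_derive (1 : R) sr) (I : setT z.2).
  rewrite (derive_snd_comp 1 0 dD) derive0 scaler0 addr0 => E.
  refine (etrans E (f_equal (fun X => 'D_1 (@time_ramp R) z.2 * X) _)).
  have dT := smooth_on_diff s2 (I : setT (z.1, time_ramp z.2)).
  have dk := smooth_on_diff sk (I : setT z).
  apply: (etrans (derive_comp ((1, 0) : R * R) dk dT)).
  have df1 := smooth_on_diff (smooth_on_fst setT) (I : setT z).
  have df2 := smooth_on_diff (smooth_on_snd_comp sr) (I : setT z).
  have dr := smooth_on_diff sr (I : setT z.2).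
  have e : 'D_(1, 0) (fun z : R * R => (z.1, time_ramp z.2)) z = (1, 0).
    apply: (etrans (derive_pair _ df1 df2)).
    rewrite (derive_snd_comp 1 0 dr) derive0.
    rewrite (derive_fst_comp 1 0 (f := fun x : R => x)); last exact: ex_diff.
    by rewrite derive_id.
  by rewrite e.
(* The horizontal component enters through a total derivative in time, whose integral is a
   difference of values at the edges 0 and 1. *)
pose h y t := 'D_1 (@time_ramp R) t * 'D_(0, 1) (Theta (1, 0)) (y, time_ramp t).
have dh y (t : R) : is_derive t 1 (fun t => Theta (1, 0) (y, time_ramp t)) (h y t).
  have dT a : differentiable (fun b => Theta (1, 0) (y, b)) a.
    exact: (differentiable_slice2 (smooth_on_diff s1 (I : setT (y, a)))).
  have i1 : is_derive (time_ramp t) 1 (fun b => Theta (1, 0) (y, b))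
      ('D_(0, 1) (Theta (1, 0)) (y, time_ramp t)).
    split; first exact: diff_derivable (dT _).
    exact: (derive_slice2 (1 : R) (smooth_on_diff s1 (I : setT (y, time_ramp t)))).
  have := @is_derive1_comp _ _ _ _ _ _ i1 (is_derive_smooth t sr).
  by rewrite mulrC.
have sh y : smooth_on setT (h y).
  apply: smooth_on_mul; [exact: openT|exact: smooth_on_derive|].
  have sy : smooth_on setT (fun t : R => (y, time_ramp t)).
    by apply: smooth_on_pair; [exact: openT|exact: smooth_on_cst|].
  exact: (smooth_on_comp fRR openT (fun _ _ => I) sy (smooth_on_derive ((0, 1) : R * R) s1)).
have ih y : I01 (h y) = 0.
  rewrite (Rintegral01_FTC (smooth_continuous (sh y)) (dh y)).
  rewrite time_ramp1 ?time_ramp0; [|lra..].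
  rewrite (gtheta_horizontal0 hw J nabla sg y (@act1 _ _ _ _ rho)).
  by rewrite (gtheta_horizontal0 hw J nabla sg y (@act0 _ _ _ _ rho)) subrr.
have p0 : (4 * pi : R) != 0 by rewrite mulf_neq0 // gt_eqF // pi_gt0.
pose G y := I01 (fun t => g (y, t)).
have inner s : I01 (fun t => pullback S (chern_weil_form J nabla) sphere (s, t)) =
    (4 * pi)^-1 * ('D_1 (@arc_ramp R) s * I01 (fun t => 'D_(1, 0) g (arc_ramp s, t))).
  pose k := (4 * pi)^-1 * 'D_1 (@arc_ramp R) s; pose y := arc_ramp s.
  rewrite (_ : (fun t => _) = fun t => k * ('D_(1, 0) g (y, t) - h y t)); last first.
    apply/funext => t; rewrite (pullback_sphere sg g1 fq) => [|r]; last exact: chern_weil_skew.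
    rewrite Dg /h -mulrBr (gtheta_curl hw pJ sg) /k -/y /=.
    rewrite -[X in 4 * pi * X]/(K (y, time_ramp t)).
    exact: cancel_const.
  have ig := integrable01 (continuous_slice1 cDg (x := y)).
  have ihh := integrable01 (smooth_continuous (sh y)).
  have igh : mu.-integrable `[0, 1] (EFin \o (fun t => 'D_(1, 0) g (y, t) - h y t)).
    apply: integrable01 => t; apply: cvgB.
      exact: (continuous_slice1 cDg).
    exact: (smooth_continuous (sh y)).
  rewrite (RintegralZl _ _ igh) // (RintegralB _ ig ihh) // ih subr0 /k.
  by rewrite mulrA.
rewrite /spheroid_integral (_ : (fun s => _) = fun s => (4 * pi)^-1 *
    ('D_1 (@arc_ramp R) s * I01 (fun t => 'D_(1, 0) g (arc_ramp s, t)))); last first.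
  by apply/funext => s; exact: inner.
have dgg z : differentiable g z by exact: (smooth_on_diff sgg (I : setT z)).
(* The outer integrand is the derivative of [G] along [arc_ramp], so only the values of [G] at 0 and
   2 survive. *)
have dQ (s : R) : is_derive s 1 (fun s => (4 * pi)^-1 * G (arc_ramp s))
    ((4 * pi)^-1 * ('D_1 (@arc_ramp R) s * I01 (fun t => 'D_(1, 0) g (arc_ramp s, t)))).
  have hh := @is_derive1_comp _ G (@arc_ramp R) s _ _
    (is_derive_Rintegral01 (arc_ramp s) dgg cDg) (is_derive_smooth s sa).
  apply: (is_derive_eq (is_deriveZ _ hh)).
  exact: (f_equal (fun X => (4 * pi)^-1 * X) (mulrC _ _)).
have cf : continuous (fun s => (4 * pi)^-1 *
    ('D_1 (@arc_ramp R) s * I01 (fun t => 'D_(1, 0) g (arc_ramp s, t)))).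
  move=> s; apply: cvgM; first exact: cvg_cst.
  apply: cvgM; first exact: (smooth_continuous (smooth_on_derive (1 : R) sa)).
  apply: (@continuous_comp _ _ _ (@arc_ramp R)
    (fun y => I01 (fun t => 'D_(1, 0) g (y, t)))).
    exact: (smooth_continuous sa).
  exact: (continuous_Rintegral01 cDg).
rewrite (Rintegral01_FTC cf dQ) arc_ramp2 ?arc_ramp0; [|lra..].
have GW r y : fixed_point rho r -> gamma y = r -> G y = mean_weight r.
  move=> fr gr; congr (Rintegral _ _ _); apply/funext => t.
  by rewrite /g /= (gtheta_vertical hw J nabla sg _ fr gr).
have g2 : gamma 2 = q by apply: g1; lra.
by rewrite (GW q 2 fq g2) (GW p 0 fp (g0 (lexx 0))) mulrBr.
Qed.

Variable lambda : R.
Hypothesis hc : forall (p : M) (f : R * R -> M), spheroid p f ->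
    forall a b : R, pi2_value S (chern_weil_form J nabla) p f a ->
      pi2_value S w p f b -> a = lambda * b.

Lemma homotopic_refl (f : R * R -> M) r : spheroid r f -> homotopic r f f.
Proof.
move=> [cf hf]; exists (fun z => f z.2); split => [z|z|z|t z]; [|by []|by []|exact: hf].
apply: (@continuous_comp _ _ _ (fun z : R * (R * R) => z.2) f); last exact: cf.
exact: cvg_snd.
Qed.

Lemma main_formula (P : R -> R) : (forall s : R, is_derive s 1 P (path_form rho w gamma s)) ->
  mean_weight q - mean_weight p = - (4 * pi) * lambda * (P 2 - P 0).
Proof.
move=> dP; have sp := sphere_spheroid sg g0 g1 fp fq.
have ss := smooth_sphere sg g1 fq.
(* The sphere is smooth and so represents its own class, for the Chern-Weil form and for [w]
   alike. *)
have v sigma : pi2_value S sigma p sphere (spheroid_integral S sigma sphere).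
  by exists sphere; split => //; exact: homotopic_refl.
have := hc sp (v (chern_weil_form J nabla)) (v w).
rewrite sphere_chern (sphere_area dP) => E.
have p0 : (4 * pi : R) != 0 by rewrite mulf_neq0 // gt_eqF // pi_gt0.
by rewrite -[LHS](mulVKf p0) E; ring.
Qed.

End Gamma.
End MainFormula.

(** * Periods and exactness *)

Lemma is_derive_MVT (R : realType) (P f : R -> R) (a b : R) :
  (forall x : R, is_derive x 1 P (f x)) -> a < b ->
  exists c, a < c < b /\ P b - P a = f c * (b - a).
Proof.
move=> dP ab; have [|c] := MVT ab (fun x _ => dP x).
  apply/continuous_in_subspaceT => x _; apply: differentiable_continuous.
  by apply/derivable1_diffP; have [] := dP x.
by rewrite in_itv /= => cab E; exists c.
Qed.

Lemma connected_ind (M : topologicalType) (A : set M) (p : M) :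
  connected [set: M] -> open A -> open (~` A) -> A p -> forall q, A q.
Proof.
move=> cM oA oC Ap q; rewrite (_ : A = setT) //; apply: cM.
- by exists p.
- by exists A; rewrite ?setTI.
- by exists A; rewrite ?setTI // -(setCK A); exact: open_closedC.
Qed.

Lemma step_le1 (R : realType) (x : R) : step x <= 1.
Proof.
by rewrite ler_pdivrMr ?step_den // mul1r lerDl flat1_ge0.
Qed.

Lemma step_derive_bound (R : realType) :
  exists C : R, forall s, 0 <= s <= 1 -> `|'D_1 (@step R) s| <= C.
Proof.
have sD : smooth_on setT ('D_1 (@step R)) by exact: smooth_on_derive (@smooth_step R).
have [C H] := @square_bound R (fun z => 'D_1 (@step R) z.2) 0
  (smooth_continuous (smooth_on_snd_comp sD)).
exists C => s s01; apply: (H 0 s); first by rewrite /= in_itv /=; lra.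
by rewrite /= in_itv.
Qed.

Section RowForm.
Variables (R : realType) (n : nat) (a : 'cV[R]_n).

(** Named in order to carry a linear structure: it will be the differential of the potential. *)
Definition row_form (v : 'rV[R]_n) : R := (v *m a) 0 0.

Lemma row_form_linear : linear row_form.
Proof. by move=> k u v; rewrite /row_form mulmxDl -scalemxAl !mx_linE. Qed.

HB.instance Definition _ :=
  GRing.isLinear.Build R 'rV[R]_n R *:%R row_form row_form_linear.

Lemma continuous_row_form : continuous row_form.
Proof.
apply: smooth_continuous; apply: (smooth_on_entry _ _ openT).
by apply: smooth_on_mulmx; [exact: openT|exact: smooth_on_id|exact: smooth_on_cst].
Qed.

End RowForm.

Section Paths.
Variables (R : realType) (n : nat) (M : topologicalType).
Variables (S : smooth_structure R n M) (rho : circle_action S).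
Variables (w : symplectic_form S).

Local Notation pform := (path_form rho w).

(* Paths are constant outside the unit interval so that they concatenate. *)
Definition path_integral (x y : M) (r : R) := exists (gamma : R -> M) (P : R -> R),
  [/\ smooth_into S setT gamma,
      forall s, s <= 0 -> gamma s = x /\ P s = 0,
      forall s, 1 <= s -> gamma s = y /\ P s = r &
      forall s : R, is_derive s 1 P (pform gamma s)].

Lemma path_form_comp (gamma : R -> M) (k : R -> R) s : smooth_into S setT gamma ->
  smooth_on setT k ->
  pform (fun s => gamma (k s)) s = 'D_1 k s * pform gamma (k s).
Proof.
move=> sg sk; pose c := chart_at S (gamma (k s)).
have ac : atlas S c by exact: chart_at_atlas.
have dk := smooth_on_diff sk (I : setT s).
have dc : differentiable (fun s => fwd c (gamma s)) (k s).
  by apply: (smooth_on_diff (sg.2 c ac)); split => //; exact: mem_chart_at.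
rewrite /path_form -/c.
have -> : 'D_1 (fwd c \o (fun s => gamma (k s))) s =
    'D_1 k s *: 'D_1 (fwd c \o gamma) (k s).
  apply: (etrans (derive_comp (1 : R) dk dc)); exact: (derive_R _ dc).
by rewrite -scalemxAl mx_scaleE.
Qed.

Lemma path_form_near (U : set R) (f g : R -> M) s : open U -> U s ->
  (forall y, U y -> f y = g y) -> pform f s = pform g s.
Proof.
move=> oU Us fg; rewrite /path_form (fg s Us).
apply: (f_equal (fun u : 'rV[R]_n => (u *m _) 0 0)).
by apply: (derive_near (1 : R) oU Us) => y Uy /=; rewrite fg.
Qed.

Lemma path_form_cst x s : pform (fun _ => x) s = 0.
Proof.
rewrite /path_form (_ : 'D_1 _ s = 0) ?mul0mx ?mxE //.
exact: derive_cst.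
Qed.

(** Any primitive serves after subtracting [P 0]. Outside the unit interval the path rests, so the
    mean value theorem makes the primitive constant there. *)
Lemma path_integral_intro (gamma : R -> M) (P : R -> R) x y :
  smooth_into S setT gamma ->
  (forall s, s <= 0 -> gamma s = x) -> (forall s, 1 <= s -> gamma s = y) ->
  (forall s : R, is_derive s 1 P (pform gamma s)) ->
  path_integral x y (P 1 - P 0).
Proof.
move=> sg g0 g1 dP; exists gamma, (fun s => P s - P 0).
have pf (U : set R) z s : open U -> U s -> (forall s, U s -> gamma s = z) ->
    pform gamma s = 0.
  by move=> oU Us e; rewrite (path_form_near oU Us e) path_form_cst.
have oN : open [set s : R | s < 0] by exact: open_lt.
have oP : open [set s : R | 1 < s] by exact: open_gt.
split=> [//|s s0|s s1|s].
- split; first exact: g0.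
  have [->|s0'] := eqVneq s 0; first by rewrite subrr.
  have [|c [c0]] := is_derive_MVT dP (a := s) (b := 0); first lra.
  rewrite (pf [set s | s < 0] x c oN) => [| |r /= r0]; last by apply: g0; lra.
    by rewrite mul0r; lra.
  by rewrite /=; lra.
- split; first exact: g1.
  have [->//|s1'] := eqVneq s 1.
  have [|c [c0]] := is_derive_MVT dP (a := 1) (b := s); first lra.
  rewrite (pf [set s | 1 < s] y c oP) => [| |r /= r0]; last by apply: g1; lra.
    by rewrite mul0r; lra.
  by rewrite /=; lra.
- by apply: (is_derive_eq (is_deriveB (dP s) (is_derive_cst (P 0) s 1))); rewrite subr0.
Qed.

Lemma path_integral_sym x y r : path_integral x y r -> path_integral y x (- r).
Proof.
move=> [g [P [sg g0 g1 dP]]].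
pose k (s : R) := 1 - s.
have sk : smooth_on setT k.
  by apply: smooth_on_subf; [exact: openT|exact: smooth_on_cst|exact: smooth_on_id].
have dk (s : R) : is_derive s 1 k (- 1).
  apply: (is_derive_eq (is_deriveB (is_derive_cst (1 : R) s 1) (is_derive_id s 1))).
  exact: sub0r.
have -> : - r = P (k 1) - P (k 0).
  by rewrite /k subrr subr0 (g0 0 (lexx _)).2 (g1 1 (lexx _)).2 sub0r.
apply: (@path_integral_intro (fun s => g (k s)) (fun s => P (k s))).
- exact: (smooth_into_comp (finite_dim_R R) openT openT (fun _ _ => I) sk sg).
- by move=> s s0; apply: (g1 _ _).1; rewrite /k; lra.
- by move=> s s0; apply: (g0 _ _).1; rewrite /k; lra.
- move=> s; rewrite (path_form_comp s sg sk).
  apply: (is_derive_eq (@is_derive1_comp _ P k s _ _ (dP (k s)) (dk s))).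
  by rewrite (@derive_val _ _ _ _ _ _ _ (dk s)) mulrC.
Qed.

Lemma path_integral_trans x y z r r' : path_integral x y r -> path_integral y z r' ->
  path_integral x z (r + r').
Proof.
move=> [g [P [sg g0 g1 dP]]] [f [Q [sf f0 f1 dQ]]].
(* The first path runs on [[0, 1/3]], the second on [[2/3, 1]]. Both rest at [y] in between, so the
   two descriptions agree on an open overlap. *)
pose k (s : R) := 3 * s; pose l (s : R) := 3 * s - 2.
have sk : smooth_on setT k.
  by apply: smooth_on_mul; [exact: openT|exact: smooth_on_cst|exact: smooth_on_id].
have sl : smooth_on setT l.
  by apply: smooth_on_subf; [exact: openT|exact: sk|exact: smooth_on_cst].
have dk (s : R) : is_derive s 1 k 3.
  by apply: (is_derive_eq (is_deriveZ 3 (is_derive_id s 1))); rewrite /GRing.scale /= mulr1.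
have dl (s : R) : is_derive s 1 l 3.
  by apply: (is_derive_eq (is_deriveB (dk s) (is_derive_cst (2 : R) s 1))); rewrite subr0.
pose h s := if s < 2^-1 then g (k s) else f (l s).
pose A := [set s : R | s < 2 / 3]; pose B := [set s : R | 3^-1 < s].
have hA s : A s -> h s = g (k s).
  rewrite /A /h /= => sA; case: ltP => // s2.
  by rewrite (g1 (k s) _).1 ?(f0 (l s) _).1 // /k /l; lra.
have hB s : B s -> h s = f (l s).
  rewrite /B /h /= => sB; case: ltP => // s2.
  by rewrite (g1 (k s) _).1 ?(f0 (l s) _).1 // /k /l; lra.
have oN : open [set s : R | s < 0] by exact: open_lt.
have oP : open [set s : R | 1 < s] by exact: open_gt.
have oA : open A by exact: open_lt.
have oB : open B by exact: open_gt.
have sgk := smooth_into_comp (finite_dim_R R) openT openT (fun _ _ => I) sk sg.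
have sfl := smooth_into_comp (finite_dim_R R) openT openT (fun _ _ => I) sl sf.
have cst0 (F : R -> M) (U : set R) u s : open U -> U s -> (forall s, U s -> F s = u) ->
    pform F s = 0.
  by move=> oU Us e; rewrite (path_form_near oU Us e) path_form_cst.
(* At every time one of the two summands is stationary, so their sum is a primitive along the
   concatenation. *)
have -> : r + r' = (P (k 1) + Q (l 1)) - (P (k 0) + Q (l 0)).
  rewrite /k /l mulr0 sub0r mulr1 (g0 0 (lexx _)).2 (g1 3 _).2; last lra.
  by rewrite (f1 (3 - 2) _).2 ?(f0 (- 2) _).2; [ring|lra..].
apply: (@path_integral_intro h (fun s => P (k s) + Q (l s))).
- apply: smooth_into_local => s _; have [s2|s2] := ltP s 2^-1.
    exists A, (fun s => g (k s)); split; [exact: oA|by rewrite /A /=; lra|by move=> u /hA ->|].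
    by apply: (smooth_into_sub _ sgk).
  exists B, (fun s => f (l s)); split; [exact: oB|by rewrite /B /=; lra|by move=> u /hB ->|].
  by apply: (smooth_into_sub _ sfl).
- move=> s s0; rewrite hA; last by rewrite /A /=; lra.
  by apply: (g0 _ _).1; rewrite /k; lra.
- move=> s s0; rewrite hB; last by rewrite /B /=; lra.
  by apply: (f1 _ _).1; rewrite /l; lra.
- move=> s.
  apply: (is_derive_eq (is_deriveD (@is_derive1_comp _ P k s _ _ (dP (k s)) (dk s))
    (@is_derive1_comp _ Q l s _ _ (dQ (l s)) (dl s)))).
  have [s2|s2] := ltP s 2^-1.
    have As : A s by rewrite /A /=; lra.
    rewrite (path_form_near oA As hA) (path_form_comp s sg sk).
    rewrite (@derive_val _ _ _ _ _ _ _ (dk s)).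
    rewrite (cst0 f [set s | s < 0] y (l s) oN) => [| |u /= u0].
    + by rewrite mul0r addr0 mulrC.
    + by rewrite /l /=; lra.
    + by apply: (f0 _ _).1; lra.
  have Bs : B s by rewrite /B /=; lra.
  rewrite (path_form_near oB Bs hB) (path_form_comp s sf sl).
  rewrite (@derive_val _ _ _ _ _ _ _ (dl s)).
  rewrite (cst0 g [set s | 1 < s] y (k s) oP) => [| |u /= u0].
  + by rewrite mul0r add0r mulrC.
  + by rewrite /k /=; lra.
  + by apply: (g1 _ _).1; lra.
Qed.

Lemma path_integral_refl x : path_integral x x 0.
Proof.
have := @path_integral_intro (fun _ => x) (fun _ => 0) x x.
rewrite subrr; apply=> //; first exact: smooth_into_cst.
by move=> s; rewrite path_form_cst; exact: is_derive_cst.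
Qed.

Definition contraction_at c x : 'cV[R]_n := (field_in rho c x *m form_in w c x)^T.

Lemma smooth_contraction_at c : atlas S c -> smooth_on (cod c) (contraction_at c).
Proof.
move=> ac; apply: (smooth_on_trmx (open_cod c)); apply: (smooth_on_mulmx (open_cod c)).
  exact: smooth_field_in.
exact: smooth_form_in.
Qed.

Lemma segment_path c x v : atlas S c ->
  (forall t : R, 0 <= t <= 1 -> cod c (x + t *: v)) ->
  exists r s : R, [/\ path_integral (bwd c x) (bwd c (x + v)) r, 0 <= s <= 1 &
    r - row_form (contraction_at c x) v = 'D_1 (@step R) s *
      row_form (contraction_at c (x + step s *: v) - contraction_at c x) v].
Proof.
move=> ac xv; pose k (s : R) := x + step s *: v; pose gamma s := bwd c (k s).
have ck s : cod c (k s) by apply: xv; rewrite step_ge0 step_le1.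
have sst := @smooth_step R.
have sk : smooth_on setT k.
  apply: smooth_on_add; [exact: openT|exact: smooth_on_cst|].
  by apply: smooth_on_scale; [exact: openT|exact: sst|exact: smooth_on_cst].
have sg : smooth_into S setT gamma.
  exact: (smooth_into_comp (finite_dim_mx R 1 n) openT (open_cod c) (fun s _ => ck s) sk
    (smooth_into_bwd ac)).
have sp := smooth_path_form rho w sg.
have [s|P dP] := primitive_ex (f := pform gamma) _
  (smooth_continuous (smooth_on_derive (1 : R) sp)).
  exact: (smooth_on_diff sp (I : setT s)).
have pE s : pform gamma s = 'D_1 (@step R) s * row_form (contraction_at c (k s)) v.
  rewrite (path_form_chart rho w sg ac (dom_bwd (ck s))) (fwd_bwd (ck s)).
  have -> : 'D_1 (fwd c \o gamma) s = 'D_1 (@step R) s *: v.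
    have ds := smooth_on_diff sst (I : setT s).
    apply: (etrans (derive_near (1 : R) openT (I : setT s) (g := k) _)).
      by move=> y _; exact: fwd_bwd.
    have [dsv e] := derive_scalemx (1 : R) ds (differentiable_cst v s).
    apply: (etrans (derive_add (1 : R) (differentiable_cst x s) dsv)).
    by rewrite derive_cst add0r e derive_cst scaler0 addr0.
  by rewrite -scalemxAl mx_scaleE.
pose a := row_form (contraction_at c x) v.
have dQ (s : R) : is_derive s 1 (fun s => P s - a * step s)
    (pform gamma s - a * 'D_1 (@step R) s).
  exact: (is_deriveB (dP s) (is_deriveZ a (is_derive_smooth s sst))).
have [s [s01 E]] := is_derive_MVT dQ (@ltr01 R).
exists (P 1 - P 0), s; split; last 1 first.
- move: E; rewrite (step_ge1 (lexx 1)) (step_le0 (lexx 0)) pE -/(k s) /row_form.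
  rewrite mulmxBr !mx_linE -/(row_form _ _) -/(row_form _ _) -/a.
  move: (row_form _ _) ('D_1 _ s) => u d E.
  by rewrite -[LHS]/(P 1 - P 0 - a); lra.
- apply: (path_integral_intro sg _ _ dP) => s' hs; rewrite /gamma /k.
    by rewrite (step_le0 hs) scale0r addr0.
  by rewrite (step_ge1 hs) scale1r.
- by lra.
Qed.

End Paths.

Lemma segment_near (R : realType) (V : normedModType R) (U : set V) (x : V) : open U -> U x ->
  exists2 e : R, 0 < e & forall v, `|v| < e -> forall t : R, 0 <= t <= 1 -> U (x + t *: v).
Proof.
move=> oU Ux; have /nbhs_ballP[e /= e0 H] := open_nbhs_nbhs (conj oU Ux).
exists e => // v ve t /andP[t0 t1]; apply: H.
rewrite -ball_normE /ball_ /= opprD addrA subrr sub0r normrN normrZ ger0_norm //.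
by rewrite (le_lt_trans _ ve) // ler_piMl.
Qed.

Lemma coord_le_norm (R : realType) (m n : nat) (A : 'M[R]_(m, n)) i j : `|A i j| <= `|A|.
Proof. by rewrite /Num.norm /= mx_normrE (le_bigmax _ _ (i, j)). Qed.

Lemma mulmx_bound (R : realType) (m n : nat) : exists2 K : R, 0 < K &
  forall (A : 'M[R]_(m, n)) (v : 'rV[R]_m) j, `|(v *m A) 0 j| <= K * `|A| * `|v|.
Proof.
exists (m%:R + 1) => [|A v j]; first by rewrite ltr_wpDl.
rewrite mxE (le_trans (ler_norm_sum _ _ _)) //.
apply: (@le_trans _ _ (\sum_(i < m) (`|A| * `|v|))).
  apply: ler_sum => i _; rewrite normrM mulrC ler_pM //.
    exact: (coord_le_norm A i j).
  exact: (coord_le_norm v 0 i).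
rewrite sumr_const card_ord -[leLHS]mulr_natl -[leRHS]mulrA ler_wpM2r ?mulr_ge0 //.
by rewrite lerDl.
Qed.

Section Exactness.
Variables (R : realType) (n : nat) (M : topologicalType).
Variables (S : smooth_structure R n M) (rho : circle_action S).
Variables (w : symplectic_form S).
Hypothesis cM : connected [set: M].

Local Notation path_integral := (path_integral rho w).
Local Notation alpha := (contraction_at rho w).

Lemma path_near y : exists U : set M,
  [/\ open U, U y & forall z, U z -> exists r, path_integral y z r].
Proof.
pose c := chart_at S y; have ac : atlas S c := chart_at_atlas S y.
have cy : dom c y := mem_chart_at S y.
have [e e0 H] := segment_near (open_cod c) (cod_fwd cy).
exists (dom c `&` fwd c @^-1` [set x | `|x - fwd c y| < e]); split.
- apply: openI_preimage; [exact: dom_open| |exact: fwd_continuous].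
  rewrite (_ : [set x | _] = ball (fwd c y) e); first exact: ball_open.
  by rewrite -ball_normE; apply/funext => x /=; rewrite distrC.
- by split => //=; rewrite subrr normr0.
- move=> z [cz /= ze]; have [r [_ [P _ _]]] := segment_path rho w ac (H _ ze).
  by exists r; rewrite addrC subrK !bwd_fwd // in P.
Qed.

(** The points that can be reached from [p] form an open set, and so do the others, because paths
    can be reversed. *)
Lemma path_ex p q : exists r, path_integral p q r.
Proof.
apply: (@connected_ind _ [set y | exists r, path_integral p y r] p cM).
- rewrite openE => y [r ry]; have [U [oU Uy H]] := path_near y.
  apply: filterS (open_nbhs_nbhs (conj oU Uy)) => z /H[r' rz].
  by exists (r + r'); exact: path_integral_trans rz.
- rewrite openE => y ny; have [U [oU Uy H]] := path_near y.
  apply: filterS (open_nbhs_nbhs (conj oU Uy)) => z /H[r' rz] [r pz].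
  apply: ny; exists (r - r'); apply: (path_integral_trans pz).
  exact: path_integral_sym.
- by exists 0; exact: path_integral_refl.
Qed.

Variable p : M.
Hypothesis loop0 : forall r, path_integral p p r -> r = 0.

Definition potential y : R := projT1 (cid (path_ex p y)).

Lemma potentialP y : path_integral p y (potential y).
Proof. by rewrite /potential; case: cid. Qed.

Lemma potential_diff y z r : path_integral y z r -> potential z - potential y = r.
Proof.
move=> yz; have l := path_integral_trans (path_integral_trans (potentialP y) yz)
  (path_integral_sym (potentialP z)).
by move: (loop0 l); lra.
Qed.

Lemma differentiable_potential c x : atlas S c -> cod c x ->
  differentiable (potential \o bwd c) x /\
  'd (potential \o bwd c) x = row_form (alpha c x) :> ('rV[R]_n -> R).
Proof.
move=> ac cx; apply: diff_of_bound; first exact: continuous_row_form.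
move=> e e0; have [K K0 HK] := mulmx_bound R n 1.
have [C HC] := step_derive_bound R.
have [d0 d00 Hd0] := segment_near (open_cod c) cx.
have C0 : 0 <= C by apply: le_trans (HC 0 _) => //; rewrite lexx ler01.
have C1 : 0 < (C + 1) * K by rewrite mulr_gt0 // ltr_wpDl.
have ca : {for x, continuous (alpha c)}.
  exact: smooth_on_cont (smooth_contraction_at rho w ac) cx.
(* [C] bounds the derivative of [step] and [K] the product with a row vector; [C + 1] keeps the
   denominator positive. *)
have : \forall y \near x, `|alpha c x - alpha c y| < e / ((C + 1) * K).
  by move/cvgrPdist_lt : ca; apply; rewrite divr_gt0.
move=> /nbhs_ballP[d1 /= d10 Hd1].
have m0 : 0 < Num.min d0 d1 by rewrite lt_min d00.
near=> v.
have vm : `|v| < Num.min d0 d1.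
  near: v; apply/nbhs_ballP; exists (Num.min d0 d1) => //= v.
  by rewrite -ball_normE /ball_ /= sub0r normrN.
move: vm; rewrite lt_min => /andP[v0 v1].
have [r [s [P s01 E]]] := segment_path rho w ac (Hd0 v v0).
rewrite /= [v + x]addrC (potential_diff P) E normrM.
have b1 := HC s s01.
have b2 : `|alpha c (x + step s *: v) - alpha c x| <= e / ((C + 1) * K).
  rewrite distrC ltW //; apply: Hd1.
  rewrite -ball_normE /ball_ /= opprD addrA subrr sub0r normrN normrZ.
  rewrite ger0_norm ?step_ge0 //; apply: le_lt_trans v1.
  by rewrite ler_piMl // step_le1.
have b3 := HK (alpha c (x + step s *: v) - alpha c x) v 0.
apply: (@le_trans _ _ ((C + 1) * (K * (e / ((C + 1) * K)) * `|v|))).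
  apply: ler_pM => //; first by rewrite (le_trans b1) // lerDl.
  apply: (le_trans b3); rewrite ler_wpM2r // ler_wpM2l // ltW //.
have -> : (C + 1) * (K * (e / ((C + 1) * K)) * `|v|) = e * `|v|; last exact: lexx.
have C1' : C + 1 != 0 by rewrite gt_eqF // ltr_wpDl.
by field; rewrite C1' gt_eqF.
Unshelve. all: by end_near.
Qed.

Lemma derive_potential c x v : atlas S c -> cod c x ->
  'D_v (potential \o bwd c) x = row_form (alpha c x) v.
Proof.
move=> ac cx; have [d E] := differentiable_potential ac cx.
by rewrite (deriveE _ d) E.
Qed.

(** Its directional derivatives are components of the contracted form, which is already known to be
    smooth. *)
Lemma smooth_potential c : atlas S c -> smooth_on (cod c) (potential \o bwd c).
Proof.
move=> ac k; have H x : cod c x -> differentiable (potential \o bwd c) x.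
  by move=> cx; have [] := differentiable_potential ac cx.
case: k => [x cx|k]; first exact: differentiable_continuous (H x cx).
split=> // v.
have sl : smooth_on (cod c) (fun x => row_form (alpha c x) v).
  apply: (smooth_on_entry _ _ (open_cod c)); apply: (smooth_on_mulmx (open_cod c)).
    exact: smooth_on_cst.
  exact: smooth_contraction_at.
apply: (Ck_on_eq (open_cod c) _ (sl k)) => x cx.
by rewrite (derive_potential _ ac cx).
Qed.

Lemma potential_hamiltonian : hamiltonian_action w rho.
Proof.
exists potential; split=> [c|q v]; first exact: smooth_potential.
have ac := chart_at_atlas S q; have cx := cod_fwd (mem_chart_at S q).
rewrite (derive_potential v ac cx) /row_form /contraction_at -(contraction_in rho w ac cx).
by rewrite /oneform_in frame_chart_at mul1mx (bwd_fwd (mem_chart_at S q)).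
Qed.

End Exactness.

(** * Fixed points with vanishing linear part *)

Lemma locally_constant_R (R : realType) (T : topologicalType) (f : R -> T) :
  (forall t0, \forall t \near t0, f t = f t0) -> forall t, f t = f 0.
Proof.
move=> lf; have cR : connected [set: R] by apply/connected_intervalP.
apply: (@connected_ind _ [set t | f t = f 0] 0 cR) => //.
- by rewrite openE => t ft; apply: filterS (lf t) => u /= ->.
- by rewrite openE => t ft; apply: filterS (lf t) => u /= ->.
Qed.

Lemma derive0_segment (R : realType) (m p : nat) (f : R -> 'M[R]_(m, p)) (a b : R) :
  (forall s : R, 0 <= s <= 1 -> differentiable f (a + s *: (b - a)) /\
    'D_1 f (a + s *: (b - a)) = 0) -> f b = f a.
Proof.
move=> H; apply/matrixP => i j.
have [s s01|s [s01 E]] := @MVT_line _ _ (fun t => f t i j) a (b - a) 1 ltr01.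
  exact: differentiable_entry (H s s01).1.
have [|d D0] := H s; first lra.
move: E; rewrite (derive_entry _ _ _ d) (derive_R _ d) D0 scaler0 mxE mulr0 scale1r.
by rewrite [a + _]addrC subrK => E; lra.
Qed.

Section FixedPoints.
Variables (R : realType) (n : nat) (M : topologicalType).
Variables (S : smooth_structure R n M) (rho : circle_action S).

Lemma smooth_flow_line c c' x : atlas S c -> atlas S c' -> cod c x ->
  let U := [set t : R | dom c' (rho t (bwd c x))] in
  [/\ open U, forall t, U t -> differentiable (fun t => flow rho c c' t x) t &
    forall t, U t -> 'D_1 (fun t => flow rho c c' t x) t =
      field_in rho c x *m flow_jac rho c c' t x].
Proof.
move=> ac ac' cx U; split=> [|t Ut|t Ut].
- have := smooth_into_open c' openT (smooth_orbit rho (bwd c x)).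
  by rewrite setTI.
- exact: (differentiable_slice1 (differentiable_flow ac ac' (z := (t, x)) (conj cx Ut))).
have fd : flow_dom rho c c' (t, x) by split.
apply: (etrans (derive_slice1 (1 : R) (differentiable_flow ac ac' fd))).
exact: derive_flow_t'.
Qed.

(** The velocity at any time is the pushforward of the velocity at time 0, which vanishes. The orbit
    is thus constant inside every chart it meets, and connectedness of the line concludes. *)
Lemma field0_fixed c x : atlas S c -> cod c x -> field_in rho c x = 0 ->
  fixed_point rho (bwd c x).
Proof.
move=> ac cx X0 t; rewrite -[RHS](act0 rho).
apply: (@locally_constant_R _ _ (fun t => rho t (bwd c x))) => {}t.
pose c' := chart_at S (rho t (bwd c x)); have ac' : atlas S c' := chart_at_atlas S _.
have [oU dU DU] := smooth_flow_line ac ac' cx.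
have Ut : dom c' (rho t (bwd c x)) by exact: mem_chart_at.
have [e e0 H] := segment_near oU Ut.
apply/nbhs_ballP; exists e => //= u; rewrite /ball /= distrC => ut.
have Uu : dom c' (rho u (bwd c x)).
  by have := H _ ut 1; rewrite scale1r addrC subrK ler01 lexx; apply.
rewrite -(bwd_fwd Uu) -(bwd_fwd Ut); congr (bwd c' _).
apply: (@derive0_segment _ _ _ (fun t => flow rho c c' t x)) => s s01.
have Us := H _ ut s s01; split; first exact: dU.
by rewrite (DU _ Us) X0 mul0mx.
Qed.

Lemma flow_fixed c x t : cod c x -> fixed_point rho (bwd c x) -> flow rho c c t x = x.
Proof. by move=> cx fx; rewrite /flow fx fwd_bwd. Qed.

Lemma flow_dom_fixed c x t : cod c x -> fixed_point rho (bwd c x) ->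
  flow_dom rho c c (t, x).
Proof. by move=> cx fx; split => //=; rewrite fx; exact: dom_bwd. Qed.

(** With zero linearised generator the variational equation has only constant solutions. *)
Lemma flow_jac_fixed1 c x t : atlas S c -> cod c x -> fixed_point rho (bwd c x) ->
  field_jac rho c x = 0 -> flow_jac rho c c t x = 1%:M.
Proof.
move=> ac cx fx B0; rewrite -(flow_jac_id rho ac cx).
have d s := smooth_on_diff (smooth_flow_jac rho ac ac) (flow_dom_fixed s cx fx).
apply: (@derive0_const_mx _ _ _ (fun t => flow_jac rho c c t x)) => s.
  exact: (differentiable_slice1 (d s)).
apply: (etrans (derive_slice1 (1 : R) (d s))).
apply: (etrans (derive_flow_jac ac ac (flow_dom_fixed s cx fx))) => /=.
by rewrite (flow_fixed s cx fx) B0 mulmx0.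
Qed.

Definition locally_trivial_at p := exists U : set M,
  [/\ open U, U p & forall q, U q -> fixed_point rho q].

(* The time-[t] maps near [p] are C^1-close to the identity, so an orbit of
   period one cannot keep moving in the direction of a nonzero velocity. *)
Lemma fixed_jac0_locally_trivial p : let c := chart_at S p in fixed_point rho p ->
  field_jac rho c (fwd c p) = 0 -> locally_trivial_at p.
Proof.
move=> c fp B0; pose x := fwd c p; have ac : atlas S c := chart_at_atlas S p.
have cp : dom c p := mem_chart_at S p; have cx : cod c x := cod_fwd cp.
have px : bwd c x = p := bwd_fwd cp.
have fx : fixed_point rho (bwd c x) by rewrite px.
have [K K0 HK] := mulmx_bound R n n.
pose A (z : R * 'rV[R]_n) := flow_jac rho c c z.1 z.2.
(* Compactness of the time interval gives one neighbourhood of [x] that works for all times of a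
   period. *)
have near1 : \forall y \near x, forall t : R, `[0, 1]%classic t ->
    flow_dom rho c c (t, y) /\ `|A (t, y) - 1%:M| < K^-1.
  have /compact_near_coveringP nc := @segment_compact R 0 1.
  apply: (nc _ (nbhs x) (fun y t => flow_dom rho c c (t, y) /\
    `|A (t, y) - 1%:M| < K^-1)) => t _.
  have fd := flow_dom_fixed t cx fx.
  have cA : {for (t, x), continuous A} := smooth_on_cont (smooth_flow_jac rho ac ac) fd.
  have N1 : \forall z \near (t, x), flow_dom rho c c z.
    exact: open_nbhs_nbhs (conj (open_flow_dom rho c c ac) fd).
  have N2 : \forall z \near (t, x), `|A (t, x) - A z| < K^-1.
    by move/cvgrPdist_lt : cA; apply; rewrite invr_gt0.
  have E1 : A (t, x) = 1%:M by exact: flow_jac_fixed1.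
  apply: filterS2 N1 N2 => -[s y] /= h1 h2; split => //.
  by rewrite distrC -E1.
have N : \forall y \near x, cod c y /\ forall t : R, `[0, 1]%classic t ->
    flow_dom rho c c (t, y) /\ `|A (t, y) - 1%:M| < K^-1.
  by apply: filterS2 (open_nbhs_nbhs (conj (open_cod c) cx)) near1.
have /nbhs_ballP[e /= e0 He] := N.
exists (dom c `&` fwd c @^-1` ball x e); split.
- by apply: openI_preimage; [exact: dom_open|exact: ball_open|exact: fwd_continuous].
- by split => //; exact: ballxx.
move=> q [cq /He[cy H]]; rewrite -(bwd_fwd cq); move: (fwd c q) cy H => y cy H.
apply: field0_fixed => //; apply: contrapT => /eqP v0.
pose v := field_in rho c y.
(* A coordinate in which the sup norm of [v] is attained. *)
have [[i1 i] /= vi] : exists i : 'I_1 * 'I_n, `|v| = `|v i.1 i.2|.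
  by apply: mx_norm_neq0; rewrite -[mx_norm v]/(`|v|) normr_eq0.
rewrite (ord1 i1) in vi.
have [oU dU DU] := smooth_flow_line ac ac cy.
have Ht (t : R) : 0 <= t <= 1 -> dom c (rho t (bwd c y)) /\ `|A (t, y) - 1%:M| < K^-1.
  by move=> t01; have [|[_ h1] h2] := H t; rewrite /= ?in_itv.
have dphi (s : R) : 0 <= s <= 1 ->
    differentiable (fun t => flow rho c c t y 0 i) ((0 + s *: (1 : R)) : R).
  move=> s01; rewrite add0r /GRing.scale /= mulr1.
  by apply: differentiable_entry; apply: dU; exact: (Ht s s01).1.
(* Coordinate [i] returns after time 1, so [(v A) i] vanishes at some time [s], hence
   [|v i| = |(v (A - 1)) i|]. This is less than [|v|], since [K |A - 1| < 1]. *)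
have [s [s01]] := MVT_line (@ltr01 R) dphi.
have s01' : 0 <= s <= 1 by lra.
have [h1 h2] := Ht s s01'.
rewrite !add0r /GRing.scale /= !mulr1 mul1r => E.
have : flow rho c c 1 y 0 i - flow rho c c 0 y 0 i = 0.
  by rewrite /flow act1 act0 subrr.
rewrite E (derive_entry _ _ _ (dU _ h1)) (DU _ h1).
have -> : flow_jac rho c c s y = 1%:M + (A (s, y) - 1%:M) by rewrite addrC subrK.
rewrite mulmxDr mulmx1 mx_addE -/v => F.
have := HK (A (s, y) - 1%:M) v i.
have -> : (v *m (A (s, y) - 1%:M)) 0 i = - v 0 i.
  by apply/eqP; rewrite -addr_eq0 addrC F.
rewrite normrN -vi => G.
have v1 : 0 < `|v| by rewrite normr_gt0.
have : K * `|A (s, y) - 1%:M| < 1 by rewrite -ltr_pdivlMl // mulr1.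
rewrite ltNge => /negP; apply.
by rewrite -(ler_pM2r v1) mul1r.
Qed.

Lemma fixed_field0 c x : cod c x -> fixed_point rho (bwd c x) -> field_in rho c x = 0.
Proof.
move=> cx fx; rewrite field_in.unlock.
apply: (@derive1_locally_cst _ _ _ setT x) => // [|t _]; first exact: openT.
exact: flow_fixed.
Qed.

Lemma continuous_act t : continuous (rho t).
Proof.
move=> p; pose c := chart_at S p; have ac : atlas S c := chart_at_atlas S p.
have cp : dom c p := mem_chart_at S p.
have e : \forall q \near p, rho t (bwd c (fwd c q)) = rho t q.
  apply: filterS (open_nbhs_nbhs (conj (dom_open c) cp)) => q cq.
  by rewrite (bwd_fwd cq).
have cf : {for fwd c p, continuous (fun x => rho t (bwd c x))}.
  apply: (@continuous_comp _ _ _ (fun x => (t, x)) (fun z : R * 'rV_n => rho z.1 (bwd c z.2))).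
    apply: smooth_continuous; apply: smooth_on_pair; first exact: openT.
      exact: smooth_on_cst.
    exact: smooth_on_id.
  exact: ((act_smooth rho ac).1 (t, fwd c p) (cod_fwd cp)).
have := @continuous_comp _ _ _ (fwd c) (fun x => rho t (bwd c x)) p
  (fwd_continuous cp) cf.
rewrite /prop_for /continuous_at /= bwd_fwd //.
by apply: cvg_trans; exact: near_eq_cvg.
Qed.

(** The points near which the action is trivial form an open set with open complement. By
    connectedness this set cannot contain p when the action is nontrivial. *)
Lemma fixed_jac_neq0 p : hausdorff_space M -> connected [set: M] ->
  nontrivial_action rho -> fixed_point rho p ->
  field_jac rho (chart_at S p) (fwd (chart_at S p) p) != 0.
Proof.
move=> hM cM [t0 [p0 nf]] fp; apply/eqP => B0; apply: nf.
suff [U [_ Up H]] : locally_trivial_at p0 by exact: H.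
apply: (@connected_ind _ locally_trivial_at p cM); last exact: fixed_jac0_locally_trivial.
  rewrite openE => q [U [oU Uq H]].
  apply: filterS (open_nbhs_nbhs (conj oU Uq)) => r Ur.
  by exists U.
(* A point that moves is separated from one of its images, so nearby points move as well. *)
rewrite openE => y nt; have [fy|] := pselect (fixed_point rho y); last first.
  move=> /existsNP[t /eqP ty].
  move: (hM); rewrite open_hausdorff => /(_ _ _ ty)[[A B] /= [Ay By] [oA oB /eqP AB]].
  rewrite inE in Ay; rewrite inE in By.
  have N1 := open_nbhs_nbhs (conj oB By).
  have N2 := @continuous_act t y _ (open_nbhs_nbhs (conj oA Ay)).
  apply: filterS2 N1 N2 => q Bq Aq [U [_ Uq H]].
  by rewrite /= (H q Uq) in Aq; have : (A `&` B) q by []; rewrite AB.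
pose c := chart_at S y; have ac : atlas S c := chart_at_atlas S y.
have cy : dom c y := mem_chart_at S y; have cx := cod_fwd cy.
(* At a fixed point outside the set the linearisation is nonzero. It stays nonzero nearby, whereas
   it vanishes wherever the action is locally trivial. *)
have [v v0] : exists v, 'D_v (field_in rho c) (fwd c y) != 0.
  apply: contrapT => H; apply: nt; apply: fixed_jac0_locally_trivial => //.
  apply: mulmx_row_inj => v; rewrite mulmx0 (field_jacE _ _ ac cx).
  by apply: contrapT => /eqP h; apply: H; exists v.
have sX := smooth_field_in rho ac.
have cD : {for fwd c y, continuous ('D_v (field_in rho c))}.
  exact: smooth_on_cont (smooth_on_derive v sX) cx.
have cDf := @continuous_comp _ _ _ (fwd c) ('D_v (field_in rho c)) y (fwd_continuous cy) cD.
have N1 : \forall q \near y, 'D_v (field_in rho c) (fwd c q) != 0.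
  exact: (cvgr_neq0 _ cDf v0).
apply: filterS2 N1 (open_nbhs_nbhs (conj (dom_open c) cy)) => q Dq cq [U [oU Uq H]].
move/eqP: Dq; apply.
have oW : open (cod c `&` bwd c @^-1` U).
  by apply: openI_preimage; [exact: open_cod|exact: oU|exact: bwd_continuous].
apply: (etrans (derive_near v oW _ (g := fun _ => 0) _)); last exact: derive_cst.
  by split; [exact: cod_fwd|rewrite /= (bwd_fwd cq)].
by move=> z [cz Uz]; apply: fixed_field0 => //; exact: H.
Qed.

End FixedPoints.

(** * Extrema of a Hamiltonian *)

Lemma line_ball (R : realType) (V : normedModType R) (x v : V) (P : set V) : nbhs x P ->
  exists2 e : R, 0 < e & forall s : R, `|s| < e -> P (x + s *: v).
Proof.
move=> xP; have dl : differentiable (cst x + *:%R ^~ v) (0 : R).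
  by have := is_diffD (is_diff_cst x (0 : R)) (is_diff_scalel 0 v).
have cl := differentiable_continuous dl.
have /nbhs_ballP[e /= e0 H] : nbhs (0 : R) (fun s : R => P (x + s *: v)).
  by apply: cl; rewrite /= fctE scale0r addr0.
by exists e => // s se; apply: H; rewrite -ball_normE /ball_ /= sub0r normrN.
Qed.

(** The restriction to a line has an interior minimum. A negative second derivative would stay
    negative nearby, and two uses of the mean value theorem would produce a smaller value. *)
Lemma min_second_derivative (R : realType) (V : normedModType R) (f : V -> R)
    (U : set V) (x v : V) : open U -> U x -> smooth_on U f ->
  (forall y, U y -> f x <= f y) -> 'D_v f x = 0 /\ 0 <= 'D_v ('D_v f) x.
Proof.
move=> oU Ux sf fx; have sD := smooth_on_derive v sf.
have D0 : 'D_v f x = 0.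
  have [h h0 H] := line_ball v (open_nbhs_nbhs (conj oU Ux)).
  have inU (s : R) : s \in `]- h, h[ -> U (x + s *: v).
    by rewrite in_itv /= -ltr_norml; exact: H.
  have dl (s : R) : s \in `]- h, h[ -> derivable (fun s : R => f (x + s *: v)) s 1.
    by move=> /inU Us; have [] := is_derive_line (smooth_on_diff sf Us).
  have h' : - h <= h by rewrite ge0_cp // ltW.
  have I0 : 0 \in `]- h, h[ by rewrite in_itv /= oppr_lt0 h0.
  have [s|_ E] := derive1_at_min h' dl I0.
    by rewrite scale0r addr0 => /inU; exact: fx.
  have [_ E'] := is_derive_line (smooth_on_diff sf (inU 0 I0)).
  by move: E'; rewrite E scale0r addr0.
split=> //; rewrite leNgt; apply/negP => neg.
have N : \forall y \near x, U y /\ 'D_v ('D_v f) y < 0.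
  have N2 : \forall y \near x, 'D_v ('D_v f) y < 0.
    exact: (cvgr_lt _ (smooth_on_cont (smooth_on_derive v sD) Ux) _ neg).
  by apply: filterS2 (open_nbhs_nbhs (conj oU Ux)) N2.
have [h2 h20 H] := line_ball v N; pose h := h2 / 2.
have h0 : 0 < h by rewrite divr_gt0.
have inU (s : R) : 0 <= s <= h -> U (x + s *: v) /\ 'D_v ('D_v f) (x + s *: v) < 0.
  move=> /andP[s0 sh]; apply: H; rewrite ger0_norm // (le_lt_trans sh) //.
  by rewrite gtr_pMr // invf_lt1 ?ltr1n.
have [s sh|s [sh E]] := @MVT_line _ _ f x v h h0.
  exact: (smooth_on_diff sf (inU s sh).1).
have s0 : 0 < s by lra.
have [t th|t [ts F]] := @MVT_line _ _ ('D_v f) x v s s0.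
  by apply: (smooth_on_diff sD (inU t _).1); lra.
have h1 : 0 <= h <= h by rewrite lexx ltW.
have th : 0 <= t <= h by lra.
have := fx _ (inU h h1).1.
have := (inU t th).2.
move: F E; rewrite D0 subr0 => ->.
move=> E dn ab; have : h * (s * 'D_v ('D_v f) (x + t *: v)) < 0.
  by rewrite !pmulr_rlt0.
by rewrite -E; lra.
Qed.

Section Hamiltonian.
Variables (R : realType) (n : nat) (M : topologicalType).
Variables (S : smooth_structure R n M) (rho : circle_action S).
Variables (w : symplectic_form S).
Variable h : M -> R.
Hypothesis sh : forall c, atlas S c -> smooth_on (cod c) (h \o bwd c).
Hypothesis dh : forall p (v : 'rV[R]_n),
  'D_v (h \o bwd (chart_at S p)) (fwd (chart_at S p) p) =
  (v *m Defs.contraction (generator rho) w p) 0 0.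

Local Notation alpha := (contraction_at rho w).

(** [dh] speaks at each point of the distinguished chart there; the transition map carries it to an
    arbitrary chart. *)
Lemma derive_hamiltonian c x v : atlas S c -> cod c x ->
  'D_v (h \o bwd c) x = row_form (alpha c x) v.
Proof.
move=> ac cx; pose c' := chart_at S (bwd c x); have ac' : atlas S c' := chart_at_atlas S _.
have c'x : dom c' (bwd c x) := mem_chart_at S _.
have ox : overlap c c' x by split.
have oo := open_overlap c c'.
have dT := smooth_on_diff (atlas_smooth ac ac') ox.
have dH := smooth_on_diff (sh ac') (cod_transition c'x).
apply: (etrans (derive_near v oo ox (g := fun y => (h \o bwd c') (transition c c' y)) _)).
  by move=> y [cy c'y]; rewrite /= bwd_transition.
apply: (etrans (derive_comp v dT dH)).
rewrite (derive_jacobian v dT) /contraction_at -(contraction_in rho w ac cx).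
by rewrite /transition /= dh /row_form /oneform_in mulmxA.
Qed.

Lemma continuous_hamiltonian : continuous h.
Proof.
move=> p; pose c := chart_at S p; have ac : atlas S c := chart_at_atlas S p.
have cp : dom c p := mem_chart_at S p.
have e : \forall q \near p, h (bwd c (fwd c q)) = h q.
  apply: filterS (open_nbhs_nbhs (conj (dom_open c) cp)) => q cq.
  by rewrite (bwd_fwd cq).
have := @continuous_comp _ _ _ (fwd c) (h \o bwd c) p
  (fwd_continuous cp) (smooth_on_cont (sh ac) (cod_fwd cp)).
rewrite /prop_for /continuous_at /= bwd_fwd //.
by apply: cvg_trans; exact: near_eq_cvg.
Qed.

Lemma is_derive_hamiltonian (gamma : R -> M) (s : R) : smooth_into S setT gamma ->
  is_derive s 1 (fun s => h (gamma s)) (path_form rho w gamma s).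
Proof.
move=> sg; pose c := chart_at S (gamma s); have ac : atlas S c := chart_at_atlas S _.
have cs : dom c (gamma s) := mem_chart_at S _.
have dg := smooth_on_diff (sg.2 c ac) (conj I cs).
have dH := smooth_on_diff (sh ac) (cod_fwd cs).
have oU := smooth_into_open c openT sg.
have Us : (setT `&` gamma @^-1` dom c) s by split.
have e y : (setT `&` gamma @^-1` dom c) y ->
    (fun y => (h \o bwd c) ((fwd c \o gamma) y)) y = h (gamma y).
  by move=> [_ cy]; rewrite /= bwd_fwd.
have dhg : differentiable (fun y => (h \o bwd c) ((fwd c \o gamma) y)) s.
  exact: differentiable_comp.
split.
  apply: diff_derivable; apply: (near_eq_differentiable _ dhg).
  by apply: filterS (open_nbhs_nbhs (conj oU Us)) => y; exact: e.
apply: (etrans (esym (derive_near (1 : R) oU Us e))).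
apply: (etrans (derive_comp (1 : R) dg dH)).
rewrite (derive_hamiltonian _ ac (cod_fwd cs)) (path_form_chart rho w sg ac cs).
by [].
Qed.

Lemma derive_alpha_zero c x u : atlas S c -> cod c x -> field_in rho c x = 0 ->
  'D_u (alpha c) x = (u *m field_jac rho c x *m form_in w c x)^T.
Proof.
move=> ac cx X0.
have dX := smooth_on_diff (smooth_field_in rho ac) cx.
have dO := smooth_on_diff (smooth_form_in w ac) cx.
apply: (etrans (derive_trmx u (differentiable_mulmx dX dO))).
by rewrite (derive_mulmx u dX dO) X0 mul0mx addr0 (field_jacE _ u ac cx).
Qed.

(** Where the generator vanishes, the derivative of [i_X w] does not see that of [w], so the Hessian
    is the linearised generator times [w]. *)
Lemma second_derivative_hamiltonian c x v : atlas S c -> cod c x ->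
  field_in rho c x = 0 ->
  'D_v ('D_v (h \o bwd c)) x = (v *m (field_jac rho c x *m form_in w c x) *m v^T) 0 0.
Proof.
move=> ac cx X0; have oc := open_cod c.
apply: (etrans (derive_near v oc cx (g := fun y => row_form (alpha c y) v) _)).
  by move=> y cy; exact: derive_hamiltonian.
have da := smooth_on_diff (smooth_contraction_at rho w ac) cx.
rewrite /row_form (derive_entry _ _ _ (differentiable_mulmx (differentiable_cst v x) da)).
rewrite (derive_mulmx v (differentiable_cst v x) da) derive_cst mul0mx add0r.
rewrite (derive_alpha_zero v ac cx X0) -[in LHS](trmxK v) -trmx_mul mxE trmxK.
by rewrite mulmxA.
Qed.

(** Nondegeneracy of [w]: if [i_X w] vanishes, so does the generator. *)
Lemma critical_field0 c x : atlas S c -> cod c x ->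
  (forall v, 'D_v (h \o bwd c) x = 0) -> field_in rho c x = 0.
Proof.
move=> ac cx D0; have a0 : alpha c x = 0.
  by apply: mulmx_row_inj => v; apply/rowP => i; rewrite (ord1 i) mulmx0 [RHS]mxE
    -(D0 v) (derive_hamiltonian v ac cx).
have := f_equal (fun a => a^T *m invmx (form_in w c x)) a0.
by rewrite /contraction_at trmxK trmx0 mul0mx (mulmxK (form_in_unit w ac cx)).
Qed.

End Hamiltonian.

(** * Signs of the weights at extrema *)

Section Sign.
Variables (R : realType) (n : nat) (M : topologicalType).
Variables (S : smooth_structure R n M) (rho : circle_action S).
Variables (w : symplectic_form S).
Hypothesis hw : symplectic_action w rho.
Variables (J : compatible_acs w) (nabla : affine_connection S).
Hypothesis pJ : preserves_acs nabla J.

(** By the mean value theorem the mean is attained at some time, so a sign valid at all times passes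
    to the mean. *)
Lemma mean_weight_value p : fixed_point rho p -> exists a : R,
  mean_weight rho J p = weight rho J p a.
Proof.
(* The constant path at p turns the smoothness of [gtheta] into that of [weight]. *)
move=> fp; have sw := smooth_weight hw J nabla (smooth_into_cst S setT p)
  (fun _ _ => erefl) fp.
have [s|Q dQ] := primitive_ex (f := weight rho J p) _
  (smooth_continuous (smooth_on_derive (1 : R) sw)).
  exact: (smooth_on_diff sw (I : setT s)).
have sr := @smooth_time_ramp R.
have dQr (t : R) : is_derive t 1 (fun t => Q (time_ramp t))
    ('D_1 (@time_ramp R) t * weight rho J p (time_ramp t)).
  have H := @is_derive1_comp _ Q (@time_ramp R) t _ _ (dQ (time_ramp t))
    (is_derive_smooth t sr).
  by apply: (is_derive_eq H); rewrite mulrC.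
have c : continuous (fun t => 'D_1 (@time_ramp R) t * weight rho J p (time_ramp t)).
  apply: smooth_continuous; apply: smooth_on_mul; [exact: openT|exact: smooth_on_derive|].
  exact: (smooth_on_comp (finite_dim_R R) openT (fun _ _ => I) sr sw).
have [a [_ E]] := is_derive_MVT dQ (@ltr01 R); exists a.
rewrite /mean_weight (Rintegral01_FTC c dQr) time_ramp1 ?time_ramp0; [|lra..].
by rewrite E subr0 mulr1.
Qed.

Section Chart.
Variable p : M.
Hypothesis fp : fixed_point rho p.
Local Notation c := (chart_at S p).
Local Notation x := (fwd c p).
Local Notation B := (field_jac rho c x).
Local Notation O := (form_in w c x).

Lemma weight_signs a : B *m O != 0 ->
  (psd (B *m O) -> 0 < weight rho J p a) /\ (psd (- (B *m O)) -> weight rho J p a < 0).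
Proof.
move=> B0; have ac : atlas S c := chart_at_atlas S p.
have cx : cod c x := cod_fwd (mem_chart_at S p).
have fx : fixed_point rho (bwd c x) by rewrite (bwd_fwd (mem_chart_at S p)).
have E := flow_symplectic hw ac ac (flow_dom_fixed a cx fx).
rewrite (flow_fixed a cx fx) in E.
have cJ := acs_in_compatible J ac cx.
have pos B' := @clin_trace_gt0 R n O (acs_in J c x) (flow_jac rho c c a x) B'
  (form_in_skew w c x) cJ (form_in_unit w ac cx) E.
split=> [pB|pB]; first exact: pos.
(* The weight is linear in the linearised generator, so the negative case is the positive one for
   [- B]. *)
have := pos (- B); rewrite mulNmx oppr_eq0 => /(_ pB B0).
by rewrite mulmxN clinN mulmxN mulNmx raddfN /= oppr_gt0.
Qed.

Variable h : M -> R.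
Hypothesis sh : forall c, atlas S c -> smooth_on (cod c) (h \o bwd c).
Hypothesis dh : forall p (v : 'rV[R]_n),
  'D_v (h \o bwd (chart_at S p)) (fwd (chart_at S p) p) =
  (v *m Defs.contraction (generator rho) w p) 0 0.

(** At a zero of the generator the vanishing Lie derivative of [w] reduces to [B O + O B^T = 0], and
    [O] is skew. *)
Lemma hessian_symmetric : (B *m O)^T = B *m O.
Proof.
have ac : atlas S c := chart_at_atlas S p.
have cx : cod c x := cod_fwd (mem_chart_at S p).
have fx : fixed_point rho (bwd c x) by rewrite (bwd_fwd (mem_chart_at S p)).
have := lie_derivative0 hw ac cx.
rewrite (fixed_field0 cx fx) derive0 addr0 => /eqP.
rewrite addr_eq0 => /eqP E.
by rewrite trmx_mul form_in_skew mulNmx -E.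
Qed.

End Chart.

End Sign.

Section Extrema.
Variables (R : realType) (n : nat) (M : topologicalType).
Variables (S : smooth_structure R n M) (rho : circle_action S).
Variables (w : symplectic_form S).
Hypothesis hw : symplectic_action w rho.
Variable h : M -> R.
Hypothesis sh : forall c, atlas S c -> smooth_on (cod c) (h \o bwd c).
Hypothesis dh : forall p (v : 'rV[R]_n),
  'D_v (h \o bwd (chart_at S p)) (fwd (chart_at S p) p) =
  (v *m Defs.contraction (generator rho) w p) 0 0.
Variable p : M.
Local Notation c := (chart_at S p).
Local Notation x := (fwd c p).
Local Notation B := (field_jac rho c x).
Local Notation O := (form_in w c x).

Let ac : atlas S c := chart_at_atlas S p.
Let cx : cod c x := cod_fwd (mem_chart_at S p).

Lemma critical_fixed : (forall v, 'D_v (h \o bwd c) x = 0) -> fixed_point rho p.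
Proof.
move=> D0; have := critical_field0 sh dh ac cx D0.
by move/(field0_fixed ac cx); rewrite (bwd_fwd (mem_chart_at S p)).
Qed.

Lemma min_fixed_psd : (forall q, h p <= h q) -> fixed_point rho p /\ psd (B *m O).
Proof.
move=> hp; have H v : 'D_v (h \o bwd c) x = 0 /\ 0 <= 'D_v ('D_v (h \o bwd c)) x.
  apply: (min_second_derivative v (open_cod c) cx (sh ac)) => y _.
  by rewrite /= (bwd_fwd (mem_chart_at S p)).
have D0 v := (H v).1; have fp := critical_fixed D0.
split=> //; split; first exact: hessian_symmetric.
move=> v; rewrite -(second_derivative_hamiltonian sh dh v ac cx (critical_field0 sh dh ac cx D0)).
exact: (H v).2.
Qed.

Lemma max_fixed_psd : (forall q, h q <= h p) -> fixed_point rho p /\ psd (- (B *m O)).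
Proof.
move=> hp; pose f := h \o bwd c; have oc := open_cod c.
have E y v : cod c y -> 'D_v (fun y => - f y) y = - 'D_v f y.
  by move=> cy; apply: deriveN; exact: diff_derivable (smooth_on_diff (sh ac) cy).
have H v : 'D_v (fun y => - f y) x = 0 /\ 0 <= 'D_v ('D_v (fun y => - f y)) x.
  apply: (min_second_derivative v oc cx).
    by apply: smooth_on_opp; [exact: oc|exact: sh].
  by move=> y _; rewrite lerN2 /f /= (bwd_fwd (mem_chart_at S p)).
have D0 v : 'D_v f x = 0 by apply: oppr_inj; rewrite -(E x v cx) (H v).1 oppr0.
have fp := critical_fixed D0.
split=> //; split; first by rewrite raddfN /= hessian_symmetric.
move=> v; have := (H v).2.
have -> : 'D_v ('D_v (fun y => - f y)) x = - 'D_v ('D_v f) x.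
  apply: (etrans (derive_near v oc cx (g := fun y => - 'D_v f y) _)).
    by move=> y cy; exact: E.
  apply: deriveN; apply: diff_derivable.
  exact: (smooth_on_diff (smooth_on_derive v (sh ac)) cx).
rewrite (second_derivative_hamiltonian sh dh v ac cx (critical_field0 sh dh ac cx D0)).
by rewrite mulmxN mulNmx mx_oppE.
Qed.

End Extrema.

Lemma mul_sign_gt0 (F : realFieldType) (a b k l u v : F) : 0 < a -> b < 0 -> 0 < k ->
  u <= v -> b - a = - (4 * k) * l * (v - u) -> 0 < l.
Proof.
move=> a0 b0 k0 uv E; rewrite ltNge; apply/negP => l0.
have : 0 <= (4 * k) * ((- l) * (v - u)).
  by rewrite !mulr_ge0 ?ler0n ?oppr_ge0 ?subr_ge0 // ltW.
have -> : (4 * k) * ((- l) * (v - u)) = b - a by rewrite E; ring.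
lra.
Qed.

Section Conclusion.
Variables (R : realType) (n : nat) (M : topologicalType).
Variables (S : smooth_structure R n M) (rho : circle_action S).
Variables (w : symplectic_form S).
Hypotheses (hM : hausdorff_space M) (kM : compact [set: M]) (cM : connected [set: M]).
Hypothesis hw : symplectic_action w rho.
Hypothesis nt : nontrivial_action rho.
Variables (J : compatible_acs w) (nabla : affine_connection S).
Hypothesis pJ : preserves_acs nabla J.
Variable lambda : R.
Hypothesis hc : forall (p : M) (f : R * R -> M), spheroid p f ->
    forall a b : R, pi2_value S (chern_weil_form J nabla) p f a ->
      pi2_value S w p f b -> a = lambda * b.

Lemma hessian_neq0 p : let c := chart_at S p in fixed_point rho p ->
  field_jac rho c (fwd c p) *m form_in w c (fwd c p) != 0.
Proof.
move=> c fp; apply: contra (fixed_jac_neq0 hM cM nt fp) => /eqP B0; apply/eqP.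
have := f_equal (fun A => A *m invmx (form_in w c (fwd c p))) B0.
rewrite mul0mx mulmxK //.
exact: form_in_unit (chart_at_atlas S p) (cod_fwd (mem_chart_at S p)).
Qed.

Lemma hamiltonian_fixed_gt0 : hamiltonian_action w rho ->
  (exists p, fixed_point rho p) /\ 0 < lambda.
Proof.
move=> [h [sh dh]]; have M0 : [set: M] !=set0 by have [_ [p _]] := nt; exists p.
have ch : {within [set: M], continuous h}.
  by apply: continuous_subspaceT; exact: continuous_hamiltonian sh.
have [p _ hp] := compact_EVT_min M0 kM ch.
have [q _ hq] := compact_EVT_max M0 kM ch.
have hp' r : h p <= h r by apply: hp; rewrite inE.
have hq' r : h r <= h q by apply: hq; rewrite inE.
have [fp Pp] := min_fixed_psd hw sh dh hp'.
have [fq Pq] := max_fixed_psd hw sh dh hq'.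
split; first by exists p.
have [a Ea] := mean_weight_value hw J nabla fp.
have [b Eb] := mean_weight_value hw J nabla fq.
have wp : 0 < mean_weight rho J p.
  by rewrite Ea; apply: (weight_signs hw J fp a (hessian_neq0 fp)).1.
have wq : mean_weight rho J q < 0.
  by rewrite Eb; apply: (weight_signs hw J fq b (hessian_neq0 fq)).2.
(* Any path from p to q will do: along it [h] itself is the primitive that [main_formula] asks for,
   so only the extreme values of [h] enter. *)
have [r [gamma [P [sg g0 g1 _]]]] := path_ex rho w cM p q.
have := main_formula hw pJ sg (fun s h0 => (g0 s h0).1) (fun s h1 => (g1 s h1).1) fp fq hc
  (fun s => is_derive_hamiltonian sh dh s sg).
have l2 : (1 : R) <= 2 by rewrite ler1n.
rewrite (g1 2 l2).1 (g0 0 (lexx 0)).1 => E.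
exact: (mul_sign_gt0 wp wq (pi_gt0 R) (hp' q) E).
Qed.

Lemma fixed_hamiltonian : lambda != 0 -> (exists p, fixed_point rho p) ->
  hamiltonian_action w rho.
Proof.
move=> l0 [p fp]; apply: (@potential_hamiltonian _ _ _ _ _ _ cM p) => r.
move=> [gamma [P [sg g0 g1 dP]]].
have := main_formula hw pJ sg (fun s h0 => (g0 s h0).1) (fun s h1 => (g1 s h1).1) fp fp hc dP.
have l2 : (1 : R) <= 2 by rewrite ler1n.
rewrite subrr (g1 2 l2).2 (g0 0 (lexx 0)).2 subr0 => /esym/eqP.
have p0 : (4 * pi : R) != 0 by rewrite mulf_neq0 // gt_eqF // pi_gt0.
by rewrite !mulf_eq0 oppr_eq0 (negPf p0) (negPf l0) /= => /eqP.
Qed.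

End Conclusion.

Theorem corollary1p7 (R : realType) (n : nat) (M : topologicalType)
    (S : smooth_structure R n M) (w : symplectic_form S)
    (rho : circle_action S) (lambda : R) :
  hausdorff_space M -> compact [set: M] -> connected [set: M] ->
  symplectic_action w rho -> nontrivial_action rho ->
  c1_proportional_on_pi2 w lambda ->
  [/\ (0 < lambda ->
         (hamiltonian_action w rho <-> exists p, fixed_point rho p)),
      (lambda < 0 ->
         ~ hamiltonian_action w rho /\ ~ (exists p, fixed_point rho p)) &
      (lambda = 0 -> ~ hamiltonian_action w rho)].
Proof.
move=> hM kM cM hw nt [sigma [[J [nabla [pJ ->]]] hc]].
have hamP := hamiltonian_fixed_gt0 hM kM cM hw nt pJ hc.
have fixP := fixed_hamiltonian cM hw pJ hc.
split=> [l0|l0|l0].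
- split=> [/hamP[]//|fp]; apply: fixP => //; exact: lt0r_neq0.
- have nham : ~ hamiltonian_action w rho by move=> /hamP[_]; rewrite ltNge ltW.
  by split=> // fp; apply: nham; apply: fixP => //; exact: ltr0_neq0.
- by move=> /hamP[_]; rewrite l0 ltxx.
Qed.
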